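(* Let $P$ be a differentiable manifold, $\mathfrak{g}$ a Lie algebra, $\Gamma:\mathfrak{g}\to\mathcal{X}(P)$ a morphism of Lie algebras from $\mathfrak{g}$ to the Lie algebra of vector fields on $P$, and $r\in\wedge^2\mathfrak{g}$ a solution of the classical Yang-Baxter equation. Write $r=\sum_{i<j}a_{ij}\,u_i\wedge u_j$ in a basis $(u_1,\dots,u_n)$ of $\mathfrak{g}$, put $U_i=\Gamma(u_i)$, and for differential 1-forms $\alpha,\beta$ on $P$ put $$\mathcal{D}^{\Gamma}_\alpha\beta:=\sum_{i<j}a_{ij}\left(\alpha(U_i)L_{U_j}\beta-\alpha(U_j)L_{U_i}\beta\right).$$ Then: (i) $\mathcal{D}^{\Gamma}$ is a torsion-free and flat contravariant connection associated to the Poisson tensor $\Gamma(r)$, and it depends only on $r$ and $\Gamma$ (in particular, not on the basis $(u_i)$). (ii) If $P$ is a Riemannian manifold and $\Gamma(u)$ is a Killing vector field for any $u\in\mathrm{Im}\,r$, then $\mathcal{D}^{\Gamma}$ is the metric contravariant connection associated to the metric and $\Gamma(r)$. (iii) If the restriction of $\Gamma$ to $\mathrm{Im}\,r$ is a locally free action, then the metacurvature of $\mathcal{D}^{\Gamma}$ vanishes.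
   Context: Manifolds, vector fields and forms are smooth; Lie algebras are real and finite-dimensional; $L$ is the Lie derivative; $\mathcal{X}(P)$ is the Lie algebra of vector fields on $P$, and $\Omega^p(P)$ is the space of differential $p$-forms on $P$. **Yang-Baxter equation.** For $r\in\wedge^2\mathfrak{g}$, also write $r:\mathfrak{g}^*\to\mathfrak{g}$ for the induced linear map, $\beta(r(\alpha))=r(\alpha,\beta)$, and $\mathrm{Im}\,r$ for its image. $r$ is a solution of the classical Yang-Baxter equation if $[r,r]=0$, where $$[r,r](\alpha,\beta,\gamma)=\alpha([r(\beta),r(\gamma)])+\beta([r(\gamma),r(\alpha)])+\gamma([r(\alpha),r(\beta)]),\qquad \alpha,\beta,\gamma\in\mathfrak{g}^*.$$ Then $\mathrm{Im}\,r$ is a Lie subalgebra of $\mathfrak{g}$. With $r=\sum_{i<j}a_{ij}u_i\wedge u_j$, put $\Gamma(r)=\sum_{i<j}a_{ij}\Gamma(u_i)\wedge\Gamma(u_j)$, which is a Poisson tensor on $P$. The restriction of $\Gamma$ to $\mathrm{Im}\,r$ is a locally free action if for every $p\in P$ the linear map $\mathrm{Im}\,r\to T_pP$, $u\mapsto\Gamma(u)(p)$, is injective. **Contravariant connections.** Let $\pi$ be a Poisson tensor on $P$. The anchor $\pi_\#:T^*P\to TP$ is given by $\beta(\pi_\#(\alpha))=\pi(\alpha,\beta)$, the Poisson bracket of functions is $\{f,g\}=\pi(df,dg)$, and the Koszul bracket of 1-forms is $$[\alpha,\beta]_\pi=L_{\pi_\#(\alpha)}\beta-L_{\pi_\#(\beta)}\alpha-d(\pi(\alpha,\beta)).$$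 A contravariant connection (on $T^*P$) associated to $\pi$ is an $\mathbb{R}$-bilinear map $\mathcal{D}:\Omega^1(P)\times\Omega^1(P)\to\Omega^1(P)$, $(\alpha,\beta)\mapsto\mathcal{D}_\alpha\beta$, with $\mathcal{D}_{f\alpha}\beta=f\mathcal{D}_\alpha\beta$ and $\mathcal{D}_\alpha(f\beta)=f\mathcal{D}_\alpha\beta+\pi_\#(\alpha)(f)\beta$ for $f\in C^\infty(P)$. It is torsion-free if $\mathcal{D}_\alpha\beta-\mathcal{D}_\beta\alpha=[\alpha,\beta]_\pi$ for all $\alpha,\beta$, and flat if $\mathcal{D}_\alpha\mathcal{D}_\beta-\mathcal{D}_\beta\mathcal{D}_\alpha-\mathcal{D}_{[\alpha,\beta]_\pi}=0$ for all $\alpha,\beta$. It is extended to functions by $\mathcal{D}_\alpha f=\pi_\#(\alpha)(f)$ and to all forms so that each $\mathcal{D}_\alpha$ is a degree $0$ derivation of the wedge product. **Metric contravariant connection.** Given a (pseudo-)Riemannian metric on $P$, with $\langle\,,\rangle$ the induced metric on $T^*P$, the metric contravariant connection associated to the metric and $\pi$ is the unique torsion-free contravariant connection $D$ associated to $\pi$ such that $\pi_\#(\alpha)\cdot\langle\beta,\gamma\rangle=\langle D_\alpha\beta,\gamma\rangle+\langle\beta,D_\alpha\gamma\rangle$ for all 1-forms $\alpha,\beta,\gamma$. **Metacurvature.** Let $\mathcal{D}$ be a torsion-free and flat contravariant connection associated to $\pi$. There is a bracket $\{\,,\}$ on $\Omega^*(P)$ (the generalized Poisson bracket), characterized by: it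 is $\mathbb{R}$-bilinear, of degree $0$, and $\{\sigma,\rho\}=-(-1)^{\deg\sigma\deg\rho}\{\rho,\sigma\}$; $d\{\sigma,\rho\}=\{d\sigma,\rho\}+(-1)^{\deg\sigma}\{\sigma,d\rho\}$; $\{\sigma,\rho\wedge\lambda\}=\{\sigma,\rho\}\wedge\lambda+(-1)^{\deg\sigma\deg\rho}\rho\wedge\{\sigma,\lambda\}$; for functions $f,g$ the bracket $\{f,g\}$ is the Poisson bracket of $\pi$, and $\{f,\sigma\}=\mathcal{D}_{df}\sigma$ for every form $\sigma$. The metacurvature of $\mathcal{D}$ is the tensor field $\mathcal{M}$ ($C^\infty(P)$-trilinear on 1-forms, with values in 2-forms) determined by $$\mathcal{M}(df,\alpha,\beta)=\{f,\{\alpha,\beta\}\}-\{\{f,\alpha\},\beta\}-\{\{f,\beta\},\alpha\}$$ for functions $f$ and 1-forms $\alpha,\beta$. It vanishes if and only if the generalized Poisson bracket satisfies the graded Jacobi identity $\{\{\sigma,\rho\},\lambda\}=\{\sigma,\{\rho,\lambda\}\}-(-1)^{\deg\sigma\deg\rho}\{\rho,\{\sigma,\lambda\}\}$. *)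

(* Defs.v *)
From HB Require Import structures.
From mathcomp Require Import all_boot all_order all_algebra.
From mathcomp Require Import all_classical all_reals all_analysis.

Set Implicit Arguments.
Unset Strict Implicit.
Unset Printing Implicit Defensive.

Import Order.TTheory GRing.Theory Num.Theory.
Import numFieldNormedType.Exports.

Local Open Scope classical_set_scope.
Local Open Scope ring_scope.

Lemma differentiable_near_eq (R : realType) (V W : normedModType R)
    (f g : V -> W) (x : V) :
  (\near x, f x = g x) -> differentiable f x -> differentiable g x.
Proof.
move=> fg df.
have fgx : f x = g x by exact: (nbhs_singleton fg).
pose h : V -> W := g - f.
have h0 : differentiable h x.
  have hx : h x = 0 by change (g x - f x = 0); rewrite fgx subrr.
  have E : h \o shift x = cst (h x) + \0 +o_ 0 id.
    apply/eqaddoP => e e0.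
    have : \forall y \near 0, f (y + x) = g (y + x).
      by move: fg; rewrite (near_shift 0 x); apply: filterS => y /=; rewrite subr0.
    apply: filterS => y fgy.
    have hyx : h (y + x) = 0 by change (g (y + x) - f (y + x) = 0); rewrite fgy subrr.
    have -> : (h \o shift x - (cst (h x) + \0)) y = 0.
      by change (h (y + x) - (h x + 0) = 0); rewrite hyx hx addr0 subrr.
    by rewrite normr0 mulr_ge0 // ltW.
  have dE : 'd h x = \0 :> (V -> W) by apply: diff_unique => //; exact: cst_continuous.
  by apply/diff_locallyP; rewrite dE; split => //; exact: cst_continuous.
by have := differentiableD df h0; rewrite addrC subrK.
Qed.

(** * Smooth functions on open subsets of R^d *)

Section SmoothRd.
Variables (R : realType) (d : nat).
Implicit Types (U : set 'rV[R]_d) (f g : 'rV[R]_d -> R).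

(* k-fold Frechet differentiability on U: f and all its iterated directional
   derivatives of order less than k are Frechet differentiable at the points
   of the open set U. For all k together this is C^oo. *)
Fixpoint ndifferentiable (k : nat) U f : Prop :=
  if k is k'.+1 then
    (forall x, U x -> differentiable f x) /\
    (forall v, ndifferentiable k' U ('D_v f))
  else True.

Definition smooth_on U f := forall k, ndifferentiable k U f.

Lemma ndifferentiable_ext k U f g : open U -> (forall x, U x -> f x = g x) ->
  ndifferentiable k U f -> ndifferentiable k U g.
Proof.
move=> Uo; elim: k f g => [//|k IH] f g fg [df Df].
have near_fg x : U x -> \near x, f x = g x.
  by move=> Ux; move/open_nbhs_nbhs: (conj Uo Ux); exact: filterS.
split=> [x Ux|v]; first exact: differentiable_near_eq (near_fg x Ux) (df x Ux).
by apply: IH (Df v) => x Ux; apply: near_eq_derive (near_fg x Ux).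
Qed.

Lemma ndifferentiableW k U f : ndifferentiable k.+1 U f -> ndifferentiable k U f.
Proof.
elim: k f => [//|k IH] f [df Df]; split=> // v; exact: IH (Df v).
Qed.

Lemma ndifferentiable_cst k U c : ndifferentiable k U (cst c).
Proof.
elim: k c => [//|k IH] c; split=> [x _|v]; first exact: differentiable_cst.
suff -> : 'D_v (cst c : 'rV[R]_d -> R) = cst 0 by exact: IH.
by apply/funext => x; rewrite derive_cst.
Qed.

Lemma ndifferentiableD k U f g : open U ->
  ndifferentiable k U f -> ndifferentiable k U g -> ndifferentiable k U (f + g).
Proof.
move=> Uo; elim: k f g => [//|k IH] f g [df Df] [dg Dg].
split=> [x Ux|v]; first exact: differentiableD (df x Ux) (dg x Ux).
apply: ndifferentiable_ext Uo _ (IH _ _ (Df v) (Dg v)) => x Ux.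
by rewrite deriveD //; apply: diff_derivable; auto.
Qed.

Lemma ndifferentiableM k U f g : open U ->
  ndifferentiable k U f -> ndifferentiable k U g -> ndifferentiable k U (f * g).
Proof.
move=> Uo; elim: k f g => [//|k IH] f g fk gk.
have [df Df] := fk; have [dg Dg] := gk.
split=> [x Ux|v]; first exact: differentiableM (df x Ux) (dg x Ux).
have fk' := ndifferentiableW fk; have gk' := ndifferentiableW gk.
have := ndifferentiableD Uo (IH _ _ fk' (Dg v)) (IH _ _ gk' (Df v)).
apply: ndifferentiable_ext Uo _ => x Ux.
by rewrite deriveM //; apply: diff_derivable; auto.
Qed.

End SmoothRd.

(** * Smooth manifolds *)

Section Manifold.
Variables (R : realType) (d : nat).

(* A homeomorphism [chart_map] of the open set [chart_dom] onto an open subset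
   of R^d, with inverse [chart_inv]; the values of the two maps outside these
   sets are irrelevant. *)
Record chart (T : topologicalType) := Chart {
  chart_dom : set T;
  chart_map : T -> 'rV[R]_d;
  chart_inv : 'rV[R]_d -> T;
  chart_domO : open chart_dom;
  chart_imgO : open (chart_map @` chart_dom);
  chart_mapK : forall p, chart_dom p -> chart_inv (chart_map p) = p;
  chart_mapC : forall p, chart_dom p -> {for p, continuous chart_map};
  chart_invC : forall x, (chart_map @` chart_dom) x ->
    {for x, continuous chart_inv}
}.

Definition smooth_transition T (c c' : chart T) := forall i : 'I_d,
  smooth_on (chart_map c @` (chart_dom c `&` chart_dom c'))
            (fun x => chart_map c' (chart_inv c x) 0 i).

Record manifold := Manifold {
  points :> topologicalType;
  manifold_hausdorff : hausdorff_space points;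
  manifold_second_countable : @second_countable points;
  atlas : set (chart points);
  atlas_cover : forall p, exists2 c, atlas c & chart_dom c p;
  atlas_smooth : forall c c', atlas c -> atlas c' -> smooth_transition c c'
}.

Definition smooth_map (P : manifold) (f : P -> R) := forall c, atlas c ->
  smooth_on (chart_map c @` chart_dom c) (f \o chart_inv c).

Definition smooth_pred (P : manifold) : {pred P -> R} :=
  [pred f | `[< smooth_map f >]].

(* The commutative R-algebra of smooth functions; its operations are
   pointwise. *)
Record Cinf (P : manifold) := MkCinf {
  cinf_fun :> P -> R;
  cinf_smooth : cinf_fun \in @smooth_pred P
}.

End Manifold.

Section CinfAlgebra.
Variables (R : realType) (d : nat) (P : manifold R d).

HB.instance Definition _ := [isSub for @cinf_fun R d P].
HB.instance Definition _ := [Choice of Cinf P by <:].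

Lemma smooth_predP (f : P -> R) : reflect (smooth_map f) (f \in @smooth_pred R d P).
Proof. exact: asboolP. Qed.

Lemma smooth_map_cst (a : R) : smooth_map (cst a : P -> R).
Proof. by move=> c _ k; exact: ndifferentiable_cst. Qed.

Lemma smooth_mapD (f g : P -> R) : smooth_map f -> smooth_map g -> smooth_map (f + g).
Proof.
move=> fs gs c Ac k.
exact (ndifferentiableD (@chart_imgO R d P c) (fs _ Ac k) (gs _ Ac k)).
Qed.

Lemma smooth_mapM (f g : P -> R) : smooth_map f -> smooth_map g -> smooth_map (f * g).
Proof.
move=> fs gs c Ac k.
exact (ndifferentiableM (@chart_imgO R d P c) (fs _ Ac k) (gs _ Ac k)).
Qed.

Lemma smooth_mapZ (a : R) (f : P -> R) : smooth_map f -> smooth_map (a *: f).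
Proof. by move=> fs; exact: smooth_mapM (smooth_map_cst a) fs. Qed.

Fact smooth_subring : subring_closed (@smooth_pred R d P).
Proof.
split=> [|f g /smooth_predP fs /smooth_predP gs|f g /smooth_predP fs /smooth_predP gs];
  apply/smooth_predP.
- exact: smooth_map_cst.
- by rewrite -scaleN1r; apply: smooth_mapD => //; exact: smooth_mapZ.
- exact: smooth_mapM.
Qed.

Fact smooth_scaler : GRing.scaler_closed (@smooth_pred R d P).
Proof. by move=> a f /smooth_predP fs; apply/smooth_predP; exact: smooth_mapZ. Qed.

HB.instance Definition _ :=
  GRing.isSubringClosed.Build (P -> R) (@smooth_pred R d P) smooth_subring.
HB.instance Definition _ :=
  GRing.isScaleClosed.Build R (P -> R) (@smooth_pred R d P) smooth_scaler.
HB.instance Definition _ := 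
  GRing.SubChoice_isSubComPzRing.Build _ _ (Cinf P) smooth_subring.
HB.instance Definition _ := [SubZmodule_isSubLmodule of Cinf P by <:].

End CinfAlgebra.

(** * Vector fields *)

(* A vector field on P is a derivation of the algebra of smooth functions. Its value
   at p is the tangent vector f |-> (X f)(p), so that this is the same thing as
   a smooth section of the tangent bundle. *)
Record vfield (R : realType) (d : nat) (P : manifold R d) := VField {
  vf_fun :> Cinf P -> Cinf P;
  vf_linear : forall (a : R) f g, vf_fun (a *: f + g) = a *: vf_fun f + vf_fun g;
  vf_leibniz : forall f g, vf_fun (f * g) = f * vf_fun g + vf_fun f * g
}.

Section VectorFields.
Variables (R : realType) (d : nat) (P : manifold R d).
Implicit Types (X Y Z : vfield P) (f g h : Cinf P).

Definition tangent X (p : P) : Cinf P -> R := fun f => X f p.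

Lemma vfP X Y : X =1 Y -> X = Y.
Proof.
case: X Y => [X lX mX] [Y lY mY] /= /funext XY; subst Y.
by congr VField; exact: Prop_irrelevance.
Qed.

HB.instance Definition _ := gen_eqMixin (vfield P).
HB.instance Definition _ := gen_choiceMixin (vfield P).

Program Definition vf_zero := @VField R d P (fun=> 0) _ _.
Next Obligation. by move=> * /=; rewrite scaler0 addr0. Qed.
Next Obligation. by move=> * /=; rewrite mulr0 mul0r addr0. Qed.

Program Definition vf_opp X := @VField R d P (fun f => - X f) _ _.
Next Obligation. by move=> * /=; rewrite vf_linear opprD scalerN. Qed.
Next Obligation. by move=> * /=; rewrite vf_leibniz opprD mulrN mulNr. Qed.

Program Definition vf_add X Y := @VField R d P (fun f => X f + Y f) _ _.
Next Obligation. by move=> * /=; rewrite !vf_linear scalerDr addrACA. Qed.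
Next Obligation. by move=> * /=; rewrite !vf_leibniz mulrDr mulrDl addrACA. Qed.

Lemma Cinf_scalerAl (a : R) f g : a *: (f * g) = (a *: f) * g.
Proof. by apply/val_inj/funext => p; exact: mulrA. Qed.

Lemma Cinf_scalerAr (a : R) f g : a *: (f * g) = f * (a *: g).
Proof. by rewrite mulrC Cinf_scalerAl mulrC. Qed.

Program Definition vf_scale h X := @VField R d P (fun f => h * X f) _ _.
Next Obligation. by move=> * /=; rewrite vf_linear mulrDr -Cinf_scalerAr. Qed.
Next Obligation.
by move=> * /=; rewrite vf_leibniz mulrDr mulrCA; congr (_ + _); exact: mulrA.
Qed.

Fact vf_addA : associative vf_add.
Proof. by move=> X Y Z; apply: vfP => f; exact: addrA. Qed.
Fact vf_addC : commutative vf_add.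
Proof. by move=> X Y; apply: vfP => f; exact: addrC. Qed.
Fact vf_add0 : left_id vf_zero vf_add.
Proof. by move=> X; apply: vfP => f; exact: add0r. Qed.
Fact vf_addN : left_inverse vf_zero vf_opp vf_add.
Proof. by move=> X; apply: vfP => f; exact: addNr. Qed.

HB.instance Definition _ := GRing.isZmodule.Build (vfield P)
  vf_addA vf_addC vf_add0 vf_addN.

Fact vf_scaleA f g X : vf_scale f (vf_scale g X) = vf_scale (f * g) X.
Proof. by apply: vfP => h; exact: mulrA. Qed.
Fact vf_scale1 : left_id 1 vf_scale.
Proof. by move=> X; apply: vfP => f; exact: mul1r. Qed.
Fact vf_scaleDr : right_distributive vf_scale +%R.
Proof. by move=> f X Y; apply: vfP => h; exact: mulrDr. Qed.
Fact vf_scaleDl X : {morph vf_scale^~ X : f g / f + g}.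
Proof. by move=> f g; apply: vfP => h; exact: mulrDl. Qed.

HB.instance Definition _ := GRing.Zmodule_isLmodule.Build (Cinf P) (vfield P)
  vf_scaleA vf_scale1 vf_scaleDr vf_scaleDl.

Lemma vfD X f g : X (f + g) = X f + X g.
Proof. by rewrite -[f]scale1r vf_linear !scale1r. Qed.

Lemma vf0 X : X 0 = 0.
Proof. by apply: (addIr (X 0)); rewrite -vfD addr0 add0r. Qed.

Lemma vfN X f : X (- f) = - X f.
Proof. by apply: (addIr (X f)); rewrite -vfD !addNr vf0. Qed.

Lemma vfZ X (a : R) f : X (a *: f) = a *: X f.
Proof. by rewrite -[a *: f]addr0 vf_linear vf0 addr0. Qed.

Program Definition lieb X Y := @VField R d P (fun f => X (Y f) - Y (X f)) _ _.
Next Obligation. by move=> * /=; rewrite !vf_linear opprD scalerBr addrACA. Qed.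
Next Obligation.
move=> X Y f g /=; rewrite !(vf_leibniz, vfD) mulrBr mulrBl !opprD.
rewrite [LHS](AC ((2*2)*(2*2)) (((1*5)*(4*8))*((2*7)*(3*6)))) /=.
by rewrite !subrr !addr0.
Qed.

End VectorFields.

(** * Differential forms *)

(* Forms of all degrees live in one type, so that degrees never have to be
   matched by casts: a k-form is a function of lists of vector fields which
   vanishes on the lists of length other than k and is C^oo-multilinear and
   alternating on those of length k. In particular a 1-form alpha is evaluated
   as [alpha [:: X]]. *)
Definition pform (R : realType) (d : nat) (P : manifold R d) : Type :=
  seq (vfield P) -> Cinf P.

Section Forms.
Variables (R : realType) (d : nat) (P : manifold R d).
Implicit Types (X Y : vfield P) (f g : Cinf P) (s : seq (vfield P)).
Implicit Types (w sigma rho : pform P).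

Definition is_form (k : nat) w : Prop :=
  [/\ forall s, size s != k -> w s = 0,
      forall s t f X Y,
        w (s ++ (f *: X + Y) :: t) = f * w (s ++ X :: t) + w (s ++ Y :: t)
    & forall s t u X, w (s ++ X :: t ++ X :: u) = 0].

Definition form0 f : pform P := fun s => if s is [::] then f else 0.

Definition fscale f w : pform P := fun s => f * w s.

Definition del (i : nat) s := take i s ++ drop i.+1 s.

(* The exterior derivative: the i-th argument of s is [nth 0 s i]. *)
Definition ext_d w : pform P := fun s =>
  \sum_(i < size s) (-1 : R) ^+ i *: nth 0 s i (w (del i s))
  + \sum_(i < size s) \sum_(j < size s | (i < j)%N)
      (-1 : R) ^+ (i + j) *: w (lieb (nth 0 s i) (nth 0 s j) :: del i (del j s)).

Definition lie X w : pform P := fun s =>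
  X (w s) - \sum_(i < size s) w (set_nth 0 s i (lieb X (nth 0 s i))).

(* The shuffle formula: the sum over all ways of distributing the arguments,
   in order, between sigma and rho. A vector field given to rho contributes -1
   for each of the later ones given to sigma; [twist] accounts for this sign. *)
Definition twist w : pform P := fun s => (-1 : R) ^+ size s *: w s.

Definition interior X w : pform P := fun s => w (X :: s).

Fixpoint shuffle s sigma rho : Cinf P :=
  if s is X :: t then
    shuffle t (interior X sigma) rho + shuffle t (twist sigma) (interior X rho)
  else sigma [::] * rho [::].

Definition wedge sigma rho : pform P := fun s => shuffle s sigma rho.

End Forms.

Section LowDegree.
Variables (R : realType) (d : nat) (P : manifold R d).
Implicit Types (X Y : vfield P) (f : Cinf P) (alpha beta : pform P).

Lemma ext_d_form0E f X : ext_d (form0 f) [:: X] = X f.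
Proof.
rewrite /ext_d /= !big_ord1 /= expr0 scale1r.
by rewrite big_pred0 ?addr0 // => j; rewrite ord1.
Qed.

Lemma wedge11E alpha beta X Y : is_form 1 alpha -> is_form 1 beta ->
  wedge alpha beta [:: X; Y] =
  alpha [:: X] * beta [:: Y] - alpha [:: Y] * beta [:: X].
Proof.
move=> [a0 _ _] [b0 _ _]; rewrite /wedge /= /interior /twist /=.
rewrite !(a0 [:: _; _], a0 [::], b0 [:: _; _], b0 [::]) //.
by rewrite !(scaler0, mul0r, mulr0, add0r, addr0) expr0 expr1 scale1r scaleN1r mulNr.
Qed.

Lemma ext_d1E alpha X Y : ext_d alpha [:: X; Y] =
  X (alpha [:: Y]) - Y (alpha [:: X]) - alpha [:: lieb X Y].
Proof.
rewrite /ext_d /= !big_ord_recl !big_ord0 /=.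
rewrite [\sum_(j < 2 | (0 < j)%N) _]big_mkcond.
rewrite [\sum_(j < 2 | (bump 0 0 < j)%N) _]big_mkcond.
rewrite !big_ord_recl !big_ord0 /= /bump /= !(addr0, add0r, expr0, expr1).
by rewrite !(scale1r, scaleN1r).
Qed.

Lemma lie1E alpha X Y :
  lie X alpha [:: Y] = X (alpha [:: Y]) - alpha [:: lieb X Y].
Proof. by rewrite /lie /= big_ord1. Qed.

End LowDegree.

(** * Contravariant connections *)

Section Contravariant.
Variables (R : realType) (d : nat) (P : manifold R d).
Implicit Types (f g h : Cinf P) (alpha beta gamma : pform P).
Implicit Types (pi : pform P -> pform P -> Cinf P).
Implicit Types (D E : pform P -> pform P -> pform P).

Definition df f : pform P := ext_d (form0 f).

Definition poisson_bracket pi f g : Cinf P := pi (df f) (df g).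

Definition is_bivector_field pi :=
  (forall f alpha alpha' beta, is_form 1 alpha -> is_form 1 alpha' ->
     is_form 1 beta -> pi (fscale f alpha + alpha') beta
                       = f * pi alpha beta + pi alpha' beta) /\
  (forall alpha beta, is_form 1 alpha -> is_form 1 beta ->
     pi alpha beta = - pi beta alpha).

Definition is_poisson pi :=
  is_bivector_field pi /\
  forall f g h, let br := poisson_bracket pi in
    br f (br g h) + br g (br h f) + br h (br f g) = 0.

Definition anchor pi alpha : vfield P :=
  xget 0 [set X | forall beta, is_form 1 beta -> beta [:: X] = pi alpha beta].

Definition koszul pi alpha beta : pform P :=
  lie (anchor pi alpha) beta - lie (anchor pi beta) alpha - df (pi alpha beta).

Record contravariant_connection pi D : Prop := ContravariantConnection {
  cc_form : forall alpha beta, is_form 1 alpha -> is_form 1 beta ->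
    is_form 1 (D alpha beta);
  cc_linearl : forall (a : R) alpha alpha' beta,
    is_form 1 alpha -> is_form 1 alpha' -> is_form 1 beta ->
    D (a *: alpha + alpha') beta = a *: D alpha beta + D alpha' beta;
  cc_linearr : forall (a : R) alpha beta beta',
    is_form 1 alpha -> is_form 1 beta -> is_form 1 beta' ->
    D alpha (a *: beta + beta') = a *: D alpha beta + D alpha beta';
  cc_scalel : forall f alpha beta, is_form 1 alpha -> is_form 1 beta ->
    D (fscale f alpha) beta = fscale f (D alpha beta);
  cc_scaler : forall f alpha beta, is_form 1 alpha -> is_form 1 beta ->
    D alpha (fscale f beta)
    = fscale f (D alpha beta) + fscale (anchor pi alpha f) beta
}.

Definition torsion_free pi D := forall alpha beta,
  is_form 1 alpha -> is_form 1 beta ->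
  D alpha beta - D beta alpha = koszul pi alpha beta.

Definition flat_connection pi D := forall alpha beta gamma,
  is_form 1 alpha -> is_form 1 beta -> is_form 1 gamma ->
  D alpha (D beta gamma) - D beta (D alpha gamma)
  - D (koszul pi alpha beta) gamma = 0.

(* E is the extension of D to forms of all degrees. *)
Record extension_to_forms pi D E : Prop := ExtensionToForms {
  ext_form : forall k alpha w, is_form 1 alpha -> is_form k w ->
    is_form k (E alpha w);
  ext_linear : forall k (a : R) alpha w w',
    is_form 1 alpha -> is_form k w -> is_form k w' ->
    E alpha (a *: w + w') = a *: E alpha w + E alpha w';
  ext_fun : forall alpha f, is_form 1 alpha ->
    E alpha (form0 f) = form0 (anchor pi alpha f);
  ext_form1 : forall alpha beta, is_form 1 alpha -> is_form 1 beta ->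
    E alpha beta = D alpha beta;
  ext_wedge : forall k l alpha w w',
    is_form 1 alpha -> is_form k w -> is_form l w' ->
    E alpha (wedge w w') = wedge (E alpha w) w' + wedge w (E alpha w')
}.

(* The conditions that characterize the generalized Poisson bracket, on
   homogeneous forms. *)
Record generalized_poisson_bracket pi D (br : pform P -> pform P -> pform P)
    : Prop := GeneralizedPoissonBracket {
  gpb_form : forall k l sigma rho, is_form k sigma -> is_form l rho ->
    is_form (k + l) (br sigma rho);
  gpb_linearl : forall k l (a : R) sigma sigma' rho,
    is_form k sigma -> is_form k sigma' -> is_form l rho ->
    br (a *: sigma + sigma') rho = a *: br sigma rho + br sigma' rho;
  gpb_linearr : forall k l (a : R) sigma rho rho',
    is_form k sigma -> is_form l rho -> is_form l rho' ->
    br sigma (a *: rho + rho') = a *: br sigma rho + br sigma rho';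
  gpb_skew : forall k l sigma rho, is_form k sigma -> is_form l rho ->
    br sigma rho = - ((-1 : R) ^+ (k * l) *: br rho sigma);
  gpb_d : forall k l sigma rho, is_form k sigma -> is_form l rho ->
    ext_d (br sigma rho)
    = br (ext_d sigma) rho + (-1 : R) ^+ k *: br sigma (ext_d rho);
  gpb_wedge : forall k l m sigma rho lambda,
    is_form k sigma -> is_form l rho -> is_form m lambda ->
    br sigma (wedge rho lambda)
    = wedge (br sigma rho) lambda
      + (-1 : R) ^+ (k * l) *: wedge rho (br sigma lambda);
  gpb_fun : forall f g,
    br (form0 f) (form0 g) = form0 (poisson_bracket pi f g);
  gpb_connection : exists2 E, extension_to_forms pi D E &
    forall k f sigma, is_form k sigma -> br (form0 f) sigma = E (df f) sigma
}.

Record metacurvature (br : pform P -> pform P -> pform P)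
    (M : pform P -> pform P -> pform P -> pform P) : Prop := Metacurvature {
  mc_form : forall alpha beta gamma,
    is_form 1 alpha -> is_form 1 beta -> is_form 1 gamma ->
    is_form 2 (M alpha beta gamma);
  mc_linear1 : forall f alpha alpha' beta gamma, is_form 1 alpha ->
    is_form 1 alpha' -> is_form 1 beta -> is_form 1 gamma ->
    M (fscale f alpha + alpha') beta gamma
    = fscale f (M alpha beta gamma) + M alpha' beta gamma;
  mc_linear2 : forall f alpha beta beta' gamma, is_form 1 alpha ->
    is_form 1 beta -> is_form 1 beta' -> is_form 1 gamma ->
    M alpha (fscale f beta + beta') gamma
    = fscale f (M alpha beta gamma) + M alpha beta' gamma;
  mc_linear3 : forall f alpha beta gamma gamma', is_form 1 alpha ->
    is_form 1 beta -> is_form 1 gamma -> is_form 1 gamma' ->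
    M alpha beta (fscale f gamma + gamma')
    = fscale f (M alpha beta gamma) + M alpha beta gamma';
  mc_exact : forall f alpha beta, is_form 1 alpha -> is_form 1 beta ->
    M (df f) alpha beta
    = br (form0 f) (br alpha beta)
      - br (br (form0 f) alpha) beta - br (br (form0 f) beta) alpha
}.

(* The bracket and the tensor are determined by the conditions above; their
   existence is part of the claim, so that the second clause is not vacuous. *)
Definition metacurvature_vanishes pi D :=
  (exists br M, generalized_poisson_bracket pi D br /\ metacurvature br M) /\
  (forall br M, generalized_poisson_bracket pi D br -> metacurvature br M ->
     forall alpha beta gamma,
       is_form 1 alpha -> is_form 1 beta -> is_form 1 gamma ->
       M alpha beta gamma = 0).

End Contravariant.

(** * Riemannian metrics *)

Record riemannian_metric (R : realType) (d : nat) (P : manifold R d) :=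
  RiemannianMetric {
  metric_fun :> vfield P -> vfield P -> Cinf P;
  metric_linear : forall f X Y Z,
    metric_fun (f *: X + Y) Z = f * metric_fun X Z + metric_fun Y Z;
  metric_sym : forall X Y, metric_fun X Y = metric_fun Y X;
  metric_pos : forall X p, tangent X p <> (fun=> 0) -> 0 < metric_fun X X p
}.

Section Riemannian.
Variables (R : realType) (d : nat) (P : manifold R d).
Variable (m : riemannian_metric P).
Implicit Types (alpha beta gamma : pform P) (X Y V : vfield P).

Definition sharp alpha : vfield P :=
  xget 0 [set X | forall Y, m X Y = alpha [:: Y]].

Definition cometric alpha beta : Cinf P := m (sharp alpha) (sharp beta).

(* L_V m = 0 *)
Definition killing V := forall X Y,
  V (m X Y) - m (lieb V X) Y - m X (lieb V Y) = 0.

Definition metric_contravariant_connection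
    (pi : pform P -> pform P -> Cinf P) (D : pform P -> pform P -> pform P) :=
  [/\ contravariant_connection pi D, torsion_free pi D
    & forall alpha beta gamma,
        is_form 1 alpha -> is_form 1 beta -> is_form 1 gamma ->
        anchor pi alpha (cometric beta gamma)
        = cometric (D alpha beta) gamma + cometric beta (D alpha gamma)].

End Riemannian.

(** * Lie algebras and the classical Yang-Baxter equation *)

Record lie_algebra (R : realType) := LieAlgebra {
  lie_space :> vectType R;
  lie_bracket : lie_space -> lie_space -> lie_space;
  lie_linear : forall (a : R) u v w,
    lie_bracket (a *: u + v) w = a *: lie_bracket u w + lie_bracket v w;
  lie_skew : forall u v, lie_bracket u v = - lie_bracket v u;
  lie_jacobi : forall u v w,
    lie_bracket u (lie_bracket v w) + lie_bracket v (lie_bracket w u)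
    + lie_bracket w (lie_bracket u v) = 0
}.

Section YangBaxter.
Variables (R : realType) (g : lie_algebra R).

Definition dual := 'Hom(g, R^o).

(* An element of the second exterior power of g is a skew-symmetric bilinear
   form on the dual of g, where u /\ v is [bivector_wedge u v]. *)
Record bivector := Bivector {
  bv_fun :> dual -> dual -> R;
  bv_linear : forall (a : R) alpha alpha' beta,
    bv_fun (a *: alpha + alpha') beta = a * bv_fun alpha beta + bv_fun alpha' beta;
  bv_skew : forall alpha beta, bv_fun alpha beta = - bv_fun beta alpha
}.
Implicit Types (r : bivector) (alpha beta gamma : dual) (u v : g).

Definition bivector_wedge u v alpha beta : R :=
  alpha u * beta v - alpha v * beta u.

(* r = \sum_(i < j) a_ij u_i /\ u_j, where u is a basis of g. *)
Definition bivector_expansion r n (u : n.-tuple g) (a : 'M[R]_n) :=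
  basis_of fullv u /\
  forall alpha beta, r alpha beta =
    \sum_(i < n) \sum_(j < n | (i < j)%N)
      a i j * bivector_wedge (tnth u i) (tnth u j) alpha beta.

Definition bivector_map r alpha : g :=
  let b := vbasis {: g} in
  \sum_(i < \dim {: g}) r alpha (linfun (coord b i)) *: tnth b i.

Lemma bivector_mapE r alpha beta : beta (bivector_map r alpha) = r alpha beta.
Proof.
have r0 gamma : r 0 gamma = 0.
  have := bv_linear r 1 0 0 gamma; rewrite scale1r addr0 mul1r => /eqP.
  by rewrite -subr_eq subrr eq_sym => /eqP.
have rr (a : R) b b' : r alpha (a *: b + b') = a * r alpha b + r alpha b'.
  by rewrite bv_skew bv_linear opprD -mulrN -!(bv_skew r alpha).
set b := vbasis {: g}; pose c i : dual := linfun (coord b i : g -> R^o).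
have -> : r alpha beta = r alpha (\sum_(i < \dim {: g}) beta (tnth b i) *: c i).
  congr (r alpha _); apply/lfunP => v.
  rewrite {1}(coord_basis (vbasisP {: g}) (memvf v)) linear_sum sum_lfunE.
  apply: eq_bigr => i _; rewrite linearZ scale_lfunE lfunE (tnth_nth 0).
  exact: mulrC.
have rB : r alpha 0 = 0 by rewrite bv_skew r0 oppr0.
rewrite /bivector_map -/b linear_sum.
elim/big_ind2 : _ => [//|x1 x2 y1 y2 -> ->|i _].
  by have := rr 1 x1 y1; rewrite scale1r mul1r.
by rewrite linearZ -[_ *: c i]addr0 rr rB addr0; exact: mulrC.
Qed.

Definition im_bivector r u := exists alpha, u = bivector_map r alpha.

Definition yang_baxter r := forall alpha beta gamma,
  alpha (lie_bracket (bivector_map r beta) (bivector_map r gamma))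
  + beta (lie_bracket (bivector_map r gamma) (bivector_map r alpha))
  + gamma (lie_bracket (bivector_map r alpha) (bivector_map r beta)) = 0.

End YangBaxter.

(** * Actions *)

Section Action.
Variables (R : realType) (d : nat) (P : manifold R d) (g : lie_algebra R).
Variable (Gamma : g -> vfield P).

(* [a *: 1] is the constant function a. *)
Definition lie_morphism :=
  (forall (a : R) u v,
     Gamma (a *: u + v) = (a *: (1 : Cinf P)) *: Gamma u + Gamma v) /\
  (forall u v, Gamma (lie_bracket u v) = lieb (Gamma u) (Gamma v)).

Definition locally_free_on (V : g -> Prop) := forall p u v, V u -> V v ->
  tangent (Gamma u) p = tangent (Gamma v) p -> u = v.

Variables (n : nat) (u : n.-tuple g) (a : 'M[R]_n).
Let U i := Gamma (tnth u i).

Definition Gamma_bivector (alpha beta : pform P) : Cinf P :=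
  \sum_(i < n) \sum_(j < n | (i < j)%N)
    a i j *: (alpha [:: U i] * beta [:: U j] - alpha [:: U j] * beta [:: U i]).

Definition Gamma_connection (alpha beta : pform P) : pform P :=
  \sum_(i < n) \sum_(j < n | (i < j)%N)
    a i j *: (fscale (alpha [:: U i]) (lie (U j) beta)
              - fscale (alpha [:: U j]) (lie (U i) beta)).

End Action.

(* Main.v *)
(** Write [r = \sum_k e_k (x) v_k] with [e_k] a basis of [g] and [v_k = r(e_k^* )],
    and put [U_k = Gamma e_k], [V_k = Gamma v_k]. Then
      [D_alpha w = \sum_k alpha(U_k) L_{V_k} w]
    for a form [w] of any degree, and the generalized Poisson bracket is
      [{sigma, rho} = \sum_k L_{U_k} sigma /\ L_{V_k} rho].
    Expanded by the Leibniz rules, the curvature of [D] and the metacurvature are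
    both equal to
      [\sum_ij F(e_i, e_j, [v_i, v_j]) + F(e_i, [v_i, e_j], v_j) - F([v_i, e_j], e_i, v_j)]
    for a trilinear [F], that is, to a contraction of [F] with the Yang-Baxter tensor
    [[r, r]], and hence vanish; the Jacobi identity is the flatness of [D] on
    functions. If the [V_k] are Killing fields, then [L_{V_k}] commutes with the
    musical isomorphism, so that [D] is metric.

    Vector fields are derivations here, and the metric and the metacurvature tensor
    are only given on global objects. What makes them computable pointwise is that a
    derivation [Y] is locally [\sum_i Y(x_i) d/dx_i], which rests on bump functions
    and on Hadamard's lemma. In particular a 1-form is locally a combination of
    differentials, and any two generalized Poisson brackets agree on those, so that
    the metacurvature tensor is unique. *)

Require Import Defs.
From HB Require Import structures.
From mathcomp Require Import all_boot all_order all_algebra.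
From mathcomp Require Import all_classical all_reals all_analysis.
From mathcomp Require Import ring lra.
Import Defs.

Set Implicit Arguments.
Unset Strict Implicit.
Unset Printing Implicit Defensive.

Import Order.TTheory GRing.Theory Num.Theory.
Import numFieldNormedType.Exports.

Local Open Scope classical_set_scope.
Local Open Scope ring_scope.

(** * Calculus on R^d *)

(** [smooth_on] is iterated differentiability, with no integral or power series behind it. To prove
    a function smooth, one looks for a family that contains it, whose members are all differentiable
    and whose derivatives are combinations of members; induction on the order does the rest.
    Quotients, bump functions and the factors in Hadamard's lemma are all treated so. For the last
    two, the exceptional points, where the definition changes branch, are reached by a quadratic
    estimate. Vector fields are never restricted to open sets. A local identity is stated as a
    global one multiplied by a cut-off function, as in [b *: Y], and read at a point where the
    cut-off is 1. On the algebraic side, the expressions that occur are R-linear in each element of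
    [g], even though they involve derivatives of functions and forms. They can thus be contracted
    with [r] in any basis, the skewness of [r] becomes the rule that its two legs may be exchanged
    at the cost of a sign, and the Yang-Baxter equation enters through a single contraction
    lemma. *)

Section SmoothFunctions.
Variables (R : realType) (d : nat).
Implicit Types (U V : set 'rV[R]_d) (f g : 'rV[R]_d -> R).

Lemma ndifferentiable_sub k U V f :
  V `<=` U -> ndifferentiable k U f -> ndifferentiable k V f.
Proof.
move=> VU; elim: k f => [//|k IH] f [df Df].
by split=> [x /VU|v]; [exact: df|exact: IH (Df v)].
Qed.

(** The gluing principle for functions given by different formulas on the members of a cover. *)
Lemma ndifferentiable_local k U f :
  (forall x, U x -> exists2 V, V x & ndifferentiable k V f) ->
  ndifferentiable k U f.
Proof.
elim: k f => [//|k IH] f fl; split=> [x|v].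
  by case/fl => V Vx [df _]; exact: df.
by apply: IH => x /fl [V Vx [_ Df]]; exists V; last exact: Df.
Qed.

Lemma ndifferentiableZ k U (a : R) f : open U ->
  ndifferentiable k U f -> ndifferentiable k U (a *: f).
Proof. by move=> Uo fk; exact (ndifferentiableM Uo (ndifferentiable_cst k U a) fk). Qed.

Lemma ndifferentiableN k U f : open U ->
  ndifferentiable k U f -> ndifferentiable k U (- f).
Proof. by move=> Uo fk; rewrite -scaleN1r; exact: ndifferentiableZ. Qed.

Lemma ndifferentiableB k U f g : open U ->
  ndifferentiable k U f -> ndifferentiable k U g -> ndifferentiable k U (f - g).
Proof.
by move=> Uo fk gk; apply: ndifferentiableD => //; exact: ndifferentiableN.
Qed.

Lemma ndifferentiable_sum (I : Type) (r : seq I) (Q : pred I)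
    (F : I -> 'rV[R]_d -> R) k U : open U ->
  (forall i, Q i -> ndifferentiable k U (F i)) ->
  ndifferentiable k U (\sum_(i <- r | Q i) F i).
Proof.
move=> Uo FU; elim/big_rec: _ => [|i f Qi]; first exact: ndifferentiable_cst.
by apply: ndifferentiableD => //; exact: FU.
Qed.

Lemma ndifferentiable_linear k U (l : {linear 'rV[R]_d -> R^o}) :
  continuous l -> ndifferentiable k U l.
Proof.
case: k => [//|k] lc; split=> [x _|v].
  exact: linear_differentiable.
suff -> : 'D_v (l : 'rV[R]_d -> R^o) = cst (l v) by exact: ndifferentiable_cst.
apply/funext => x; rewrite deriveE; last exact: linear_differentiable.
by rewrite diff_lin.
Qed.

Lemma ndifferentiable_coord k U (i : 'I_d) :
  ndifferentiable k U (fun x => x ord0 i).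
Proof.
have lin : linear (fun x : 'rV[R]_d => x ord0 i : R^o).
  by move=> a x y; rewrite !mxE.
pose L := GRing.isLinear.Build _ _ _ _ _ lin.
pose l : {linear 'rV[R]_d -> R^o} := HB.pack (fun x : 'rV[R]_d => x ord0 i : R^o) L.
have /= := @ndifferentiable_linear k U l; apply => x.
exact: (@coord_continuous R 1 d ord0 i x).
Qed.

(* Stated with [c * f = e] instead of a division, the hypothesis is inherited by
   the derivatives: [c ^+ 2 * D f = c * D e - D c * e]. *)
Lemma ndifferentiable_quotient k U f : open U ->
  (forall x, U x -> exists c e, [/\ ndifferentiable k U c, ndifferentiable k U e,
     c x != 0 & forall y, U y -> c y * f y = e y]) ->
  ndifferentiable k U f.
Proof.
move=> Uo; elim: k f => [//|k IH] f fq.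
have df x : U x -> differentiable f x.
  move=> Ux; have [c [e [[dc _] [de _] cx cf]]] := fq x Ux.
  have cnz : \forall y \near x, c y != 0.
    have := differentiable_continuous (dc x Ux).
    by move/(_ [set z | z != 0]); apply; apply: open_nbhs_nbhs; split => //; exact: open_neq.
  apply: (@differentiable_near_eq _ _ _ (e * (fun y => (c y)^-1))).
    near=> y; change (e y * (c y)^-1 = f y); rewrite -[e y](cf y).
      by rewrite mulrAC divff ?mul1r //; near: y; exact: cnz.
    by near: y; exact: open_nbhs_nbhs.
  apply: differentiableM; first exact: de.
  by apply: differentiableV => //; exact: dc.
split=> // v; apply: IH => x Ux.
have [c [e [cs es cx cf]]] := fq x Ux.
have [dc Dc] := cs; have [de De] := es.
have ck := ndifferentiableW cs; have ek := ndifferentiableW es.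
exists (c * c), (c * 'D_v e - 'D_v c * e); split.
- exact: ndifferentiableM.
- by apply: ndifferentiableB => //; apply: ndifferentiableM => //; [exact: De|exact: Dc].
- by rewrite mulf_neq0.
move=> y Uy.
have ecf : \forall z \near y, e z = (c * f) z.
  by move/open_nbhs_nbhs: (conj Uo Uy); apply: filterS => z Uz; rewrite -[e z](cf z).
have Ee : 'D_v e y = c y * 'D_v f y + f y * 'D_v c y.
  rewrite (near_eq_derive _ ecf) deriveM //.
    by apply: diff_derivable; exact: dc.
  by apply: diff_derivable; exact: df.
change (c y * c y * 'D_v f y = c y * 'D_v e y - 'D_v c y * e y).
rewrite Ee -(cf y Uy); ring.
Unshelve. all: by end_near.
Qed.

End SmoothFunctions.

(** * The chain rule for iterated differentiability *)

Section ChainRule.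
Variables (R : realType) (d n : nat) (U : set 'rV[R]_d) (V : set 'rV[R]_n).
Variable chi : 'rV[R]_d -> 'rV[R]_n.
Hypotheses (Uo : open U) (Vo : open V) (chiUV : forall x, U x -> V (chi x)).

(** A derivative of [f \o chi] is the sum of the partial derivatives of [f] along [chi] times the
    derivatives of the coordinates of [chi]. The first factors fall under the induction hypothesis,
    which is therefore kept general in [f]; the second have lost one order, which is all that
    remains to be proved. *)
Lemma ndifferentiable_comp k (f : 'rV[R]_n -> R) :
  (forall i, ndifferentiable k U (fun x => chi x ord0 i)) ->
  ndifferentiable k V f -> ndifferentiable k U (f \o chi).
Proof.
elim: k f => [//|k IH] f chik [df Df].
pose cj i := fun x => chi x ord0 i.
have dcj x i : U x -> differentiable (cj i) x by case: (chik i) => + _; apply.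
have chiE : chi = \sum_i (fun x => cj i x *: delta_mx ord0 i).
  by apply/funext => x; rewrite fct_sumE [LHS]row_sum_delta.
have dchi x : U x -> differentiable chi x.
  move=> Ux; rewrite chiE; apply: differentiable_sum => i.
  by apply: differentiableZl; exact: dcj.
have Dchi x v : U x -> 'd chi x v = \sum_i 'D_v (cj i) x *: delta_mx ord0 i.
  move=> Ux; rewrite -deriveE; last exact: dchi.
  rewrite [in LHS]chiE derive_sum.
    apply: eq_bigr => i _; rewrite deriveE; last first.
      by apply: differentiableZl; exact: dcj.
    by rewrite diffZl ?deriveE //; exact: dcj.
  by move=> i; apply: diff_derivable; apply: differentiableZl; exact: dcj.
split=> [x Ux|v].
  by apply: differentiable_comp; [exact: dchi|apply: df; exact: chiUV].
have chiW i := ndifferentiableW (chik i).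
have S : ndifferentiable k U
    (\sum_i (('D_(delta_mx ord0 i) f \o chi) * 'D_v (cj i))).
  apply: ndifferentiable_sum => // i _; apply: ndifferentiableM => //.
    by apply: IH => //; exact: Df.
  by case: (chik i) => _; apply.
apply: ndifferentiable_ext S => // x Ux; rewrite fct_sumE /=.
rewrite deriveE; last first.
  by apply: differentiable_comp; [exact: dchi|apply: df; exact: chiUV].
rewrite diff_comp; [|exact: dchi|by apply: df; exact: chiUV].
rewrite /= Dchi // linear_sum; apply: eq_bigr => i _.
rewrite linearZ /= -deriveE; last by apply: df; exact: chiUV.
exact: mulrC.
Qed.

End ChainRule.

(** Meant for functions defined by cases: at the point where the branches meet, an estimate replaces
    a formula. The bound at [y = x] already forces [f x = 0], so that the estimate says that [f] is
    small to second order. *)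
Lemma quadratic_differentiable (R : realType) (V W : normedModType R)
    (f : V -> W) (x : V) (C : R) :
  (\forall y \near x, `|f y| <= C * `|y - x| ^+ 2) ->
  differentiable f x /\ forall v, 'D_v f x = 0.
Proof.
move=> fC.
have fx : f x = 0.
  apply/eqP; rewrite -normr_le0; apply: le_trans (nbhs_singleton fC) _.
  by rewrite subrr normr0 expr0n mulr0.
have E : f \o shift x = cst (f x) + \0 +o_ 0 id.
  apply/eqaddoP => e e0.
  have h1 : \forall y \near (0 : V), `|f (y + x)| <= C * `|y| ^+ 2.
    by move: fC; rewrite (near_shift 0 x); apply: filterS => y /=; rewrite subr0 addrK.
  have h2 : \forall y \near (0 : V), `|C| * `|y| <= e.
    near=> y.
    have : `|y| <= e / (`|C| + 1).
      near: y; apply/nbhs_norm0P; exists (e / (`|C| + 1)) => [|y /= /ltW//].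
      by rewrite /= divr_gt0 // ltr_wpDl.
    rewrite ler_pdivlMr ?ltr_wpDl // => /(le_trans _); apply.
    by rewrite mulrC ler_wpM2l // lerDl.
  near=> y.
  change (`|f (y + x) - (f x + 0)| <= e * `|y|).
  rewrite fx addr0 subr0; apply: (@le_trans _ _ (C * `|y| ^+ 2)); first by near: y.
  apply: (@le_trans _ _ (`|C| * `|y| * `|y|)).
    by rewrite -mulrA -expr2 ler_wpM2r ?ler_norm // exprn_ge0.
  by rewrite ler_wpM2r //; near: y.
have dE : 'd f x = \0 :> (V -> W).
  by apply: diff_unique => //; exact: cst_continuous.
have df : differentiable f x.
  by apply/diff_locallyP; rewrite dE; split => //; exact: cst_continuous.
by split=> // v; rewrite deriveE // dE.
Unshelve. all: by end_near.
Qed.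

(** * Mean values along lines and the symmetry of second derivatives *)

Section Lines.
Variables (R : realType) (d : nat).
Implicit Types (f : 'rV[R]_d -> R) (x v w : 'rV[R]_d).

Lemma smooth_differentiable f x : smooth_on setT f -> differentiable f x.
Proof. by move=> fs; case: (fs 1) => + _; apply. Qed.

Lemma smooth_derive f v : smooth_on setT f -> smooth_on setT ('D_v f).
Proof. by move=> fs k; case: (fs k.+1) => _; apply. Qed.

Lemma is_derive_line f x v (s : R) : differentiable f (x + s *: v) ->
  is_derive s 1 (fun s => f (x + s *: v)) ('D_v f (x + s *: v)).
Proof.
move=> df; pose l := (fun s : R => x + s *: v).
have dl : is_diff s l (fun h => h *: v).
  have : is_diff s (cst x + (fun h : R => h *: v)) (0 + (fun h => h *: v)).
    by apply: is_diffD.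
  by rewrite add0r.
have dfl : differentiable (f \o l) s by apply: differentiable_comp.
apply: DeriveDef; first exact: diff_derivable.
change ('D_1 (f \o l) s = 'D_v f (l s)).
by rewrite !deriveE // diff_comp // [in LHS]/= diff_val scale1r.
Qed.

Lemma MVT_line f x v : (forall y, differentiable f y) ->
  forall b : R, exists2 c : R, `|c| <= `|b| &
    f (x + b *: v) - f x = 'D_v f (x + c *: v) * b.
Proof.
move=> df b; pose g := fun s : R => f (x + s *: v).
have dg (s : R) : is_derive s 1 g ('D_v f (x + s *: v)).
  by apply: is_derive_line.
have gc : continuous g.
  by move=> s; apply: differentiable_continuous; apply/derivable1_diffP; apply: ex_derive.
have g0 : g 0 = f x by rewrite /g scale0r addr0.
have gw A : {within A, continuous g} by exact: continuous_subspaceT.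
have [b0|b0] := leP 0 b.
  have [c] := MVT_segment b0 (fun s _ => dg s) (gw _).
  rewrite in_itv /= => /andP[c0 cb]; rewrite g0 subr0 => E; exists c => //.
  by rewrite !ger0_norm // (le_trans c0).
have [c] := MVT_segment (ltW b0) (fun s _ => dg s) (gw _).
rewrite in_itv /= => /andP[bc c0]; rewrite g0 sub0r => E; exists c.
  by rewrite !ler0_norm ?lerN2 // ltW.
by rewrite -[_ - _]opprB E mulrN opprK.
Qed.

End Lines.

Lemma differentiable_approx (R : realType) (V W : normedModType R)
    (f : V -> W) (x : V) (e : R) : differentiable f x -> 0 < e ->
  \forall u \near 0, `|f (u + x) - (f x + 'd f x u)| <= e * `|u|.
Proof.
by move=> /diff_locallyP[_ /eqaddoP fx] /fx.
Qed.

Lemma is_diff_addr (R : realType) (V : normedModType R) (a y : V) :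
  is_diff y (fun y => y + a) (fun v => v).
Proof.
have -> : (fun v : V => v) = (fun v => v) + cst 0 by apply/funext => v; rewrite fctE addr0.
exact: (@is_diffD _ _ _ (fun y => y) (cst a) _ _ y (is_diff_id y) (is_diff_cst a y)).
Qed.

Section Schwarz.
Variables (R : realType) (d : nat).
Implicit Types (f : 'rV[R]_d -> R) (x v w : 'rV[R]_d).

Lemma derive_linear f x : differentiable f x ->
  forall (a : R) v w, 'D_(a *: v + w) f x = a * 'D_v f x + 'D_w f x.
Proof. by move=> df a v w; rewrite !deriveE // linearP. Qed.

(* Symmetric in [v] and [w], this second difference computes both mixed
   derivatives to second order in [s]. *)
Lemma second_difference_approx f x v w (e : R) : smooth_on setT f -> 0 < e ->
  \forall s \near (0 : R), `|f (x + s *: v + s *: w) - f (x + s *: v)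
     - (f (x + s *: w) - f x) - s ^+ 2 * 'D_w ('D_v f) x| <= e * s ^+ 2.
Proof.
move=> fs e0; set G := 'D_v f.
have dG : differentiable G x by apply: smooth_differentiable; exact: smooth_derive.
(* The two errors of linear approximation of [G] have arguments [c *: v + s *: w] and [c *: v], of
   total norm at most [|s|] times twice [|v|] plus [|w|]. The summand 1 keeps the divisor [K]
   positive. *)
pose K := `|v| *+ 2 + `|w| + 1.
have K0 : 0 < K by rewrite /K ltr_wpDl // addr_ge0 // mulrn_wge0.
have eK : 0 < e / K by rewrite divr_gt0.
have := differentiable_approx dG eK.
move=> /nbhs_norm0P[r /= r0 Gr].
apply/nbhs_norm0P; exists (r / K) => /=; first by rewrite divr_gt0.
move=> s /=; rewrite ltr_pdivlMr // => sr.
(* The second difference is the increment of [h] along [v], so the mean value theorem turns it into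
   a difference of two values of [G], to which only first-order differentiability is applied. *)
pose h := fun y => f (y + s *: w) - f y.
have dsh y : differentiable (fun y => f (y + s *: w)) y.
  apply: (@differentiable_comp _ _ _ _ (fun y => y + s *: w) f); last exact: smooth_differentiable.
  by case: (is_diff_addr (s *: w) y).
have dh y : differentiable h y by apply: differentiableB => //; exact: smooth_differentiable.
have Dh y : 'D_v h y = G (y + s *: w) - G y.
  rewrite deriveB; try by [apply: diff_derivable;
    exact: smooth_differentiable|apply: diff_derivable].
  congr (_ - _); have iy := is_diff_addr (s *: w) y.
  rewrite deriveE // (@diff_comp _ _ _ _ (fun y => y + s *: w) f) //;
    last exact: smooth_differentiable.
  by rewrite /= diff_val /G deriveE //; exact: smooth_differentiable.
have [c cs E] := MVT_line x v dh s.
have -> : f (x + s *: v + s *: w) - f (x + s *: v) - (f (x + s *: w) - f x)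
   = h (x + s *: v) - h x by rewrite /h.
rewrite E Dh.
have smK (u : 'rV[R]_d) : `|u| <= `|s| * (`|v| + `|w|) -> `|u| < r.
  move=> /le_lt_trans; apply; apply: le_lt_trans sr; rewrite ler_wpM2l //.
  rewrite /K mulr2n; have := normr_ge0 v; lra.
have cv : `|c *: v| <= `|s| * `|v| by rewrite normrZ ler_wpM2r.
have cvw : `|c *: v + s *: w| <= `|s| * (`|v| + `|w|).
  by rewrite (le_trans (ler_normD _ _)) // mulrDr lerD // normrZ.
have cvw' : `|c *: v| <= `|s| * (`|v| + `|w|).
  by rewrite (le_trans cv) // ler_wpM2l // lerDl.
have /= h2 := Gr _ (smK _ cvw); have /= h1 := Gr _ (smK _ cvw').
rewrite [_ + x]addrC in h1; rewrite [_ + x]addrC addrA in h2.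
have dGl : 'd G x (c *: v + s *: w) = 'd G x (c *: v) + s * 'D_w G x.
  by rewrite linearD [X in _ + X]linearZ deriveE.
rewrite dGl in h2.
set g1 := G (x + c *: v + s *: w) in h2 *; set g2 := G (x + c *: v) in h1 *.
set D1 := 'd G x (c *: v) in h1 h2; set D2 := 'D_w G x in h2 *.
have -> : (g1 - g2) * s - s ^+ 2 * D2 =
  (g1 - (G x + (D1 + s * D2)) - (g2 - (G x + D1))) * s by ring.
rewrite normrM -(real_normK (num_real s)) [X in _ <= _ * X]expr2 mulrA ler_wpM2r //.
apply: le_trans (ler_normB _ _) _.
apply: le_trans (lerD h2 h1) _.
rewrite -mulrDr mulrAC ler_pdivrMr // -mulrA ler_wpM2l ?(ltW e0) //.
apply: le_trans (lerD cvw cv) _; rewrite -mulrDr ler_wpM2l // /K mulr2n.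
lra.
Qed.

(** Divided by [s ^+ 2], one and the same second difference approximates both mixed derivatives,
    because exchanging [v] and [w] only permutes its terms. Each approximation is granted half of
    [e]. *)
Lemma derive_comm f v w : smooth_on setT f -> 'D_v ('D_w f) = 'D_w ('D_v f).
Proof.
move=> fs; apply/funext => x; apply/eqP; rewrite -subr_eq0 -normr_le0.
apply/ler_addgt0Pr => e e0; rewrite add0r; have e2 : 0 < e / 2 by rewrite divr_gt0.
have /nbhs_norm0P[r1 /= r10 h1] := second_difference_approx x v w fs e2.
have /nbhs_norm0P[r2 /= r20 h2] := second_difference_approx x w v fs e2.
pose s := Num.min r1 r2 / 2.
have m0 : 0 < Num.min r1 r2 by rewrite lt_min r10.
have s0 : 0 < s by rewrite divr_gt0.
have : `|s| < Num.min r1 r2 by rewrite gtr0_norm // /s; lra.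
rewrite lt_min => /andP[/h1 /= {}h1 /h2 /= {}h2].
have s2 : 0 < s ^+ 2 by rewrite exprn_gt0.
rewrite -(ler_pM2l s2) -{1}(gtr0_norm s2) -normrM.
rewrite (addrAC x (s *: w)) in h2.
have := le_trans (ler_normB _ _) (lerD h1 h2).
set a := f _; set b := f _; set c := f _; set g := f _.
set D1 := 'D_w _ _; set D2 := 'D_v _ _.
have -> : a - b - (c - g) - s ^+ 2 * D1 - (a - c - (b - g) - s ^+ 2 * D2)
  = s ^+ 2 * (D2 - D1) by ring.
by move/le_trans; apply; rewrite -mulrDl -splitr mulrC.
Qed.

End Schwarz.

(** * Hadamard's lemma in one coordinate, by Taylor quotients *)

Lemma is_diff_coord (R : realType) (d : nat) (i : 'I_d) (x : 'rV[R]_d) :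
  is_diff x (fun y : 'rV[R]_d => y ord0 i) (fun y => y ord0 i).
Proof.
have lin : linear (fun x : 'rV[R]_d => x ord0 i : R^o) by move=> a y z; rewrite !mxE.
pose L := GRing.isLinear.Build _ _ _ _ _ lin.
pose l : {linear 'rV[R]_d -> R^o} := HB.pack (fun x : 'rV[R]_d => x ord0 i : R^o) L.
have lc : continuous l by move=> y; exact: (@coord_continuous R 1 d ord0 i y).
by apply: DiffDef; [exact: (@linear_differentiable _ _ _ l x lc)|exact: (@diff_lin _ _ _ l)].
Qed.

Lemma rV_coord_le (R : realType) (d : nat) (x : 'rV[R]_d) (j : 'I_d) :
  `|x ord0 j| <= `|x|.
Proof.
change (`|x ord0 j| <= mx_norm x); rewrite mx_normrE.
exact: (le_bigmax _ (fun ij : 'I_1 * 'I_d => `|x ij.1 ij.2|) (ord0, j)).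
Qed.

Lemma rV_norm_le (R : realType) (d : nat) (x : 'rV[R]_d) (M : R) : 0 <= M ->
  (forall j, `|x ord0 j| <= M) -> `|x| <= M.
Proof.
move=> M0 xM; change (mx_norm x <= M); rewrite mx_normrE.
by apply/bigmax_leP; split=> // -[k j] _; rewrite [k]ord1.
Qed.

Section Hadamard.
Variables (R : realType) (d : nat) (i : 'I_d) (c : R).
Implicit Types (f : 'rV[R]_d -> R) (x v : 'rV[R]_d).

Let e : 'rV[R]_d := delta_mx ord0 i.
Let t (x : 'rV[R]_d) : R := x ord0 i - c.
Let pr (x : 'rV[R]_d) := x - t x *: e.
Let hor v : 'rV[R]_d := v - v ord0 i *: e.

Let De f : 'rV[R]_d -> R := 'D_e f.

(** The coefficient of [t ^+ n] in the Taylor expansion along the [i]-th axis, based at the foot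
    [pr x] of [x] on the hyperplane where the [i]-th coordinate is [c]. As a function of [x] it is
    constant along that axis. *)
Definition taylor_coef n f : 'rV[R]_d -> R := fun x => iter n De f (pr x) / (factorial n)%:R.

Fixpoint taylor_rem n f : 'rV[R]_d -> R :=
  if n is m.+1 then fun x => taylor_rem m f x - taylor_coef m f x * t x ^+ m else f.

(* The quotient of the Taylor remainder by [t ^+ n], extended by its limit. *)
Definition taylor_quot n f : 'rV[R]_d -> R := fun x =>
  if t x == 0 then taylor_coef n f x else taylor_rem n f x / t x ^+ n.

Lemma foot_id x : t x = 0 -> pr x = x.
Proof. by rewrite /pr => ->; rewrite scale0r subr0. Qed.

Lemma axis_coord : e ord0 i = 1.
Proof. by rewrite mxE !eqxx. Qed.

Lemma height_line x s : t (x + s *: e) = t x + s.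
Proof. by rewrite /t !mxE !eqxx mulr1 addrAC. Qed.

Lemma height_foot x : t (pr x) = 0.
Proof. by rewrite /pr -scaleNr height_line subrr. Qed.

Lemma smooth_height : smooth_on setT t.
Proof.
move=> k; apply: ndifferentiableB => //.
- exact: openT.
- exact: ndifferentiable_coord.
- exact: ndifferentiable_cst.
Qed.

Lemma is_diff_height x : is_diff x t (fun v => v ord0 i).
Proof.
have := is_diffB (is_diff_coord i x) (is_diff_cst c x).
by rewrite subr0.
Qed.

Lemma is_diff_foot x : is_diff x pr hor.
Proof.
have dt := is_diff_height x.
have dte : is_diff x (fun y => t y *: e) (fun v => v ord0 i *: e).
  apply: DiffDef; first exact: differentiableZl.
  by rewrite diffZl // diff_val.
exact: (is_diffB (is_diff_id x) dte).
Qed.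

Lemma smooth_foot_comp f : smooth_on setT f -> smooth_on setT (f \o pr).
Proof.
move=> fs k; apply: (@ndifferentiable_comp _ _ _ setT setT) => //; try exact: openT.
move=> j.
have -> : (fun x => pr x ord0 j) = (fun x => x ord0 j) - (e ord0 j *: t).
  by apply/funext => x; rewrite /pr !mxE mulrC.
apply: ndifferentiableB; [exact: openT|exact: ndifferentiable_coord|].
by apply: ndifferentiableZ; [exact: openT|exact: smooth_height].
Qed.

Lemma derive_foot_comp f x v : smooth_on setT f ->
  'D_v (f \o pr) x = 'D_(hor v) f (pr x).
Proof.
move=> fs; have dp := is_diff_foot x.
rewrite deriveE; last by apply: differentiable_comp => //; exact: smooth_differentiable.
by rewrite diff_comp //= ?diff_val -?deriveE //; exact: smooth_differentiable.
Qed.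

Lemma iter_derive_smooth f n : smooth_on setT f -> smooth_on setT (iter n De f).
Proof. by move=> fs; elim: n => //= n; exact: smooth_derive. Qed.

Lemma derive_iterC f n v : smooth_on setT f ->
  'D_v (iter n De f) = iter n De ('D_v f).
Proof.
move=> fs; elim: n => //= n IH.
by rewrite derive_comm ?IH //; exact: iter_derive_smooth.
Qed.

Lemma smooth_taylor_coef n f : smooth_on setT f -> smooth_on setT (taylor_coef n f).
Proof.
move=> fs k; have -> : taylor_coef n f = (factorial n)%:R^-1 *: (iter n De f \o pr).
  by apply/funext => x; exact: mulrC.
apply: ndifferentiableZ; first exact: openT.
by apply: smooth_foot_comp; exact: iter_derive_smooth.
Qed.

Lemma derive_taylor_coef n f x v : smooth_on setT f ->
  'D_v (taylor_coef n f) x = taylor_coef n ('D_(hor v) f) x.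
Proof.
move=> fs; have -> : taylor_coef n f = (factorial n)%:R^-1 *: (iter n De f \o pr).
  by apply/funext => y; exact: mulrC.
have js := iter_derive_smooth n fs.
rewrite deriveZ; last by apply: diff_derivable; apply: smooth_differentiable;
  exact: smooth_foot_comp.
by rewrite derive_foot_comp // /taylor_coef -derive_iterC // mulrC.
Qed.

Lemma taylor_coef_derive n f x : taylor_coef n ('D_e f) x = n.+1%:R * taylor_coef n.+1 f x.
Proof.
rewrite /taylor_coef iterSr factS natrM invfM -/(De f) mulrCA; congr (_ * _).
by rewrite mulrA mulfV ?mul1r // pnatr_eq0.
Qed.

Lemma smooth_taylor_rem n f : smooth_on setT f -> smooth_on setT (taylor_rem n f).
Proof.
move=> fs; elim: n => //= n IH k.
apply: ndifferentiableB; [exact: openT|exact: IH|].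
have -> : (fun x => taylor_coef n f x * t x ^+ n) = taylor_coef n f * t ^+ n.
  by apply/funext => x; rewrite !fctE.
apply: ndifferentiableM; [exact: openT|exact: smooth_taylor_coef|].
elim: n {IH} => [|n IH]; first by rewrite expr0; exact: ndifferentiable_cst.
by rewrite exprS; apply: ndifferentiableM; [exact: openT|exact: smooth_height|].
Qed.

Lemma derive_height x v : 'D_v t x = v ord0 i.
Proof. by have dt := is_diff_height x; rewrite deriveE // diff_val. Qed.

Lemma hor_axis : hor e = 0.
Proof. by rewrite /hor axis_coord scale1r subrr. Qed.

(** The recursion behind the smoothness of Taylor quotients. On the hyperplane it holds because the
    value of the quotient there was chosen to be the coefficient; elsewhere it is the definition of
    the next remainder, divided by a power of [t]. *)
Lemma taylor_quot_step n f x :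
  taylor_quot n f x = taylor_coef n f x + t x * taylor_quot n.+1 f x.
Proof.
rewrite /taylor_quot; case: eqVneq => [->|t0]; first by rewrite mul0r addr0.
by rewrite /= exprS; field; rewrite ?expf_neq0 ?t0.
Qed.

Lemma derive_taylor_coef_axis n f x : smooth_on setT f -> 'D_e (taylor_coef n f) x = 0.
Proof.
move=> fs; have js := iter_derive_smooth n fs.
have -> : taylor_coef n f = (factorial n)%:R^-1 *: (iter n De f \o pr).
  by apply/funext => y; exact: mulrC.
rewrite deriveZ; last by apply: diff_derivable; apply: smooth_differentiable;
  exact: smooth_foot_comp.
by rewrite derive_foot_comp // hor_axis derive0 scaler0.
Qed.

Lemma smooth_heightX n : smooth_on setT (t ^+ n).
Proof.
move=> k; elim: n => [|n IH]; first by rewrite expr0; exact: ndifferentiable_cst.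
by rewrite exprS; apply: ndifferentiableM; [exact: openT|exact: smooth_height|].
Qed.

(** Along the axis the coefficients are constant and [t ^+ m.+1] has derivative [m.+1] times
    [t ^+ m], so differentiating the expansion of [f] gives the expansion of its derivative, one
    order lower. *)
Lemma derive_taylor_rem n f x : smooth_on setT f ->
  'D_e (taylor_rem n.+1 f) x = taylor_rem n ('D_e f) x.
Proof.
move=> fs; have dc m y : derivable (taylor_coef m f) y e.
  by apply: diff_derivable; apply: smooth_differentiable; exact: smooth_taylor_coef.
have dt m y : derivable (t ^+ m) y e.
  by apply: diff_derivable; apply: smooth_differentiable; exact: smooth_heightX.
have dr m y : derivable (taylor_rem m f) y e.
  by apply: diff_derivable; apply: smooth_differentiable; exact: smooth_taylor_rem.
have Dct m y : 'D_e (taylor_coef m f * t ^+ m) y = taylor_coef m f y * 'D_e (t ^+ m) y.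
  by rewrite (deriveM (dc m y) (dt m y)) derive_taylor_coef_axis // scaler0 addr0.
have remS m y : 'D_e (taylor_rem m.+1 f) y =
    'D_e (taylor_rem m f) y - taylor_coef m f y * 'D_e (t ^+ m) y.
  rewrite -Dct -(deriveB (dr m y) (derivableM (dc m y) (dt m y))).
  by congr (derive _ y e); apply/funext => z; rewrite !fctE.
have DtX m y : 'D_e (t ^+ m.+1) y = m.+1%:R * t y ^+ m.
  have Dt : derivable t y e.
    by apply: diff_derivable; apply: smooth_differentiable; exact: smooth_height.
  apply: etrans (deriveX m.+1 Dt) _.
  by rewrite derive_height axis_coord; exact: mulr1.
elim: n => [|n IH]; rewrite remS.
  by rewrite expr0 derive_cst mulr0 subr0.
by rewrite IH DtX /= taylor_coef_derive; ring.
Qed.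

Lemma taylor_rem_height0 n f x : t x = 0 -> taylor_rem n.+1 f x = 0.
Proof.
move=> tx; elim: n => [|n IH].
  by rewrite /= /taylor_coef /= fact0 expr0 divr1 mulr1 foot_id // subrr.
by rewrite [LHS]/= -/(taylor_rem n.+1 f x) IH tx expr0n mulr0 subr0.
Qed.

Lemma continuous_bound f x : {for x, continuous f} ->
  exists2 C : R, 0 <= C & \forall y \near x, `|f y| <= C.
Proof.
move=> fc; exists (`|f x| + 1) => //.
have /cvgr_dist_lt/(_ 1 ltr01) := fc; apply: filterS => y /ltW h.
have -> : f y = f x - (f x - f y) by ring.
by rewrite (le_trans (ler_normB _ _)) // lerD2l.
Qed.

(** The remainder vanishes at the foot of [x], and its derivative along the axis is a remainder of
    one order less. The mean value theorem on the segment from the foot to [x] therefore gains one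
    factor [t x]. *)
Lemma taylor_rem_bound n f x0 : smooth_on setT f -> t x0 = 0 ->
  exists2 C : R, 0 <= C & \forall x \near x0, `|taylor_rem n f x| <= C * `|t x| ^+ n.
Proof.
move=> fs tx0; elim: n f fs => [|n IH] f fs.
  have [C C0 fC] := continuous_bound (differentiable_continuous (smooth_differentiable x0 fs)).
  by exists C => //; apply: filterS fC => x; rewrite expr0 mulr1.
have [C C0 /nbhs_normP[r /= r0 fC]] := IH _ (smooth_derive e fs).
exists C => //; apply/nbhs_normP; exists r => // x /= xr.
have dr y : differentiable (taylor_rem n.+1 f) y
  by apply: smooth_differentiable; exact: smooth_taylor_rem.
have [s st E] := MVT_line (pr x) e dr (t x).
have prK : pr x + t x *: e = x by rewrite /pr subrK.
rewrite prK (taylor_rem_height0 _ _ (height_foot x)) subr0 derive_taylor_rem // in E.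
change (`|taylor_rem n.+1 f x| <= C * `|t x| ^+ n.+1); rewrite E.
rewrite normrM exprSr mulrA ler_wpM2r //.
(* The intermediate point stays in the ball: it differs from [x] only in the [i]-th coordinate,
   where its distance to [x0] is [|s|], at most [|t x|], the distance from [x] to [x0] in that
   coordinate. *)
have /fC /= : `|x0 - (pr x + s *: e)| < r.
  apply: le_lt_trans xr; apply: rV_norm_le => // j.
  have [->|ji] := eqVneq j i.
    apply: le_trans (rV_coord_le _ i); rewrite !mxE !eqxx !mulr1.
    have -> : x0 ord0 i - (x ord0 i - t x + s) = - s.
      by move: tx0; rewrite /t; move/subr0_eq => ->; ring.
    rewrite normrN (le_trans st) // distrC; move: tx0; rewrite /t => /subr0_eq ->.
    by [].
  apply: le_trans (rV_coord_le _ j); rewrite !mxE (negbTE ji) andbF !mulr0.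
  by rewrite subr0 addr0.
move/le_trans; apply; rewrite ler_wpM2l // lerXn2r ?nnegrE //.
by rewrite height_line height_foot add0r.
Qed.

Lemma taylor_quot_bound n f x0 : smooth_on setT f -> t x0 = 0 ->
  exists C : R, \forall x \near x0, `|taylor_quot n f x| <= C.
Proof.
move=> fs tx0; have [C C0 hC] := taylor_rem_bound n fs tx0.
have [K K0 hK] := continuous_bound
  (differentiable_continuous (smooth_differentiable x0 (smooth_taylor_coef n fs))).
exists (C + K); near=> x; rewrite /taylor_quot; case: eqVneq => tx.
  by apply: (@le_trans _ _ K); [near: x|rewrite lerDr].
apply: (@le_trans _ _ C); last by rewrite lerDl.
rewrite normrM normfV normrX ler_pdivrMr ?exprn_gt0 ?normr_gt0 //.
by near: x.
Unshelve. all: by end_near.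
Qed.

Lemma taylor_quot0 f : taylor_quot 0 f = f.
Proof.
apply/funext => x; rewrite /taylor_quot /= /taylor_coef /= fact0 !divr1.
by case: eqP => // tx; rewrite foot_id.
Qed.

(** Two steps of the recursion write the quotient as a smooth function plus [t ^+ 2] times the
    quotient of order [n.+2]. The latter is bounded near [x], so that this last term contributes
    nothing to the differential. *)
Lemma taylor_quot_height0 n f x : smooth_on setT f -> t x = 0 ->
  differentiable (taylor_quot n f) x /\
  forall v, 'D_v (taylor_quot n f) x =
    'D_v (taylor_coef n f) x + v ord0 i * taylor_coef n.+1 f x.
Proof.
move=> fs tx; pose q y := t y * (t y * taylor_quot n.+2 f y).
have [C hC] := taylor_quot_bound n.+2 fs tx.
have [dq Dq] : differentiable q x /\ forall v, 'D_v q x = 0.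
  apply: (@quadratic_differentiable _ _ _ q x C); apply: filterS hC => y hC.
  have ty : `|t y| <= `|y - x|.
    apply: le_trans (rV_coord_le _ i); rewrite !mxE.
    by move: tx; rewrite /t => /subr0_eq ->.
  rewrite /q !normrM mulrA mulrC.
  by apply: ler_pM => //; rewrite expr2 ler_pM.
have E : taylor_quot n f = taylor_coef n f + t * taylor_coef n.+1 f + q.
  apply/funext => y; rewrite !fctE /q (taylor_quot_step n) (taylor_quot_step n.+1); ring.
have dc m : differentiable (taylor_coef m f) x
  by apply: smooth_differentiable; exact: smooth_taylor_coef.
have dt : differentiable t x by apply: smooth_differentiable; exact: smooth_height.
have dtc : differentiable (t * taylor_coef n.+1 f) x by exact: differentiableM.
have dctc : differentiable (taylor_coef n f + t * taylor_coef n.+1 f) x by exact: differentiableD.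
rewrite E; split=> [|v]; first exact: differentiableD.
rewrite deriveD; [|exact: diff_derivable|exact: diff_derivable].
rewrite Dq addr0 deriveD; [|exact: diff_derivable|exact: diff_derivable].
have Dt : derivable t x v by exact: diff_derivable.
have Dc : derivable (taylor_coef n.+1 f) x v by apply: diff_derivable.
rewrite (deriveM Dt Dc).
by rewrite tx scale0r add0r derive_height /GRing.scale /= mulrC.
Qed.

Lemma taylor_quot_differentiable n f x : smooth_on setT f -> differentiable (taylor_quot n f) x.
Proof.
move=> fs; have [tx|tx] := eqVneq (t x) 0; first by case: (taylor_quot_height0 n fs tx).
apply: (@differentiable_near_eq _ _ _ (taylor_rem n f * (fun y => ((t ^+ n) y)^-1))).
  have tE y : (t ^+ n) y = t y ^+ n by rewrite !fctE.
  have : \forall y \near x, t y != 0.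
    have := differentiable_continuous (smooth_differentiable x smooth_height).
    by move/(_ [set z | z != 0]); apply; apply: open_nbhs_nbhs; split => //; exact: open_neq.
  by apply: filterS => y ty; rewrite /taylor_quot (negbTE ty) -tE.
apply: differentiableM; first by apply: smooth_differentiable; exact: smooth_taylor_rem.
apply: differentiableV; first by apply: smooth_differentiable; exact: smooth_heightX.
by rewrite !fctE expf_neq0.
Qed.

(* The derivatives of Taylor quotients are combinations of Taylor quotients, so
   differentiability alone already gives smoothness. *)
Lemma derive_taylor_quot n f x v : smooth_on setT f -> 'D_v (taylor_quot n f) x =
  taylor_quot n ('D_(hor v) f) x
  + v ord0 i * (taylor_quot n ('D_e f) x - n%:R * taylor_quot n.+1 f x).
Proof.
move=> fs; have hs := smooth_derive (hor v) fs; have es := smooth_derive e fs.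
have [tx|tx] := eqVneq (t x) 0.
  have [_ ->] := taylor_quot_height0 n fs tx.
  rewrite (derive_taylor_coef n x v fs) /taylor_quot tx eqxx taylor_coef_derive -natr1; ring.
(* Off the hyperplane the formula passes from [n] to [n.+1] by differentiating the recursion for
   [taylor_quot n f] and cancelling the nonzero factor [t x]. *)
elim: n => [|n IH].
  have := derive_linear (smooth_differentiable x fs) (v ord0 i) e (hor v).
  by rewrite {1}/hor addrC subrK !taylor_quot0 mul0r subr0 addrC.
have E : taylor_quot n f = taylor_coef n f + t * taylor_quot n.+1 f.
  by apply/funext => y; rewrite (taylor_quot_step n).
have Dt : derivable t x v by apply: diff_derivable; apply: smooth_differentiable;
  exact: smooth_height.
have Dc : derivable (taylor_coef n f) x v.
  by apply: diff_derivable; apply: smooth_differentiable; exact: smooth_taylor_coef.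
have Dq : derivable (taylor_quot n.+1 f) x v
  by apply: diff_derivable; exact: taylor_quot_differentiable.
have DE : 'D_v (taylor_quot n f) x = taylor_coef n ('D_(hor v) f) x
    + (t x * 'D_v (taylor_quot n.+1 f) x + taylor_quot n.+1 f x * v ord0 i).
  rewrite {1}E (deriveD Dc (derivableM Dt Dq)) (derive_taylor_coef n x v fs); congr (_ + _).
  by rewrite (deriveM Dt Dq) derive_height.
move: IH; rewrite DE (taylor_quot_step n ('D_(hor v) f)) (taylor_quot_step n ('D_e f)).
rewrite taylor_coef_derive.
rewrite (taylor_quot_step n.+1 f) => IH; apply: (mulfI tx); move: IH.
set D := 'D_v _ _; set a := taylor_coef _ _ _; set b := taylor_coef _ _ _.
set q1 := taylor_quot _ _ _; set q2 := taylor_quot _ _ _; set q3 := taylor_quot _ _ _.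
rewrite -natr1; lra.
Qed.

Lemma smooth_taylor_quot n f : smooth_on setT f -> smooth_on setT (taylor_quot n f).
Proof.
move=> fs k; elim: k n f fs => [//|k IH] n f fs;
  split=> [x _|v]; first exact: taylor_quot_differentiable.
have -> : 'D_v (taylor_quot n f) = taylor_quot n ('D_(hor v) f)
  + v ord0 i *: (taylor_quot n ('D_e f) - n%:R *: taylor_quot n.+1 f).
  by apply/funext => x; rewrite derive_taylor_quot.
have oT := @openT ('rV[R]_d); have se := smooth_derive e fs.
apply: ndifferentiableD => //; first by apply: IH; exact: smooth_derive.
apply: ndifferentiableZ => //; apply: ndifferentiableB => //; first exact: IH.
by apply: ndifferentiableZ => //; exact: IH.
Qed.

Lemma hadamard f : smooth_on setT f -> exists2 g, smooth_on setT g &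
  forall x, f x - f (x - (x ord0 i - c) *: delta_mx ord0 i)
            = (x ord0 i - c) * g x.
Proof.
move=> fs; exists (taylor_quot 1 f); first exact: smooth_taylor_quot.
move=> x; have := taylor_quot_step 0 f x; rewrite taylor_quot0 => {1}->.
by rewrite /taylor_coef /= fact0 divr1 addrAC subrr add0r.
Qed.

End Hadamard.

(** * Bump functions *)

Section Bump.
Variable R : realType.
Implicit Types (s t : R).

(* The functions [t^-n exp(-1/t)], all smooth at [0], form a family that is closed
   under differentiation. *)
Definition flat n t : R := if t <= 0 then 0 else t^-1 ^+ n * expR (- t^-1).

Lemma flat_le0 n t : t <= 0 -> flat n t = 0.
Proof. by rewrite /flat => ->. Qed.

Lemma flat_gt0 n t : 0 < t -> 0 < flat n t.
Proof.
by move=> t0; rewrite /flat leNgt t0 /= mulr_gt0 ?expR_gt0 // exprn_gt0 // invr_gt0.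
Qed.

Lemma flat_ge0 n t : 0 <= flat n t.
Proof. by have [t0|t0] := leP t 0; [rewrite flat_le0|exact: ltW (flat_gt0 n t0)]. Qed.

(** With [s] the inverse of [t], the exponential series gives that [expR s] is at least [s ^+ n.+2]
    over the factorial of [n.+2]. The two powers beyond [n] leave the factor [t ^+ 2] that
    differentiability at 0 calls for. *)
Lemma flat_quadratic n t : `|flat n t| <= (factorial n.+2)%:R * `|t| ^+ 2.
Proof.
rewrite ger0_norm ?flat_ge0 //; have [t0|t0] := leP t 0.
  by rewrite flat_le0 // mulr_ge0 // exprn_ge0.
rewrite /flat (leNgt t) t0 /= gtr0_norm //.
have s0 : 0 < t^-1 by rewrite invr_gt0.
have := expR_ge1Dxn n.+1 (ltW s0); set F : R := (factorial _)%:R => h.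
have F0 : 0 < F by rewrite ltr0n fact_gt0.
have {}h : t^-1 ^+ n.+2 <= F * expR t^-1.
  rewrite mulrC -ler_pdivrMr //; apply: le_trans h; lra.
rewrite expRN ler_pdivrMr ?expR_gt0 //.
have -> : t^-1 ^+ n = t ^+ 2 * t^-1 ^+ n.+2.
  rewrite !exprS expr0 mulr1; move: (t^-1 ^+ n) => u.
  by field; rewrite gt_eqF.
by rewrite [F * _]mulrC -[_ * F * _]mulrA ler_wpM2l // exprn_ge0 // ltW.
Qed.

Lemma is_derive_flat n t :
  is_derive t 1 (flat n) (flat n.+2 t - n%:R * flat n.+1 t).
Proof.
have [t0|t0|->] := ltgtP t 0.
- rewrite !flat_le0 ?(ltW t0) // mulr0 subr0.
  apply: (@near_eq_is_derive _ R^o R^o (cst 0) _ _ _ _ _ (is_derive_cst 0 t 1)).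
  by near=> s; rewrite flat_le0 //; apply: ltW; near: s; exact: lt_nbhsl.
- have tn0 : t != 0 by rewrite gt_eqF.
  have dV : is_derive t 1 (fun t : R => t^-1) (- t ^- 2).
    by have := is_deriveV tn0 (is_derive_id t 1); rewrite /GRing.scale /= mulr1.
  have dX : is_derive t 1 (fun t : R => t^-1 ^+ n) (- (n%:R * t^-1 ^+ n.+1)).
    have -> : (fun t : R => t^-1 ^+ n) = (fun t : R => t^-1) ^+ n.
      by apply/funext => s; rewrite !fctE.
    apply: is_derive_eq (is_deriveX n dV) _.
    case: n => [|n]; first by rewrite !mul0r oppr0 scale0r.
    by rewrite /GRing.scale /= !exprS expr0 exprVn; field; rewrite ?expf_neq0 ?tn0.
  have dE : is_derive t 1 (fun t : R => expR (- t^-1)) (t ^- 2 * expR (- t^-1)).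
    have dN := is_deriveN dV.
    have := @is_derive1_comp _ expR (- (fun t : R => t^-1)) t _ _ (is_derive_expR (- t^-1)) dN.
    by rewrite opprK mulrC.
  apply: (@near_eq_is_derive _ R^o R^o (fun s => s^-1 ^+ n * expR (- s^-1))).
    near=> s; rewrite /flat leNgt ifF //; apply/negbTE/negPn; near: s; exact: lt_nbhsr.
  apply: is_derive_eq (is_deriveM dX dE) _.
  rewrite /GRing.scale /flat leNgt t0 /= !exprS; move: (t^-1 ^+ n) => u.
  by field.
- rewrite !flat_le0 // mulr0 subr0.
  have [|df Df] := @quadratic_differentiable R R^o R^o (flat n) 0 (factorial n.+2)%:R.
    by near=> s; rewrite subr0; exact: flat_quadratic.
  by apply: DeriveDef; [exact: diff_derivable|exact: Df].
Unshelve. all: by end_near.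
Qed.

Section Composition.
Variable d : nat.
Implicit Types (U : set 'rV[R]_d) (f g : 'rV[R]_d -> R).

(** Differentiating raises the index of [flat], so the induction on the order treats all [n] at
    once. *)
Lemma ndifferentiable_flat k n U g : open U ->
  ndifferentiable k U g -> ndifferentiable k U (flat n \o g).
Proof.
move=> Uo; elim: k n g => [//|k IH] n g gk; have [dg Dg] := gk.
have df t : differentiable (flat n) t.
  by apply/derivable1_diffP; case: (is_derive_flat n t).
split=> [x Ux|v]; first by apply: differentiable_comp => //; exact: dg.
have gk' := ndifferentiableW gk.
have S : ndifferentiable k U
    (((flat n.+2 \o g) - n%:R *: (flat n.+1 \o g)) * 'D_v g).
  apply: ndifferentiableM => //; last exact: Dg.
  by apply: ndifferentiableB => //; [|apply: ndifferentiableZ => //]; exact: IH.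
apply: ndifferentiable_ext S => // x Ux.
have Ef u : 'd (flat n) (g x) u = u * (flat n.+2 (g x) - n%:R * flat n.+1 (g x)).
  have [_ <-] := is_derive_flat n (g x).
  rewrite deriveE // -{1}[u]mulr1 -[u * 1]/(u *: (1 : R^o)) linearZ.
  by [].
rewrite deriveE; last by apply: differentiable_comp => //; exact: dg.
rewrite diff_comp //; last exact: dg.
rewrite /= Ef -(deriveE v (dg x Ux)); exact: mulrC.
Qed.

Definition box (a : 'rV[R]_d) (r : R) : set 'rV[R]_d :=
  [set x | forall j, `|x ord0 j - a ord0 j| < r].

Definition cbox (a : 'rV[R]_d) (r : R) : set 'rV[R]_d :=
  [set x | forall j, `|x ord0 j - a ord0 j| <= r].

Lemma cbox_compact a r : compact (cbox a r).
Proof.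
have := @rV_compact R^o d (fun j => `[a ord0 j - r, a ord0 j + r]%classic)
  (fun j => @segment_compact R _ _).
congr compact; apply/seteqP; split=> x /= h j; have := h j.
  by rewrite /= in_itv /= ler_distl.
by rewrite /= in_itv /= ler_distl.
Qed.

Lemma cbox_closed a r : closed (cbox a r).
Proof. exact: (compact_closed (@norm_hausdorff _ _) (@cbox_compact a r)). Qed.

Lemma nbhs_cbox a (U : set 'rV[R]_d) : open U -> U a ->
  exists2 r, 0 < r & cbox a r `<=` U.
Proof.
move=> Uo Ua; have /nbhs_normP[r /= r0 rU] := open_nbhs_nbhs (conj Uo Ua).
exists (r / 2); first by rewrite divr_gt0.
move=> x ax; apply: rU => /=; apply: (@le_lt_trans _ _ (r / 2)).
  apply: rV_norm_le => [|j]; first by rewrite divr_ge0 // ltW.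
  by rewrite !mxE distrC; exact: ax.
by lra.
Qed.

(** [inn] is positive exactly on the open box of radius [r2], and [out] vanishes exactly on the
    closed box of radius [r1]. Since [r1 < r2], the sum [inn + out] has no zero, and [inn] divided
    by it is the plateau. The boxes are described by squares of coordinates because absolute values
    are not smooth. *)
Lemma plateau (a : 'rV[R]_d) (r1 r2 : R) : 0 < r1 -> r1 < r2 ->
  exists h : 'rV[R]_d -> R, [/\ smooth_on setT h,
    forall x, cbox a r1 x -> h x = 1 & forall x, ~ box a r2 x -> h x = 0].
Proof.
move=> r10 r12; have oT := @openT 'rV[R]_d.
pose sq j := fun x : 'rV[R]_d => (x ord0 j - a ord0 j) ^+ 2.
have sqs j k : ndifferentiable k setT (sq j).
  have cs : ndifferentiable k setT (fun x : 'rV[R]_d => x ord0 j - a ord0 j).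
    by apply: ndifferentiableB => //; [exact: ndifferentiable_coord|exact: ndifferentiable_cst].
  apply: (ndifferentiable_ext oT _ (ndifferentiableM oT cs cs)) => x _.
  exact: esym (expr2 _).
pose inn x := \prod_j flat 0 (r2 ^+ 2 - sq j x).
pose out x := \sum_j flat 0 (sq j x - r1 ^+ 2).
have inns k : ndifferentiable k setT inn.
  have -> : inn = \prod_j (flat 0 \o (cst (r2 ^+ 2) - sq j)).
    by apply/funext => x; rewrite fct_prodE.
  elim/big_rec: _ => [|j f _ IH]; first exact: ndifferentiable_cst.
  apply: ndifferentiableM => //; apply: ndifferentiable_flat => //.
  by apply: ndifferentiableB => //; exact: ndifferentiable_cst.
have outs k : ndifferentiable k setT out.
  have -> : out = \sum_j (flat 0 \o (sq j - cst (r1 ^+ 2))).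
    by apply/funext => x; rewrite fct_sumE.
  apply: ndifferentiable_sum => // j _; apply: ndifferentiable_flat => //.
  by apply: ndifferentiableB => //; exact: ndifferentiable_cst.
have r20 : 0 < r2 by exact: lt_trans r12.
have sqE j x : sq j x = `|x ord0 j - a ord0 j| ^+ 2 by rewrite real_normK ?num_real.
have sqP j x r : 0 < r -> (sq j x < r ^+ 2) = (`|x ord0 j - a ord0 j| < r).
  by move=> r0; rewrite sqE ltr_pXn2r // nnegrE ltW.
have inn_ge0 x : 0 <= inn x by apply: prodr_ge0 => j _; exact: flat_ge0.
have out_ge0 x : 0 <= out x by apply: sumr_ge0 => j _; exact: flat_ge0.
have inn_gt0 x : box a r2 x -> 0 < inn x.
  by move=> bx; apply: prodr_gt0 => j _; apply: flat_gt0; rewrite subr_gt0 sqP.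
have out0 x : cbox a r1 x -> out x = 0.
  move=> bx; apply: big1 => j _; apply: flat_le0; rewrite subr_le0.
  rewrite sqE ler_pXn2r // ?nnegrE // ?(ltW r10) //.
have den x : 0 < inn x + out x.
  have [bx|] := pselect (cbox a r1 x).
    by rewrite ltr_wpDr //; apply: inn_gt0 => j; exact: le_lt_trans r12.
  move/existsNP => [j /negP]; rewrite -ltNge => rj.
  rewrite ltr_wpDl // /out (bigD1 j) //= ltr_wpDr //.
    by apply: sumr_ge0 => l _; exact: flat_ge0.
  apply: flat_gt0; rewrite subr_gt0 sqE.
  by rewrite ltr_pXn2r // nnegrE // ltW.
exists (fun x => inn x / (inn x + out x)); split.
- move=> k; apply: ndifferentiable_quotient => // x _.
  exists (inn + out), inn; split => //; first exact: ndifferentiableD.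
    by rewrite gt_eqF //; exact: den.
  move=> y _; rewrite -[(inn + out) y]/(inn y + out y) mulrC divfK //.
  by rewrite gt_eqF.
- by move=> x ox; have := den x; rewrite out0 // addr0 => ix; rewrite divff // gt_eqF.
move=> x /existsNP[j /negP]; rewrite -leNgt => rj.
rewrite /inn (bigD1 j) //= flat_le0 ?mul0r // subr_le0 leNgt sqP // -leNgt //.
Qed.

End Composition.
End Bump.

(** * Hadamard's lemma in all coordinates *)

Section FullHadamard.
Variables (R : realType) (d : nat).

Definition freeze (s : seq 'I_d) (a x : 'rV[R]_d) : 'rV[R]_d :=
  \row_j (if j \in s then a ord0 j else x ord0 j).

Lemma smooth_freeze s a (f : 'rV[R]_d -> R) :
  smooth_on setT f -> smooth_on setT (f \o freeze s a).
Proof.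
move=> fs k; apply: (@ndifferentiable_comp _ _ _ setT setT) => //; try exact: openT.
move=> j; case js : (j \in s).
  have -> : (fun x => freeze s a x ord0 j) = cst (a ord0 j).
    by apply/funext => x; rewrite mxE js.
  exact: ndifferentiable_cst.
have -> : (fun x => freeze s a x ord0 j) = (fun x => x ord0 j).
  by apply/funext => x; rewrite mxE js.
exact: ndifferentiable_coord.
Qed.

(** The coordinates are frozen one at a time and the differences telescope. Freezing [i] on top of
    [s] evaluates [f \o freeze s a] at the foot of [x] on the hyperplane through [a], so each
    difference is an instance of the one-coordinate lemma. *)
Lemma hadamard_seq (f : 'rV[R]_d -> R) (a : 'rV[R]_d) (s : seq 'I_d) :
  smooth_on setT f -> uniq s -> exists g : 'I_d -> 'rV[R]_d -> R,
    (forall i, smooth_on setT (g i)) /\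
    forall x, f x - f (freeze s a x) = \sum_(i <- s) (x ord0 i - a ord0 i) * g i x.
Proof.
move=> fs; elim: s => [_|i s IH /= /andP[ni us]].
  exists (fun _ => cst 0); split=> [i k|x]; first exact: ndifferentiable_cst.
  rewrite big_nil; apply/eqP; rewrite subr_eq0; apply/eqP; congr f.
  by apply/rowP => j; rewrite mxE.
have [g [gs gE]] := IH us.
have [h hs hE] := hadamard i (a ord0 i) (smooth_freeze s a fs).
exists (fun j => if j == i then h else g j); split=> [j|x]; first by case: eqP.
rewrite big_cons eqxx -hE /=.
have -> : \sum_(j <- s) (x ord0 j - a ord0 j) * (if j == i then h else g j) x
        = f x - f (freeze s a x).
  rewrite gE [LHS]big_seq [RHS]big_seq; apply: eq_bigr => j js.
  by rewrite ifF //; apply: contraNF ni => /eqP <-.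
have -> : freeze (i :: s) a x = freeze s a (x - (x ord0 i - a ord0 i) *: delta_mx ord0 i).
  apply/rowP => j; rewrite !mxE in_cons eqxx /=; have [->|ji] /= := eqVneq j i.
    by rewrite mulr1 (negbTE ni); ring.
  by rewrite mulr0 subr0.
by ring.
Qed.

Lemma hadamard_expansion (f : 'rV[R]_d -> R) (a : 'rV[R]_d) : smooth_on setT f ->
  exists g : 'I_d -> 'rV[R]_d -> R, (forall i, smooth_on setT (g i)) /\
    forall x, f x - f a = \sum_i (x ord0 i - a ord0 i) * g i x.
Proof.
move=> fs; have [g [gs gE]] := hadamard_seq a fs (index_enum_uniq 'I_d).
exists g; split=> // x; rewrite -gE; congr (_ - f _).
by apply/rowP => j; rewrite mxE mem_index_enum.
Qed.

End FullHadamard.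

Lemma smooth_extend_zero (R : realType) (d : nat) (U K : set 'rV[R]_d)
    (h : 'rV[R]_d -> R) : open U -> closed K -> K `<=` U ->
  (forall x, ~ K x -> h x = 0) -> smooth_on U h -> smooth_on setT h.
Proof.
move=> Uo Kc KU h0 hs k; apply: ndifferentiable_local => x _.
have [Kx|Kx] := pselect (K x); first by exists U; [exact: KU|exact: hs].
exists (~` K) => //.
apply: (@ndifferentiable_ext _ _ _ _ (cst 0)); first exact: closed_openC.
  by move=> y Ky; rewrite h0.
exact: ndifferentiable_cst.
Qed.

(** * Local frames on a manifold *)

Section Extension.
Variables (R : realType) (d : nat) (P : manifold R d).
Implicit Types (c : chart R d P) (h : 'rV[R]_d -> R).

Definition chart_img c := chart_map c @` chart_dom c.

Lemma chart_img_inv c x : chart_img c x ->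
  chart_dom c (chart_inv c x) /\ chart_map c (chart_inv c x) = x.
Proof. by move=> [q cq <-]; rewrite chart_mapK. Qed.

Lemma chart_map_open c (A : set P) : open A ->
  open (chart_map c @` (chart_dom c `&` A)).
Proof.
move=> Ao; rewrite openE => x [q [cq Aq] <-].
have Ix : chart_img c (chart_map c q) by exists q.
have n1 := open_nbhs_nbhs (conj (@chart_imgO R d P c) Ix).
have n2 : \forall y \near chart_map c q, A (chart_inv c y).
  apply: (chart_invC Ix); rewrite chart_mapK //; exact: open_nbhs_nbhs.
apply: filterS2 n1 n2 => y Iy Ay.
have [cy yE] := chart_img_inv Iy; by exists (chart_inv c y).
Qed.

Definition chart_ext c h : P -> R := fun q =>
  if `[<chart_dom c q>] then h (chart_map c q) else 0.

Lemma chart_ext_in c h q : chart_dom c q -> chart_ext c h q = h (chart_map c q).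
Proof. by move=> cq; rewrite /chart_ext asboolT. Qed.

Lemma chart_ext_out c h q : ~ chart_dom c q -> chart_ext c h q = 0.
Proof. by move=> cq; rewrite /chart_ext asboolF. Qed.

(** Seen from another chart, the function is [h] after a smooth transition at points of the domain
    of [c]. At any other point it vanishes nearby: the image of the compact set [K] is closed in
    [P], which is Hausdorff, so some neighbourhood of the point misses it. *)
Lemma chart_ext_smooth c h K : atlas c -> compact K -> K `<=` chart_img c ->
  (forall x, ~ K x -> h x = 0) -> smooth_on (chart_img c) h ->
  smooth_map (chart_ext c h).
Proof.
move=> Ac Kc KI h0 hs c' Ac' k; apply: ndifferentiable_local => y Iy.
have [c'q yE] := chart_img_inv Iy; set q := chart_inv c' y in c'q yE.
have [cq|cq] := pselect (chart_dom c q).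
  exists (chart_map c' @` (chart_dom c' `&` chart_dom c)); first by exists q.
  have Wo : open (chart_map c' @` (chart_dom c' `&` chart_dom c)).
    by apply: chart_map_open; exact: (@chart_domO R d P c).
  pose chi x := chart_map c (chart_inv c' x).
  apply: (@ndifferentiable_ext _ _ _ _ (h \o chi)) => //.
    move=> _ [p [c'p cp] <-] /=; rewrite /chi !chart_mapK //.
    by rewrite chart_ext_in.
  apply: (@ndifferentiable_comp _ _ _ _ (chart_img c)) => //.
  - by move=> _ [p [c'p cp] <-] /=; rewrite /chi !chart_mapK //; exists p.
  - by move=> i; exact: (atlas_smooth Ac' Ac).
pose L := chart_inv c @` K.
have Lc : closed L.
  apply: compact_closed; first exact: manifold_hausdorff.
  apply: continuous_compact Kc.
  apply: continuous_in_subspaceT => x; rewrite inE => /KI; exact: chart_invC.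
exists (chart_map c' @` (chart_dom c' `&` ~` L)).
  exists q => //; split=> // -[x Kx qE]; apply: cq; rewrite -qE.
  by case: (chart_img_inv (KI _ Kx)).
apply: (@ndifferentiable_ext _ _ _ _ (cst 0)).
- by apply: chart_map_open; exact: closed_openC.
- move=> _ [p [c'p Lp] <-] /=; rewrite chart_mapK //.
  have [cp|cp] := pselect (chart_dom c p); last by rewrite chart_ext_out.
  rewrite chart_ext_in // h0 // => Kp; apply: Lp.
  by exists (chart_map c p) => //; exact: chart_mapK.
- exact: ndifferentiable_cst.
Qed.

End Extension.

Section PointwiseOperations.
Variables (R : realType) (d : nat) (P : manifold R d).
Implicit Types (f g : Cinf P).

Lemma CinfP f g : (forall p, f p = g p) -> f = g.
Proof. by move=> fg; apply/val_inj/funext. Qed.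

Lemma Cinf_addE f g p : (f + g) p = f p + g p. Proof. by []. Qed.
Lemma Cinf_oppE f p : (- f) p = - f p. Proof. by []. Qed.
Lemma Cinf_mulE f g p : (f * g) p = f p * g p. Proof. by []. Qed.
Lemma Cinf_scaleE (a : R) f p : (a *: f) p = a * f p. Proof. by []. Qed.
Lemma Cinf_sumE (I : Type) (r : seq I) (Q : pred I) (F : I -> Cinf P) p :
  (\sum_(i <- r | Q i) F i) p = \sum_(i <- r | Q i) F i p.
Proof. exact: (big_morph (fun f : Cinf P => f p) (fun f g => erefl) erefl). Qed.

Lemma vf_sumE (I : Type) (r : seq I) (Q : pred I) (F : I -> vfield P) f :
  (\sum_(i <- r | Q i) F i) f = \sum_(i <- r | Q i) F i f.
Proof. exact: (big_morph (fun X : vfield P => X f) (fun X Y => erefl) erefl). Qed.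

End PointwiseOperations.

(** * Coordinate fields multiplied by a bump function *)

Section LocalFrame.
Variables (R : realType) (d : nat) (P : manifold R d).

(** The factor [h], supported in a compact part of the chart, makes the partial derivative a
    derivation of global functions. *)
Lemma chart_partial (c : chart R d P) (K : set 'rV[R]_d) (h : 'rV[R]_d -> R) (i : 'I_d) :
  atlas c -> compact K -> K `<=` chart_img c ->
  (forall x, ~ K x -> h x = 0) -> smooth_on (chart_img c) h ->
  exists X : vfield P, forall (f : Cinf P) q, X f q =
    chart_ext c (fun x => h x * 'D_(delta_mx ord0 i) (f \o chart_inv c) x) q.
Proof.
move=> Ac Kc KI h0 hs; have Io : open (chart_img c) by exact: (@chart_imgO R d P c).
pose F (f : Cinf P) := chart_ext c (fun x => h x * 'D_(delta_mx ord0 i) (f \o chart_inv c) x).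
have fs (f : Cinf P) : smooth_on (chart_img c) (f \o chart_inv c).
  by move/smooth_predP: (cinf_smooth f); apply.
have Fs f : F f \in @smooth_pred R d P.
  apply/smooth_predP; apply: (chart_ext_smooth Ac Kc KI).
    by move=> x Kx; rewrite h0 ?mul0r.
  move=> k; have [_ Df] := fs f k.+1.
  exact: (ndifferentiableM Io (hs k) (Df (delta_mx ord0 i))).
have df (f : Cinf P) q : chart_dom c q ->
    derivable (f \o chart_inv c) (chart_map c q) (delta_mx ord0 i).
  move=> cq; apply: diff_derivable; case: (fs f 1) => + _; apply; by exists q.
have lin (a : R) (f g : Cinf P) :
    MkCinf (Fs (a *: f + g)) = a *: MkCinf (Fs f) + MkCinf (Fs g).
  apply: CinfP => q; rewrite Cinf_addE Cinf_scaleE /= /F.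
  have [cq|cq] := pselect (chart_dom c q); last first.
    by rewrite !chart_ext_out // mulr0 addr0.
  rewrite !chart_ext_in //.
  have -> : (a *: f + g : Cinf P) \o chart_inv c = a *: (f \o chart_inv c) + (g \o chart_inv c).
    by [].
  have da : derivable (a *: (f \o chart_inv c)) (chart_map c q) (delta_mx ord0 i).
    by apply: derivableZ; exact: df.
  rewrite (deriveD da (df g q cq)) deriveZ; last exact: df.
  by rewrite /GRing.scale /=; ring.
have leib (f g : Cinf P) :
    MkCinf (Fs (f * g)) = f * MkCinf (Fs g) + MkCinf (Fs f) * g.
  apply: CinfP => q; rewrite Cinf_addE !Cinf_mulE /= /F.
  have [cq|cq] := pselect (chart_dom c q); last first.
    by rewrite !chart_ext_out // mulr0 mul0r addr0.
  rewrite !chart_ext_in //.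
  have -> : (f * g : Cinf P) \o chart_inv c = (f \o chart_inv c) * (g \o chart_inv c).
    by [].
  rewrite (deriveM (df f q cq) (df g q cq)) /= chart_mapK //.
  by rewrite /GRing.scale /=; ring.
by exists (VField lin leib).
Qed.

Lemma box_nbhs (a y : 'rV[R]_d) (r : R) : box a r y -> \forall z \near y, box a r z.
Proof.
move=> ay; apply: (@filter_forall 'rV[R]_d 'I_d
  (fun j z => `|z ord0 j - a ord0 j| < r) (nbhs y) _ _) => j.
have := ay j; rewrite -subr_gt0 => rj.
suff : \forall z \near y, `|(z : 'rV[R]_d) ord0 j - a ord0 j| < r by [].
apply/nbhs_normP; exists (r - `|y ord0 j - a ord0 j|) => //= z /= yz.
have := le_lt_trans (rV_coord_le (y - z) j) yz; rewrite !mxE distrC => h.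
have -> : z ord0 j - a ord0 j = (z ord0 j - y ord0 j) + (y ord0 j - a ord0 j) by ring.
by apply: le_lt_trans (ler_normD _ _) _; rewrite -ltrBrDr.
Qed.

(* [b] is a bump function at [p], [X i] is [b] times the i-th coordinate field and
   [x i] is the i-th coordinate, cut off outside a neighbourhood of the support
   of [b]. *)
Lemma local_frame (p : P) : exists (b : Cinf P) (x : 'I_d -> Cinf P) (X : 'I_d -> vfield P),
  [/\ b p = 1, forall i k, X k (x i) = (i == k)%:R * b
    & forall Y : vfield P, b *: Y = \sum_i Y (x i) *: X i].
Proof.
have [c Ac cp] := atlas_cover p.
have Io : open (chart_img c) by exact: (@chart_imgO R d P c).
set a := chart_map c p.
have Ia : chart_img c a by exists p.
have [r r0 rI] := nbhs_cbox Io Ia.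
(* Three nested boxes: [h0] is 1 on the smallest and vanishes outside the middle one, on which [h1]
   is 1, while [h1] vanishes outside the largest, contained in the chart. Hence cutting off by [h1]
   changes nothing where [h0] is nonzero. *)
have [r4 r42 r2 r21] : [/\ 0 < r / 4, r / 4 < r / 2, 0 < r / 2 & r / 2 < r] by split; lra.
have [h0 [h0s h01 h00]] := plateau a r4 r42.
have [h1 [h1s h11 h10]] := plateau a r2 r21.
pose K := cbox a r.
have Kc : compact K by exact: cbox_compact.
have h1K x : ~ K x -> h1 x = 0.
  by move=> Kx; apply: h10 => bx; apply: Kx => j; exact: ltW.
have h0K x : ~ K x -> h0 x = 0.
  move=> Kx; apply: h00 => bx; apply: Kx => j; have := bx j; lra.
have ext h : (forall x, ~ K x -> h x = 0) -> smooth_on (chart_img c) h ->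
    {f : Cinf P | cinf_fun f = chart_ext c h}.
  move=> hK hs; have fs : chart_ext c h \in @smooth_pred R d P.
    by apply/smooth_predP; exact: (chart_ext_smooth Ac Kc rI hK hs).
  by exists (MkCinf fs).
have onI h : smooth_on setT h -> smooth_on (chart_img c) h.
  by move=> hs k; apply: ndifferentiable_sub (hs k).
have [b bE] := ext h0 h0K (onI _ h0s).
have [e eE] := ext h1 h1K (onI _ h1s).
have ext1 g : smooth_on setT g -> {f : Cinf P | cinf_fun f = chart_ext c (h1 * g)}.
  move=> gs; apply: ext => [x /h1K h1x|k]; first by rewrite fctE /= h1x mul0r.
  by apply: ndifferentiableM => //; [exact: onI|exact: onI].
have cs i : smooth_on setT (fun x : 'rV[R]_d => x ord0 i).
  by move=> k; exact: ndifferentiable_coord.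
pose x i := sval (ext1 _ (cs i)).
have xE i : cinf_fun (x i) = chart_ext c (h1 * (fun x => x ord0 i)).
  exact: (svalP (ext1 _ (cs i))).
have /choice[X XE] : forall i, exists X : vfield P, forall (f : Cinf P) q, X f q =
    chart_ext c (fun x => h0 x * 'D_(delta_mx ord0 i) (f \o chart_inv c) x) q.
  by move=> i; exact: (chart_partial i Ac Kc rI h0K (onI _ h0s)).
have Xx i k : X k (x i) = (i == k)%:R * b.
  apply: CinfP => q; rewrite XE Cinf_mulE bE.
  have [cq|cq] := pselect (chart_dom c q); last by rewrite !chart_ext_out // mulr0.
  rewrite !chart_ext_in //; set y := chart_map c q.
  have [->|h0y] := eqVneq (h0 y) 0; first by rewrite mul0r mulr0.
  have ay : box a (r / 2) y by apply: contrapT => /h00 E; rewrite E eqxx in h0y.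
  have xnear : \forall z \near y, (x i \o chart_inv c) z = z ord0 i.
    have Iy : chart_img c y by exists q.
    apply: filterS2 (box_nbhs ay) (open_nbhs_nbhs (conj Io Iy)) => z az Iz.
    have [cz zE] := chart_img_inv Iz.
    rewrite /= xE chart_ext_in // zE fctE /= h11 ?mul1r // => j; exact: ltW.
  have dc := is_diff_coord i y.
  rewrite (near_eq_derive _ xnear) deriveE // diff_val mxE eqxx /= mulrC.
  by case: eqP.
exists b, x, X; split; [|exact: Xx|].
  by rewrite bE chart_ext_in // h01 // => j; rewrite subrr normr0; lra.
move=> Y; apply: vfP => f; rewrite vf_sumE; apply: CinfP => q.
rewrite Cinf_sumE; change (b q * Y f q = \sum_i Y (x i) q * X i f q).
have [cq|cq] := pselect (chart_dom c q); last first.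
  by rewrite bE chart_ext_out // mul0r big1 // => i _; rewrite XE chart_ext_out // mulr0.
set y := chart_map c q.
have bq : b q = h0 y by rewrite bE chart_ext_in.
have [h0y|h0y] := eqVneq (h0 y) 0.
  by rewrite bq h0y mul0r big1 // => i _; rewrite XE chart_ext_in // h0y mul0r mulr0.
have ay : box a (r / 2) y by apply: contrapT => /h00 E; rewrite E eqxx in h0y.
have h1y : h1 y = 1 by apply: h11 => j; exact: ltW.
pose F z := h1 z * f (chart_inv c z).
have Fs : smooth_on setT F.
  apply: (@smooth_extend_zero _ _ (chart_img c) K) => //; first exact: cbox_closed.
    by move=> z /h1K h1z; rewrite /F h1z mul0r.
  have fs : smooth_on (chart_img c) (f \o chart_inv c).
    by move/smooth_predP: (cinf_smooth f); apply.
  by move=> k; exact: (ndifferentiableM Io (onI _ h1s k) (fs k)).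
have [g [gs gE]] := hadamard_expansion y Fs.
pose G i := sval (ext1 _ (gs i)).
have GE i : cinf_fun (G i) = chart_ext c (h1 * g i).
  exact: (svalP (ext1 _ (gs i))).
(* Hadamard's expansion about [y], multiplied by [h1] squared: in every product each factor is then
   cut off and extends to a global smooth function, to which a vector field can be applied. *)
have expand : e * e * (e * f) - F y *: (e * e) = \sum_i (x i - y ord0 i *: e) * G i.
  apply: CinfP => z; rewrite Cinf_addE Cinf_oppE Cinf_scaleE Cinf_sumE !Cinf_mulE.
  have [cz|cz] := pselect (chart_dom c z); last first.
    rewrite eE chart_ext_out // !mul0r mulr0 subr0 big1 // => i _.
    by rewrite Cinf_mulE GE chart_ext_out // mulr0.
  rewrite eE chart_ext_in //; set w := chart_map c z.
  have := gE w; rewrite {1}/F chart_mapK // => E.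
  have -> : h1 w * h1 w * (h1 w * f z) - F y * (h1 w * h1 w)
     = h1 w * h1 w * (h1 w * f z - F y) by ring.
  rewrite E mulr_sumr; apply: eq_bigr => i _.
  rewrite Cinf_mulE Cinf_addE Cinf_oppE Cinf_scaleE xE GE eE !chart_ext_in // !fctE /=.
  by rewrite -/w; ring.
have be : b * e = b.
  apply: CinfP => z; rewrite Cinf_mulE bE eE.
  have [cz|cz] := pselect (chart_dom c z); last by rewrite !chart_ext_out // mul0r.
  rewrite !chart_ext_in //; set w := chart_map c z.
  have [->|h0w] := eqVneq (h0 w) 0; first by rewrite mul0r.
  have aw : box a (r / 2) w by apply: contrapT => /h00 E; rewrite E eqxx in h0w.
  by rewrite h11 ?mulr1 // => j; apply: ltW.
have eq1 : e q = 1 by rewrite eE chart_ext_in.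
have xq i : x i q = y ord0 i by rewrite xE chart_ext_in // fctE /= -/y h1y mul1r.
(* At [q] the factors [x i - y ord0 i *: e] vanish, so that only their derivatives survive. The
   cut-off does not contribute: applying [Z] to [b * e = b] shows that [Z e] vanishes at [q],
   because [b q] does not. *)
have key (Z : vfield P) : Z f q = \sum_i Z (x i) q * g i y.
  have Ze : Z e q = 0.
    have := congr1 (fun k : Cinf P => Z k q) be.
    rewrite /= vf_leibniz Cinf_addE !Cinf_mulE eq1 mulr1 => /eqP.
    by rewrite -subr_eq0 addrK mulf_eq0 bq (negbTE h0y) => /eqP.
  have := congr1 (fun k : Cinf P => Z k q) expand.
  rewrite /= vfD vfN vfZ !vf_leibniz.
  rewrite !(Cinf_addE, Cinf_oppE, Cinf_scaleE, Cinf_mulE) Ze eq1.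
  rewrite !(mulr0, mul0r, mulr1, mul1r, addr0, add0r, subr0, oppr0) => ->.
  have -> : Z (\sum_i (x i - y ord0 i *: e) * G i) = \sum_i Z ((x i - y ord0 i *: e) * G i).
    exact: (big_morph Z (vfD Z) (vf0 Z)).
  rewrite Cinf_sumE; apply: eq_bigr => i _.
  rewrite vf_leibniz vfD vfN vfZ !(Cinf_addE, Cinf_oppE, Cinf_scaleE, Cinf_mulE) Ze eq1 xq.
  rewrite GE chart_ext_in // fctE /= -/y h1y mulr1 subrr mulr0 mul0r add0r subr0 mul1r.
  by [].
(* Applied to the frame fields themselves, the same formula identifies the Hadamard factors with
   their derivatives of [f]. *)
have XkE k : X k f q = b q * g k y.
  rewrite key (bigD1 k) //= big1 => [|i ik]; first by rewrite Xx eqxx mul1r addr0.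
  by rewrite Xx (negbTE ik) mul0r mul0r.
rewrite (key Y) mulr_sumr; apply: eq_bigr => i _; rewrite XkE; ring.
Qed.

End LocalFrame.

(** * The musical isomorphism *)

Section Sharp.
Variables (R : realType) (d : nat) (P : manifold R d) (m : riemannian_metric P).
Implicit Types (X Y Z W : vfield P) (f g : Cinf P) (alpha : pform P).

(** Checks the smoothness of a function assembled from choices made point by point: near each point
    it is a quotient of two global smooth functions. *)
Lemma smooth_map_quotient (F : P -> R) :
  (forall p, exists c e : Cinf P, c p != 0 /\ forall q, c q * F q = e q) ->
  smooth_map F.
Proof.
move=> Fq c Ac k; apply: ndifferentiable_quotient.
  exact: (@chart_imgO R d P c).
move=> y Iy; have [cy yE] := chart_img_inv Iy.
have [u [e [u0 uF]]] := Fq (chart_inv c y).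
exists (u \o chart_inv c), (e \o chart_inv c); split=> //.
- by move/smooth_predP: (cinf_smooth u); apply.
- by move/smooth_predP: (cinf_smooth e); apply.
- by move=> z _ /=; exact: uF.
Qed.

Lemma metricDl X Y Z : m (X + Y) Z = m X Z + m Y Z.
Proof. by rewrite -[X]scale1r metric_linear mul1r scale1r. Qed.

Lemma metric0l Z : m 0 Z = 0.
Proof. by apply: (addIr (m 0 Z)); rewrite -metricDl !add0r. Qed.

Lemma metricZl f X Z : m (f *: X) Z = f * m X Z.
Proof. by rewrite -[f *: X]addr0 metric_linear metric0l addr0. Qed.

Lemma metricZr f X Z : m Z (f *: X) = f * m Z X.
Proof. by rewrite metric_sym metricZl metric_sym. Qed.

Lemma metric_suml (I : Type) (r : seq I) (Q : pred I) (F : I -> vfield P) Z :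
  m (\sum_(i <- r | Q i) F i) Z = \sum_(i <- r | Q i) m (F i) Z.
Proof. exact: (big_morph (fun X => m X Z) (fun X Y => metricDl X Y Z) (metric0l Z)). Qed.

Lemma metric_sumr (I : Type) (r : seq I) (Q : pred I) (F : I -> vfield P) Z :
  m Z (\sum_(i <- r | Q i) F i) = \sum_(i <- r | Q i) m Z (F i).
Proof. by rewrite metric_sym metric_suml; apply: eq_bigr => i _; rewrite metric_sym. Qed.

Lemma metric_tangent0 W p : m W W p = 0 -> forall f, W f p = 0.
Proof.
move=> W0 f; suff : tangent W p = (fun=> 0) by move/(congr1 (fun h : Cinf P -> R => h f)).
by apply: contrapT => /(metric_pos m); rewrite W0 ltxx.
Qed.

Lemma metric_nondegenerate X Y : (forall Z, m X Z = m Y Z) -> X = Y.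
Proof.
move=> XY; apply/eqP; rewrite -subr_eq0; apply/eqP/vfP => f; apply: CinfP => p.
apply: metric_tangent0; rewrite metricDl -scaleN1r metricZl XY mulN1r.
by rewrite subrr.
Qed.

Fact eval_is_additive (p : P) : zmod_morphism (fun f : Cinf P => f p).
Proof. by []. Qed.
Fact eval_is_multiplicative (p : P) : monoid_morphism (fun f : Cinf P => f p).
Proof. by []. Qed.

(* Cramer's rule for the Gram matrix of a local frame; [c] is its determinant,
   cut off. *)
Lemma sharp_local alpha p : is_form 1 alpha ->
  exists (Z : vfield P) (c : Cinf P), c p != 0 /\ forall Y, m Z Y = c * alpha [:: Y].
Proof.
move=> [_ alin _].
have aD f X Y : alpha [:: f *: X + Y] = f * alpha [:: X] + alpha [:: Y] by exact: (alin [::] [::]).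
have a0 : alpha [:: 0] = 0.
  have := aD 1 0 0; rewrite scale1r addr0 mul1r => /eqP.
  by rewrite -subr_eq0 opprD addNKr oppr_eq0 => /eqP.
have aZ f X : alpha [:: f *: X] = f * alpha [:: X] by rewrite -[f *: X]addr0 aD a0 addr0.
have asum (F : 'I_d -> vfield P) : alpha [:: \sum_i F i] = \sum_i alpha [:: F i].
  apply: (big_morph (fun X => alpha [:: X])) => // X Y.
  by rewrite -[X]scale1r aD mul1r scale1r.
have [b [x [X [bp Xx frame]]]] := local_frame p.
pose G : 'M[Cinf P]_d := \matrix_(i, j) m (X i) (X j).
pose v : 'rV[Cinf P]_d := \row_i alpha [:: X i].
pose Z := \sum_j (v *m \adj G) ord0 j *: X j.
have ZX k : m Z (X k) = \det G * alpha [:: X k].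
  transitivity ((v *m \adj G *m G) ord0 k).
    rewrite metric_suml mxE; apply: eq_bigr => j _.
    by rewrite metricZl [G _ _]mxE.
  by rewrite -mulmxA mul_adj_mx mul_mx_scalar !mxE.
(* [Z] is controlled on the frame fields only. The factor [b], moved to the other argument of [m],
   turns [Y] into [b *: Y], which is a combination of them. *)
exists (b *: Z), (\det G * b); split; last first.
  move=> Y; rewrite metricZl -metricZr frame metric_sumr -mulrA -aZ frame asum mulr_sumr.
  by apply: eq_bigr => k _; rewrite metricZr ZX aZ mulrCA.
rewrite Cinf_mulE bp mulr1.
pose ev : {rmorphism Cinf P -> R} := HB.pack (fun f : Cinf P => f p)
  (GRing.isZmodMorphism.Build _ _ _ (eval_is_additive p))
  (GRing.isMonoidMorphism.Build _ _ _ (eval_is_multiplicative p)).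
rewrite -[X in X != 0]/(ev (\det G)) -det_map_mx.
(* A kernel vector of the Gram matrix at [p] gives a combination [W] of the frame of length zero at
   [p], hence with zero tangent vector there. Its values on the coordinates [x i] are the entries of
   [w]. *)
apply/negP => /det0P [w w0 wG].
pose W := \sum_j (w ord0 j *: (1 : Cinf P)) *: X j.
have WW : m W W p = 0.
  rewrite /W metric_sumr Cinf_sumE big1 // => k _.
  rewrite metricZr metric_suml Cinf_mulE Cinf_sumE.
  have := congr1 (fun A : 'rV[R]_d => A ord0 k) wG; rewrite !mxE => wGk.
  rewrite (_ : \sum_j _ = 0) ?mulr0 // -[RHS]wGk; apply: eq_bigr => j _.
  by rewrite metricZl !mxE Cinf_mulE Cinf_scaleE mulr1.
case/negP: w0; apply/eqP/rowP => i.
have := metric_tangent0 WW (x i); rewrite vf_sumE Cinf_sumE (bigD1 i) //= big1 ?addr0.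
  move=> E; rewrite mxE -[RHS]E.
  change (w ord0 i = w ord0 i * 1 * X i (x i) p).
  by rewrite Xx eqxx mul1r bp !mulr1.
move=> j ji; change (w ord0 j * 1 * X j (x i) p = 0).
by rewrite Xx eq_sym (negbTE ji) mul0r mulr0.
Qed.

(** The local solutions [Z p] have products [c p * alpha [:: Y]], so by nondegeneracy any two are
    proportional with ratio given by the functions [c]. The derivation that takes [f] to
    [Z q f q / c q q] at [q] therefore agrees near each [p] with [Z p] divided by [c p], which makes
    it smooth. *)
Lemma sharp_exists alpha : is_form 1 alpha ->
  exists Z : vfield P, forall Y, m Z Y = alpha [:: Y].
Proof.
move=> a1; have [Z ZP] := choice (fun p => sharp_local p a1).
have [c cZ] := choice ZP.
have cp p : c p p != 0 by case: (cZ p).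
have mZ p Y : m (Z p) Y = c p * alpha [:: Y] by case: (cZ p).
have compat p q : c q *: Z p = c p *: Z q.
  by apply: metric_nondegenerate => Y; rewrite !metricZl !mZ mulrCA.
pose F f := fun q => Z q f q / c q q.
have FE p f q : c p q * F f q = Z p f q.
  rewrite /F mulrA; apply: (canLR (mulfK (cp q))).
  have := congr1 (fun X : vfield P => X f q) (compat p q).
  change (c q q * Z p f q = c p q * Z q f q -> c p q * Z q f q = Z p f q * c q q).
  by move=> <-; rewrite mulrC.
have Fs f : F f \in @smooth_pred R d P.
  apply/smooth_predP; apply: smooth_map_quotient => p.
  by exists (c p), (Z p f).
have lin (a : R) (f g : Cinf P) : MkCinf (Fs (a *: f + g)) = a *: MkCinf (Fs f) + MkCinf (Fs g).
  apply: CinfP => q; rewrite Cinf_addE Cinf_scaleE /= /F vf_linear Cinf_addE Cinf_scaleE.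
  by rewrite mulrDl mulrA.
have leib (f g : Cinf P) : MkCinf (Fs (f * g)) = f * MkCinf (Fs g) + MkCinf (Fs f) * g.
  apply: CinfP => q; rewrite Cinf_addE !Cinf_mulE /= /F vf_leibniz Cinf_addE !Cinf_mulE.
  by rewrite mulrDl -mulrA; congr (_ + _); exact: mulrAC.
exists (VField lin leib) => Y; apply: CinfP => p; apply: (mulfI (cp p)).
rewrite -!Cinf_mulE -mZ -metricZl; congr (m _ Y p).
by apply: vfP => f; apply: CinfP => q; exact: FE.
Qed.

Lemma sharpE alpha : is_form 1 alpha -> forall Y, m (sharp m alpha) Y = alpha [:: Y].
Proof.
move=> a1; have [Z ZP] := sharp_exists a1.
exact: (@xgetPex _ 0 [set X | forall Y, m X Y = alpha [:: Y]] (ex_intro _ Z ZP)).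
Qed.

Lemma sharp_unique alpha X : is_form 1 alpha ->
  (forall Y, m X Y = alpha [:: Y]) -> sharp m alpha = X.
Proof. by move=> a1 XE; apply: metric_nondegenerate => Y; rewrite sharpE // XE. Qed.

End Sharp.

(** * Calculus of differential forms *)

Section FormCalculus.
Variables (R : realType) (d : nat) (P : manifold R d).
Implicit Types (X Y Z : vfield P) (f g : Cinf P) (s t : seq (vfield P)).
Implicit Types (w sigma rho lambda : pform P).

Lemma pformP w w' : (forall s, w s = w' s) -> w = w'.
Proof. exact: funext. Qed.

Lemma pform_consE w X s : w (X :: s) = interior X w s.
Proof. by []. Qed.

Lemma pform_nilP w w' : w [::] = w' [::] ->
  (forall X, interior X w = interior X w') -> w = w'.
Proof.
move=> w0 wX; apply: pformP => -[//|X s].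
exact: (congr1 (fun w : pform P => w s) (wX X)).
Qed.

Lemma pform_addE w w' s : (w + w') s = w s + w' s. Proof. by []. Qed.
Lemma pform_oppE w s : (- w) s = - w s. Proof. by []. Qed.
Lemma pform_scaleE (a : R) w s : (a *: w) s = a *: w s. Proof. by []. Qed.
Lemma pform_zeroE s : (0 : pform P) s = 0. Proof. by []. Qed.
Lemma fscaleE f w s : fscale f w s = f * w s. Proof. by []. Qed.
Lemma pform_sumE (I : Type) (r : seq I) (Q : pred I) (F : I -> pform P) s :
  (\sum_(i <- r | Q i) F i) s = \sum_(i <- r | Q i) F i s.
Proof. by elim/big_ind2: _ => // w f w' f' <- <-. Qed.

Lemma Cinf_scale_mul1 (a : R) f : a *: f = (a *: (1 : Cinf P)) * f.
Proof. by rewrite -Cinf_scalerAl mul1r. Qed.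

Lemma pform_scale_fscale (a : R) w : a *: w = fscale (a *: (1 : Cinf P)) w.
Proof. by apply: pformP => s; exact: Cinf_scale_mul1. Qed.

Lemma fscaleD f w w' : fscale f (w + w') = fscale f w + fscale f w'.
Proof. by apply: pformP => s; exact: mulrDr. Qed.
Lemma fscaleDl f g w : fscale (f + g) w = fscale f w + fscale g w.
Proof. by apply: pformP => s; exact: mulrDl. Qed.
Lemma fscaleA f g w : fscale f (fscale g w) = fscale (f * g) w.
Proof. by apply: pformP => s; exact: mulrA. Qed.
Lemma fscale0 f : fscale f (0 : pform P) = 0.
Proof. by apply: pformP => s; exact: mulr0. Qed.
Lemma fscale0l w : fscale 0 w = 0.
Proof. by apply: pformP => s; exact: mul0r. Qed.
Lemma fscale1 w : fscale 1 w = w.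
Proof. by apply: pformP => s; exact: mul1r. Qed.
Lemma fscale_sum (I : Type) (r : seq I) (Q : pred I) (F : I -> pform P) f :
  fscale f (\sum_(i <- r | Q i) F i) = \sum_(i <- r | Q i) fscale f (F i).
Proof. exact: (big_morph (fscale f) (fscaleD f) (fscale0 f)). Qed.
Lemma fscale_suml (I : Type) (r : seq I) (Q : pred I) (F : I -> Cinf P) w :
  fscale (\sum_(i <- r | Q i) F i) w = \sum_(i <- r | Q i) fscale (F i) w.
Proof. exact: (big_morph (fun f => fscale f w) (fun f g => fscaleDl f g w) (fscale0l w)). Qed.

Lemma is_form_zero k : is_form k (0 : pform P).
Proof. by split=> // *; rewrite !pform_zeroE mulr0 addr0. Qed.

Lemma is_form_fscaleD k f w w' : is_form k w -> is_form k w' -> is_form k (fscale f w + w').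
Proof.
move=> [w0 wl wa] [w0' wl' wa']; split.
- by move=> s sk; rewrite pform_addE fscaleE w0 // w0' // mulr0 addr0.
- by move=> s t g X Y; rewrite !pform_addE !fscaleE wl wl'; ring.
- by move=> s t u X; rewrite pform_addE fscaleE wa wa' mulr0 addr0.
Qed.

Lemma is_form_fscale k f w : is_form k w -> is_form k (fscale f w).
Proof. by move=> wk; rewrite -[fscale f w]addr0; apply: is_form_fscaleD => //;
  exact: is_form_zero. Qed.

Lemma is_formD k w w' : is_form k w -> is_form k w' -> is_form k (w + w').
Proof. by move=> wk; rewrite -[w]fscale1; exact: is_form_fscaleD. Qed.

Lemma is_formZ k (a : R) w : is_form k w -> is_form k (a *: w).
Proof. by rewrite pform_scale_fscale; exact: is_form_fscale. Qed.

Lemma is_formN k w : is_form k w -> is_form k (- w).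
Proof. by rewrite -scaleN1r; exact: is_formZ. Qed.

Lemma is_formB k w w' : is_form k w -> is_form k w' -> is_form k (w - w').
Proof. by move=> wk wk'; apply: is_formD => //; exact: is_formN. Qed.

Lemma is_form_sum (I : Type) (r : seq I) (Q : pred I) (F : I -> pform P) k :
  (forall i, Q i -> is_form k (F i)) -> is_form k (\sum_(i <- r | Q i) F i).
Proof.
move=> Fk; elim/big_rec: _ => [|i w Qi wk]; first exact: is_form_zero.
by apply: is_formD => //; exact: Fk.
Qed.

Lemma interiorD X w w' : interior X (w + w') = interior X w + interior X w'.
Proof. by []. Qed.
Lemma interiorN X w : interior X (- w) = - interior X w.
Proof. by []. Qed.
Lemma interiorZ X (a : R) w : interior X (a *: w) = a *: interior X w.
Proof. by []. Qed.
Lemma interior_fscale X f w : interior X (fscale f w) = fscale f (interior X w).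
Proof. by []. Qed.
Lemma is_form_interior k X w : is_form k w -> is_form k.-1 (interior X w).
Proof.
case: k => [|k] [w0 wl wa].
  have -> : interior X w = 0 by apply: pformP => s; exact: w0.
  exact: is_form_zero.
split=> [s sk|s t f Y Z|s t u Y].
- exact: w0.
- exact: (wl (X :: s)).
- exact: (wa (X :: s)).
Qed.

Lemma interior_form0 X w : is_form 0 w -> interior X w = 0.
Proof. by case=> w0 _ _; apply: pformP => s; exact: w0. Qed.

Lemma interior_linear k f X Y w : is_form k w ->
  interior (f *: X + Y) w = fscale f (interior X w) + interior Y w.
Proof. by case=> _ wl _; apply: pformP => s; exact: (wl [::]). Qed.

Lemma interior_add k X Y w : is_form k w ->
  interior (X + Y) w = interior X w + interior Y w.
Proof. by move=> wk; rewrite -[X in LHS]scale1r (interior_linear _ _ _ wk) fscale1. Qed.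

Lemma interior_vzero k w : is_form k w -> interior 0 w = 0.
Proof.
by move=> wk; apply: (addIr (interior 0 w)); rewrite -(interior_add _ _ wk) addr0 add0r.
Qed.

Lemma interior_scale k f X w : is_form k w ->
  interior (f *: X) w = fscale f (interior X w).
Proof.
by move=> wk; rewrite -[f *: X]addr0 (interior_linear _ _ _ wk) (interior_vzero wk) addr0.
Qed.

Lemma interior_opp k X w : is_form k w -> interior (- X) w = - interior X w.
Proof.
move=> wk; apply/eqP; rewrite -addr_eq0 -(interior_add _ _ wk) addNr.
by rewrite (interior_vzero wk).
Qed.

Lemma interior_twice k X w : is_form k w -> interior X (interior X w) = 0.
Proof. by case=> _ _ wa; apply: pformP => s; exact: (wa [::] [::]). Qed.

Lemma interior_anticomm k X Y w : is_form k w ->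
  interior X (interior Y w) = - interior Y (interior X w).
Proof.
move=> wk; apply/eqP; rewrite -addr_eq0; apply/eqP.
have := interior_twice (X + Y) wk; have wk' Z := is_form_interior Z wk.
rewrite (interior_add _ _ wk) interiorD !(interior_add _ _ (wk' _)).
by rewrite !(interior_twice _ wk) add0r addr0 addrC.
Qed.

(** Alternation is asked only for the first two arguments. Polarized at [X + Y] it gives skewness in
    them, and exchanging the first argument with its neighbour reduces any other repetition to the
    alternation of a contraction. *)
Lemma is_formSP k w : w [::] = 0 -> (forall X, is_form k (interior X w)) ->
  (forall f X Y, interior (f *: X + Y) w = fscale f (interior X w) + interior Y w) ->
  (forall X, interior X (interior X w) = 0) -> is_form k.+1 w.
Proof.
move=> w0 wk wl wa.
have at_ w1 w2 s : w1 = w2 -> w1 s = w2 s :> Cinf P by move=> ->.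
have wD X Y : interior (X + Y) w = interior X w + interior Y w.
  by rewrite -[X in LHS]scale1r wl fscale1.
have wC X Y s : w (X :: Y :: s) = - w (Y :: X :: s).
  apply/eqP; rewrite -addr_eq0; apply/eqP.
  have := at_ _ _ s (wa (X + Y)); rewrite wD interiorD.
  rewrite !(interior_add _ _ (wk _)) !wa add0r addr0.
  by rewrite pform_addE addrC.
split.
- by move=> [//|X s] sk; case: (wk X) => h _ _; exact: h.
- move=> [|X s] t f Y Z; first exact: (at_ _ _ t (wl f Y Z)).
  by case: (wk X) => _ h _; exact: h.
- move=> [|X s] t u Y; last by case: (wk X) => _ _ h; exact: h.
  case: t => [|Z t]; first exact: (at_ _ _ u (wa Y)).
  rewrite /= wC; have [_ _ h] := wk Z.
  by rewrite -[w _]/(interior Z w ([::] ++ Y :: t ++ Y :: u)) h oppr0.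
Qed.

Lemma is_form0P w : (forall X, interior X w = 0) -> is_form 0 w.
Proof.
move=> w0; have wE X s : w (X :: s) = 0.
  exact: (congr1 (fun w : pform P => w s) (w0 X)).
split=> [[//|X s] _|s t f X Y|s t u X]; first exact: wE.
  by case: s => [|Z s]; rewrite /= !wE mulr0 addr0.
by case: s => [|Z s]; rewrite /= wE.
Qed.

Lemma form0_form f : is_form 0 (form0 f : pform P).
Proof. by apply: is_form0P. Qed.

Lemma form_swap k w s t X Y : is_form k w ->
  w (s ++ X :: Y :: t) = - w (s ++ Y :: X :: t).
Proof.
elim: s k w => [|Z s IH] k w wk.
  by have := congr1 (fun w : pform P => w t) (interior_anticomm Y X wk).
exact: (IH _ (interior Z w) (is_form_interior Z wk)).
Qed.

Lemma form_move k w s t X : is_form k w ->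
  w (s ++ X :: t) = (-1 : R) ^+ size s *: w (X :: s ++ t).
Proof.
elim: s k w => [|Z s IH] k w wk; first by rewrite expr0 scale1r.
have -> : w ((Z :: s) ++ X :: t) = interior Z w (s ++ X :: t) by [].
rewrite (IH _ _ (is_form_interior Z wk)) /interior /=.
by rewrite (form_swap [::] _ _ _ wk) /= exprS mulN1r scaleNr scalerN.
Qed.

Lemma interior_twist X w : interior X (twist w) = - twist (interior X w).
Proof.
by apply: pformP => s; rewrite /interior /twist pform_oppE /= exprS mulN1r scaleNr.
Qed.

Lemma twistK w : twist (twist w) = w.
Proof.
by apply: pformP => s; rewrite /twist scalerA -exprD addnn -signr_odd odd_double scale1r.
Qed.

Lemma twist_form k w : is_form k w -> twist w = (-1 : R) ^+ k *: w.
Proof.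
case=> w0 _ _; apply: pformP => s; rewrite /twist pform_scaleE.
by have [->//|/w0 ->] := eqVneq (size s) k; rewrite !scaler0.
Qed.

Lemma is_form_twist k w : is_form k w -> is_form k (twist w).
Proof. by move=> wk; rewrite (twist_form wk); exact: is_formZ. Qed.

Lemma twistD w w' : twist (w + w') = twist w + twist w'.
Proof. by apply: pformP => s; exact: scalerDr. Qed.

Lemma twist_fscale f w : twist (fscale f w) = fscale f (twist w).
Proof. by apply: pformP => s; exact: Cinf_scalerAr. Qed.

(** The graded Leibniz rule for contraction, which is the recursion in [shuffle]. The sign depending
    on the degree of [sigma] is inside [twist], so the rule needs no degree. *)
Lemma interior_wedge X sigma rho : interior X (wedge sigma rho) =
  wedge (interior X sigma) rho + wedge (twist sigma) (interior X rho).
Proof. by []. Qed.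

Lemma wedge_linearl f sigma sigma' rho :
  wedge (fscale f sigma + sigma') rho = fscale f (wedge sigma rho) + wedge sigma' rho.
Proof.
apply: pformP => s; elim: s sigma sigma' rho => [|X s IH] sigma sigma' rho.
  by rewrite /wedge /= !pform_addE !fscaleE /=; ring.
rewrite !pform_consE interiorD interior_fscale !interior_wedge interiorD.
rewrite interior_fscale twistD twist_fscale.
by rewrite !(pform_addE, fscaleE, IH); ring.
Qed.

Lemma wedge_linearr f sigma rho rho' :
  wedge sigma (fscale f rho + rho') = fscale f (wedge sigma rho) + wedge sigma rho'.
Proof.
apply: pformP => s; elim: s sigma rho rho' => [|X s IH] sigma rho rho'.
  by rewrite /wedge /= !pform_addE !fscaleE /=; ring.
rewrite !pform_consE interiorD interior_fscale !interior_wedge interiorD interior_fscale.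
by rewrite !(pform_addE, fscaleE, IH); ring.
Qed.

End FormCalculus.

(** * The algebra of the wedge product *)

Section Wedge.
Variables (R : realType) (d : nat) (P : manifold R d).
Implicit Types (X Y Z : vfield P) (f g : Cinf P) (s t : seq (vfield P)).
Implicit Types (w sigma rho lambda : pform P).

Lemma wedgeDl sigma sigma' rho : wedge (sigma + sigma') rho = wedge sigma rho + wedge sigma' rho.
Proof. by rewrite -[sigma in LHS]fscale1 wedge_linearl fscale1. Qed.

Lemma wedgeDr sigma rho rho' : wedge sigma (rho + rho') = wedge sigma rho + wedge sigma rho'.
Proof. by rewrite -[rho in LHS]fscale1 wedge_linearr fscale1. Qed.

Lemma wedge0l rho : wedge 0 rho = 0.
Proof. by apply: (addIr (wedge 0 rho)); rewrite -wedgeDl !add0r. Qed.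

Lemma wedge0r rho : wedge rho 0 = 0.
Proof. by apply: (addIr (wedge rho 0)); rewrite -wedgeDr !add0r. Qed.

Lemma wedge_fscalel f sigma rho : wedge (fscale f sigma) rho = fscale f (wedge sigma rho).
Proof. by rewrite -[fscale f sigma in LHS]addr0 wedge_linearl wedge0l addr0. Qed.

Lemma wedge_fscaler f sigma rho : wedge sigma (fscale f rho) = fscale f (wedge sigma rho).
Proof. by rewrite -[fscale f rho in LHS]addr0 wedge_linearr wedge0r addr0. Qed.

Lemma wedgeZl (a : R) sigma rho : wedge (a *: sigma) rho = a *: wedge sigma rho.
Proof. by rewrite !pform_scale_fscale wedge_fscalel. Qed.

Lemma wedgeZr (a : R) sigma rho : wedge sigma (a *: rho) = a *: wedge sigma rho.
Proof. by rewrite !pform_scale_fscale wedge_fscaler. Qed.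

Lemma wedgeNl sigma rho : wedge (- sigma) rho = - wedge sigma rho.
Proof. by rewrite -scaleN1r wedgeZl scaleN1r. Qed.

Lemma wedgeNr sigma rho : wedge sigma (- rho) = - wedge sigma rho.
Proof. by rewrite -scaleN1r wedgeZr scaleN1r. Qed.

Lemma wedge_suml (I : Type) (r : seq I) (Q : pred I) (F : I -> pform P) rho :
  wedge (\sum_(i <- r | Q i) F i) rho = \sum_(i <- r | Q i) wedge (F i) rho.
Proof. exact: (big_morph (fun w => wedge w rho) (fun w w' => wedgeDl w w' rho) (wedge0l rho)). Qed.

Lemma wedge_sumr (I : Type) (r : seq I) (Q : pred I) (F : I -> pform P) rho :
  wedge rho (\sum_(i <- r | Q i) F i) = \sum_(i <- r | Q i) wedge rho (F i).
Proof. exact: (big_morph (wedge rho) (wedgeDr rho) (wedge0r rho)). Qed.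

Lemma interior_form0E X f : interior X (form0 f) = 0.
Proof. exact: interior_form0 (form0_form f). Qed.

Lemma wedge_form0 f w : wedge (form0 f) w = fscale f w.
Proof.
apply: pformP => s; elim: s w => [//|X s IH] w.
rewrite pform_consE interior_wedge interior_form0E wedge0l add0r.
by rewrite (twist_form (form0_form f)) expr0 scale1r IH.
Qed.

Lemma wedge_nil sigma rho : wedge sigma rho [::] = sigma [::] * rho [::].
Proof. by []. Qed.

Lemma form_nil k w : is_form k.+1 w -> w [::] = 0.
Proof. by case=> h _ _; exact: h. Qed.

Lemma is_form_wedge k l sigma rho :
  is_form k sigma -> is_form l rho -> is_form (k + l) (wedge sigma rho).
Proof.
move: {2}(k + l)%N (erefl (k + l)%N) => n; elim: n k l sigma rho => [|n IH] k l sigma rho kl sk rl.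
  have [k0 l0] : k = 0 /\ l = 0 by move/eqP: kl; rewrite addn_eq0 => /andP[/eqP-> /eqP->].
  subst k l; apply: is_form0P => X.
  by rewrite interior_wedge !interior_form0 // wedge0l wedge0r addr0.
rewrite kl; apply: is_formSP.
- rewrite wedge_nil; case: k l kl sk rl => [|k] [|l] // kl sk rl.
  + by rewrite (form_nil rl) mulr0.
  + by rewrite (form_nil sk) mul0r.
  + by rewrite (form_nil rl) mulr0.
- move=> X; rewrite interior_wedge; apply: is_formD.
    case: k kl sk => [|k] kl sk; first by rewrite interior_form0 // wedge0l; exact: is_form_zero.
    have kn : (k + l)%N = n by case: kl.
    by rewrite -kn; apply: IH => //; exact: is_form_interior sk.
  case: l kl rl => [|l] kl rl; first by rewrite (interior_form0 _ rl) wedge0r; exact: is_form_zero.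
  have kn : (k + l)%N = n by move: kl; rewrite addnS; case.
  by rewrite -kn; apply: IH => //; [exact: is_form_twist|exact: is_form_interior rl].
- move=> f X Y; rewrite !interior_wedge (interior_linear _ _ _ sk) (interior_linear _ _ _ rl).
  by rewrite wedge_linearl wedge_linearr fscaleD addrACA.
move=> X; rewrite !(interior_wedge, interiorD) (interior_twice _ sk) (interior_twice _ rl).
by rewrite wedge0l wedge0r interior_twist wedgeNl add0r addr0 addrN.
Qed.

Lemma wedgeC k l sigma rho : is_form k sigma -> is_form l rho ->
  wedge sigma rho = (-1 : R) ^+ (k * l) *: wedge rho sigma.
Proof.
move=> sk rl; apply: pformP => s; elim: s k l sigma rho sk rl => [|X s IH] k l sigma rho sk rl.
  rewrite pform_scaleE !wedge_nil; case: k sk => [|k] sk.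
    by rewrite mul0n expr0 scale1r mulrC.
  by rewrite (form_nil sk) mul0r mulr0 scaler0.
rewrite !pform_consE interiorZ !interior_wedge pform_addE pform_scaleE pform_addE.
rewrite (twist_form sk) (twist_form rl) !wedgeZl !pform_scaleE scalerDr scalerA addrC.
congr (_ + _).
- case: l rl => [|l] rl; first by rewrite !(interior_form0 _ rl) wedge0l wedge0r !scaler0.
  rewrite (IH _ _ _ _ sk (is_form_interior X rl)) pform_scaleE scalerA -exprD.
  by rewrite mulnS.
- case: k sk => [|k] sk; first by rewrite !(interior_form0 _ sk) wedge0l wedge0r !scaler0.
  rewrite (IH _ _ _ _ (is_form_interior X sk) rl) pform_scaleE /=.
  have sq : (-1 : R) ^+ l * (-1) ^+ l = 1 by rewrite -exprD addnn -signr_odd odd_double.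
  by rewrite mulSn exprD mulrAC sq mul1r.
Qed.

Lemma twist_wedge sigma rho : twist (wedge sigma rho) = wedge (twist sigma) (twist rho).
Proof.
apply: pformP => s; elim: s sigma rho => [|X s IH] sigma rho.
  by rewrite /twist /wedge /= expr0 !scale1r.
rewrite !pform_consE interior_twist !interior_wedge twistD !interior_twist.
by rewrite !(pform_addE, pform_oppE, wedgeNl, wedgeNr, IH) opprD.
Qed.

Lemma wedgeA sigma rho lambda :
  wedge sigma (wedge rho lambda) = wedge (wedge sigma rho) lambda.
Proof.
apply: pformP => s; elim: s sigma rho lambda => [|X s IH] sigma rho lambda.
  exact: mulrA.
rewrite !pform_consE !interior_wedge wedgeDl wedgeDr twist_wedge.
by rewrite !(pform_addE, IH) addrA.
Qed.

End Wedge.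

(** * The Lie derivative *)

Section LieDerivative.
Variables (R : realType) (d : nat) (P : manifold R d).
Implicit Types (X Y Z : vfield P) (f g : Cinf P) (s t : seq (vfield P)).
Implicit Types (w sigma rho lambda : pform P).

Lemma liebE X Y f : lieb X Y f = X (Y f) - Y (X f). Proof. by []. Qed.

Lemma liebC X Y : lieb X Y = - lieb Y X.
Proof. by apply: vfP => f; exact: esym (opprB _ _). Qed.

Lemma lieb_scaler f X Y : lieb X (f *: Y) = f *: lieb X Y + X f *: Y.
Proof.
apply: vfP => g; change (X (f * Y g) - f * Y (X g) = f * (X (Y g) - Y (X g)) + X f * Y g).
by rewrite vf_leibniz; ring.
Qed.

Lemma liebDr X Y Z : lieb X (Y + Z) = lieb X Y + lieb X Z.
Proof.
apply: vfP => g.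
change (X (Y g + Z g) - (Y (X g) + Z (X g)) = (X (Y g) - Y (X g)) + (X (Z g) - Z (X g))).
by rewrite vfD; ring.
Qed.

Lemma lieb_scalel f X Y : lieb (f *: X) Y = f *: lieb X Y - Y f *: X.
Proof. by rewrite liebC lieb_scaler (liebC Y X) scalerN opprD opprK. Qed.

Lemma liebDl X Y Z : lieb (X + Y) Z = lieb X Z + lieb Y Z.
Proof. by rewrite liebC liebDr opprD -!liebC. Qed.

Lemma lieb0r X : lieb X 0 = 0.
Proof. by apply: (addIr (lieb X 0)); rewrite -liebDr !add0r. Qed.

Lemma lieb_jacobi X Y Z : lieb X (lieb Y Z) = lieb (lieb X Y) Z + lieb Y (lieb X Z).
Proof.
apply: vfP => g.
change (lieb X (lieb Y Z) g = lieb (lieb X Y) Z g + lieb Y (lieb X Z) g).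
by rewrite !liebE !vfD !vfN; ring.
Qed.

Lemma lie_nil X w : lie X w [::] = X (w [::]).
Proof. by rewrite /lie big_ord0 subr0. Qed.

(** The commutator of contraction and Lie derivative. Together with the value on the empty list it
    determines [lie], and the identities for [lie] follow from it by induction on the arguments. *)
Lemma interior_lie X Y w :
  interior Y (lie X w) = lie X (interior Y w) - interior (lieb X Y) w.
Proof.
apply: pformP => s; rewrite pform_addE pform_oppE /interior /lie /= big_ord_recl /=.
by rewrite opprD addrA addrAC.
Qed.

Lemma lieD X w w' : lie X (w + w') = lie X w + lie X w'.
Proof.
apply: pformP => s; rewrite /lie !pform_addE vfD big_split /=; ring.
Qed.

Lemma lie_fscale X f w : lie X (fscale f w) = fscale f (lie X w) + fscale (X f) w.
Proof.
apply: pformP => s; rewrite /lie pform_addE !fscaleE vf_leibniz mulrBr mulr_sumr; ring.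
Qed.

Lemma lie0 X : lie X (0 : pform P) = 0.
Proof. by apply: (addIr (lie X 0)); rewrite -lieD !add0r. Qed.

Lemma lieZ X (a : R) w : lie X (a *: w) = a *: lie X w.
Proof.
rewrite !pform_scale_fscale lie_fscale vfZ.
have -> : X 1 = 0.
  have := vf_leibniz X 1 1; rewrite !mulr1 mul1r => /eqP.
  by rewrite -subr_eq0 opprD addNKr oppr_eq0 => /eqP.
by rewrite scaler0 fscale0l addr0.
Qed.

Lemma lieN X w : lie X (- w) = - lie X w.
Proof. by rewrite -scaleN1r lieZ scaleN1r. Qed.

Lemma lie_sum (I : Type) (r : seq I) (Q : pred I) (F : I -> pform P) X :
  lie X (\sum_(i <- r | Q i) F i) = \sum_(i <- r | Q i) lie X (F i).
Proof. exact: (big_morph (lie X) (lieD X) (lie0 X)). Qed.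

Lemma is_form_lie k X w : is_form k w -> is_form k (lie X w).
Proof.
elim: k w => [|k IH] w wk.
  apply: is_form0P => Y; rewrite interior_lie !(interior_form0 _ wk) lie0 subr0 //.
apply: is_formSP => [|Y|f Y Z|Y].
- by rewrite lie_nil (form_nil wk) vf0.
- rewrite interior_lie; apply: is_formB; last exact: is_form_interior wk.
  by apply: IH; exact: is_form_interior wk.
- rewrite !interior_lie (interior_linear _ _ _ wk) lieD lie_fscale liebDr lieb_scaler.
  rewrite (interior_add _ _ wk) (interior_linear _ _ _ wk) (interior_scale _ _ wk).
  by apply: pformP => s; rewrite !(pform_addE, pform_oppE, fscaleE); ring.
- rewrite interior_lie interiorD interiorN interior_lie (interior_twice _ wk) lie0 sub0r.
  by rewrite (interior_anticomm _ _ wk) opprK subrr.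
Qed.

Lemma lie_twist X w : lie X (twist w) = twist (lie X w).
Proof.
apply: pformP => s; rewrite /lie /twist vfZ scalerBr scaler_sumr; congr (_ - _).
by apply: eq_bigr => i _; rewrite size_set_nth (maxn_idPr _).
Qed.

Lemma lie_wedge X sigma rho :
  lie X (wedge sigma rho) = wedge (lie X sigma) rho + wedge sigma (lie X rho).
Proof.
apply: pformP => s; elim: s sigma rho => [|Y s IH] sigma rho.
  rewrite lie_nil pform_addE !wedge_nil !lie_nil vf_leibniz; ring.
rewrite [RHS]pform_addE !pform_consE !interior_lie !interior_wedge lieD !interior_lie.
rewrite !(pform_addE, pform_oppE, IH, wedgeDl, wedgeDr, wedgeNl, wedgeNr, lie_twist). ring.
Qed.

Lemma lie_addl k X Y w : is_form k w -> lie (X + Y) w = lie X w + lie Y w.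
Proof.
move=> wk; apply: pformP => s; elim: s k w wk => [|Z s IH] k w wk.
  by rewrite pform_addE !lie_nil.
rewrite !pform_consE interiorD !interior_lie liebDl (interior_add _ _ wk).
rewrite !(pform_addE, pform_oppE) (IH _ _ (is_form_interior Z wk)) pform_addE; ring.
Qed.

Lemma lie_lieb k X Y w : is_form k w ->
  lie (lieb X Y) w = lie X (lie Y w) - lie Y (lie X w).
Proof.
move=> wk; apply: pformP => s; elim: s k w wk => [|Z s IH] k w wk.
  by rewrite pform_addE pform_oppE !lie_nil.
have twice A B : interior Z (lie A (lie B w)) = lie A (lie B (interior Z w))
    - lie A (interior (lieb B Z) w) - lie B (interior (lieb A Z) w)
    + interior (lieb B (lieb A Z)) w.
  rewrite !interior_lie (lieD A (lie B (interior Z w))) (lieN A) (opprB (lie B _)).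
  by rewrite [interior _ _ - lie B _]addrC addrA.
rewrite !pform_consE interior_lie interiorD interiorN !twice.
have := congr1 (fun V => interior V w s) (lieb_jacobi X Y Z).
rewrite /= (interior_add _ _ wk) !(pform_addE, pform_oppE) => ->.
rewrite (IH _ _ (is_form_interior Z wk)) !(pform_addE, pform_oppE); ring.
Qed.

End LieDerivative.

(** * The exterior derivative *)

Section ExteriorDerivative.
Variables (R : realType) (d : nat) (P : manifold R d).
Implicit Types (X Y Z : vfield P) (f g : Cinf P) (s t : seq (vfield P)).
Implicit Types (w sigma rho lambda : pform P).

Lemma ext_d_nil w : ext_d w [::] = 0.
Proof. by rewrite /ext_d /= !big_ord0 addr0. Qed.

Lemma set_nth_take_drop s (i : nat) X : (i < size s)%N ->
  set_nth 0 s i X = take i s ++ X :: drop i.+1 s.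
Proof. by move=> si; rewrite set_nthE si. Qed.

(* Cartan's formula; it turns the identities below into inductions on the list of
   arguments. *)
Lemma interior_d k X w : is_form k w ->
  interior X (ext_d w) = lie X w - ext_d (interior X w).
Proof.
move=> wk; apply: pformP => s; rewrite pform_addE pform_oppE /interior /ext_d /lie /=.
rewrite big_ord_recl /= expr0 scale1r -/(del 0 (X :: s)).
have -> : del 0 (X :: s) = s by rewrite /del /= drop0.
rewrite -!addrA; congr (_ + _).
(* The terms of index 0, where [X] differentiates or is bracketed, make up [lie X w]. The others
   form [- ext_d (interior X w)]: in the single sum the sign comes from the shift of the index, in
   the double sum, where two shifts cancel, from moving [X] in front of the bracket. *)
have sum1 : \sum_(i < size s) (-1 : R) ^+ (bump 0 i) *:
      nth 0 (X :: s) (bump 0 i) (w (del (bump 0 i) (X :: s)))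
    = - \sum_(i < size s) (-1 : R) ^+ i *: nth 0 s i (w (X :: del i s)).
  rewrite -sumrN; apply: eq_bigr => i _.
  by rewrite /bump /= add1n exprS mulN1r scaleNr.
rewrite sum1 big_ord_recl /=.
have sum2 : \sum_(j < (size s).+1 | (0 < j)%N) (-1 : R) ^+ j *:
      w (lieb X (nth 0 (X :: s) j) :: del 0 (del j (X :: s)))
    = - \sum_(i < size s) w (set_nth 0 s i (lieb X (nth 0 s i))).
  rewrite big_mkcond big_ord_recl /= add0r -sumrN; apply: eq_bigr => i _.
  rewrite /bump /= add1n exprS mulN1r scaleNr; congr (- _).
  rewrite set_nth_take_drop // (form_move _ _ _ wk) size_take ltn_ord.
  by rewrite /del /= drop0.
have sum3 : \sum_(i < size s) \sum_(j < (size s).+1 | (bump 0 i < j)%N)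
      (-1 : R) ^+ (bump 0 i + j) *: w (lieb (nth 0 (X :: s) (bump 0 i)) (nth 0 (X :: s) j)
         :: del (bump 0 i) (del j (X :: s)))
    = - \sum_(i < size s) \sum_(j < size s | (i < j)%N)
      (-1 : R) ^+ (i + j) *: w (X :: lieb (nth 0 s i) (nth 0 s j) :: del i (del j s)).
  rewrite -sumrN; apply: eq_bigr => i _.
  rewrite big_mkcond big_ord_recl /= add0r [in RHS]big_mkcond -sumrN.
  apply: eq_bigr => j _; rewrite /bump /= !add1n ltnS; case: ifP => _; last by rewrite oppr0.
  rewrite addnS addSn exprS exprS mulN1r mulN1r opprK.
  by rewrite (form_swap [::] _ _ _ wk) scalerN.
rewrite sum2 sum3; ring.
Qed.

Lemma ext_dD w w' : ext_d (w + w') = ext_d w + ext_d w'.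
Proof.
apply: pformP => s; rewrite [RHS]pform_addE /ext_d [RHS]addrACA.
congr (_ + _); rewrite -big_split /=.
  by apply: eq_bigr => i _; rewrite pform_addE vfD scalerDr.
by apply: eq_bigr => i _; rewrite -big_split; apply: eq_bigr => j _; rewrite pform_addE scalerDr.
Qed.

Lemma ext_d0 : ext_d (0 : pform P) = 0.
Proof. by apply: (addIr (ext_d (0 : pform P))); rewrite -ext_dD !add0r. Qed.

Lemma ext_dN w : ext_d (- w) = - ext_d w.
Proof. by apply: (addIr (ext_d w)); rewrite -ext_dD !addNr ext_d0. Qed.

Lemma ext_d_sum (I : Type) (r : seq I) (Q : pred I) (F : I -> pform P) :
  ext_d (\sum_(i <- r | Q i) F i) = \sum_(i <- r | Q i) ext_d (F i).
Proof. exact: (big_morph (@ext_d R d P) ext_dD ext_d0). Qed.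

Lemma interior_df X f : interior X (df f) = form0 (X f).
Proof.
rewrite /df (interior_d _ (form0_form f)) interior_form0E ext_d0 subr0.
apply: pform_nilP; first by rewrite lie_nil.
by move=> Y; rewrite interior_lie !interior_form0E lie0 subr0.
Qed.

Lemma df_nil f : df f [::] = 0 :> Cinf P. Proof. exact: ext_d_nil. Qed.

Lemma is_form_df f : is_form 1 (df f : pform P).
Proof.
apply: is_formSP => [|X|g X Y|X]; rewrite ?df_nil // ?interior_df ?interior_form0E //.
  exact: form0_form.
apply: pform_nilP => [|Z]; last first.
  by rewrite interiorD interior_fscale !interior_form0E fscale0 addr0.
by rewrite pform_addE fscaleE.
Qed.

Lemma dfE f X : df f [:: X] = X f.
Proof. exact: ext_d_form0E. Qed.

Lemma lie_scale k f X w : is_form k w ->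
  lie (f *: X) w = fscale f (lie X w) + wedge (df f) (interior X w).
Proof.
move=> wk; apply: pformP => s; elim: s k w wk => [|Z s IH] k w wk.
  by rewrite pform_addE fscaleE !lie_nil wedge_nil df_nil mul0r addr0.
rewrite pform_consE interior_lie [RHS]pform_addE fscaleE !pform_consE interior_lie.
rewrite interior_wedge interior_df wedge_form0 (twist_form (is_form_df f)) expr1 scaleN1r.
rewrite wedgeNl (interior_anticomm Z X wk) wedgeNr opprK.
have -> : interior (lieb (f *: X) Z) w =
    fscale f (interior (lieb X Z) w) - fscale (Z f) (interior X w).
  by rewrite lieb_scalel (interior_add _ _ wk) (interior_opp _ wk) !(interior_scale _ _ wk).
rewrite !(pform_addE, pform_oppE) (IH _ _ (is_form_interior Z wk)).
rewrite !(pform_addE, pform_oppE) !fscaleE.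
ring.
Qed.

Lemma ext_d_fscale k f w : is_form k w ->
  ext_d (fscale f w) = fscale f (ext_d w) + wedge (df f) w.
Proof.
move=> wk; apply: pformP => s; elim: s k w wk => [|X s IH] k w wk.
  by rewrite pform_addE fscaleE !ext_d_nil wedge_nil df_nil mul0r mulr0 addr0.
rewrite pform_consE (interior_d _ (is_form_fscale f wk)) [RHS]pform_addE fscaleE !pform_consE.
rewrite (interior_d _ wk) interior_wedge interior_df wedge_form0.
rewrite (twist_form (is_form_df f)) expr1 scaleN1r wedgeNl lie_fscale interior_fscale.
rewrite !(pform_addE, pform_oppE) (IH _ _ (is_form_interior X wk)).
rewrite !(pform_addE, pform_oppE) !fscaleE; ring.
Qed.

Lemma ext_dZ k (a : R) w : is_form k w -> ext_d (a *: w) = a *: ext_d w.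
Proof.
move=> wk; apply: pformP => s; rewrite pform_scaleE /ext_d scalerDr !scaler_sumr.
congr (_ + _); first by apply: eq_bigr => i _; rewrite pform_scaleE vfZ !scalerA mulrC.
apply: eq_bigr => i _; rewrite scaler_sumr; apply: eq_bigr => j _.
by rewrite pform_scaleE !scalerA mulrC.
Qed.

Lemma is_form_ext_d k w : is_form k w -> is_form k.+1 (ext_d w).
Proof.
elim: k w => [|k IH] w wk; apply: is_formSP; rewrite ?ext_d_nil //.
- move=> X; rewrite (interior_d _ wk) (interior_form0 _ wk) ext_d0 subr0.
  exact: is_form_lie.
- move=> f X Y; rewrite !(interior_d _ wk) !(interior_form0 _ wk) ext_d0 !subr0.
  by rewrite (lie_addl _ _ wk) (lie_scale _ _ wk) (interior_form0 _ wk) wedge0r addr0.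
- move=> X; rewrite (interior_d _ wk) (interior_form0 _ wk) ext_d0 subr0.
  by rewrite interior_lie !(interior_form0 _ wk) lie0 subr0.
- move=> X; rewrite (interior_d _ wk); apply: is_formB; first exact: is_form_lie.
  exact: IH (is_form_interior X wk).
- move=> f X Y; rewrite !(interior_d _ wk) (interior_linear _ _ _ wk).
  rewrite (lie_addl _ _ wk) (lie_scale _ _ wk) ext_dD.
  rewrite (ext_d_fscale _ (is_form_interior X wk)).
  by apply: pformP => s; rewrite !(pform_addE, pform_oppE, fscaleE); ring.
move=> X; rewrite (interior_d _ wk) interiorD interiorN.
rewrite (interior_d _ (is_form_interior X wk)) interior_lie (interior_twice _ wk) ext_d0 subr0.
have -> : lieb X X = 0 by apply: vfP => f; exact: subrr.
by rewrite (interior_vzero wk) subr0 subrr.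
Qed.

Lemma lie_ext_d k X w : is_form k w -> lie X (ext_d w) = ext_d (lie X w).
Proof.
move=> wk; apply: pformP => s; elim: s k w wk => [|Y s IH] k w wk.
  by rewrite lie_nil !ext_d_nil vf0.
have Ywk := is_form_interior Y wk.
rewrite !pform_consE interior_lie (interior_d _ (is_form_lie X wk)) !(interior_d _ wk).
rewrite interior_lie (lieD X (lie Y w)) (lieN X) (lie_lieb _ _ wk).
rewrite (ext_dD (lie X _)) ext_dN.
rewrite !(pform_addE, pform_oppE) (IH _ _ Ywk); ring.
Qed.

Lemma ext_d_wedge k l sigma rho : is_form k sigma -> is_form l rho ->
  ext_d (wedge sigma rho) = wedge (ext_d sigma) rho + wedge (twist sigma) (ext_d rho).
Proof.
move=> sk rl; apply: pformP => s; elim: s k l sigma rho sk rl => [|X s IH] k l sigma rho sk rl.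
  by rewrite pform_addE ext_d_nil !wedge_nil !ext_d_nil mul0r mulr0 addr0.
have Xsk := is_form_interior X sk; have Xrl := is_form_interior X rl.
have tw : twist (ext_d sigma) = - ext_d (twist sigma).
  rewrite (twist_form (is_form_ext_d sk)) (twist_form sk) (ext_dZ _ sk).
  by rewrite exprS mulN1r scaleNr.
rewrite pform_consE (interior_d _ (is_form_wedge sk rl)) lie_wedge interior_wedge.
rewrite [RHS]pform_addE !pform_consE !interior_wedge tw interior_twist twistK.
rewrite (interior_d _ sk) (interior_d _ rl) (ext_dD (wedge _ _)).
rewrite !(wedgeDl (lie _ _)) !(wedgeDr _ (lie _ _)) !wedgeNl !wedgeNr.
rewrite !(pform_addE, pform_oppE) (IH _ _ _ _ Xsk rl) (IH _ _ _ _ (is_form_twist sk) Xrl).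
rewrite !(pform_addE, pform_oppE) twistK; ring.
Qed.

End ExteriorDerivative.

(** * The classical Yang-Baxter equation *)

Section Contraction.
Variables (R : realType) (g : lie_algebra R) (r : bivector g).

Definition basis_vec (i : 'I_(\dim {: g})) : g := tnth (vbasis {: g}) i.
Definition dual_vec (i : 'I_(\dim {: g})) : dual g := linfun (coord (vbasis {: g}) i).
(* [r] is the tensor [\sum_i basis_vec i (x) r_vec i]. *)
Definition r_vec (i : 'I_(\dim {: g})) : g := bivector_map r (dual_vec i).

Local Notation e := basis_vec.
Local Notation c := dual_vec.
Local Notation v := r_vec.

Lemma basis_expansion (x : g) : x = \sum_i c i x *: e i.
Proof.
rewrite {1}(coord_basis (vbasisP {: g}) (memvf x)).
by apply: eq_bigr => i _; rewrite lfunE /e (tnth_nth 0).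
Qed.

Lemma dual_basis i j : c i (e j) = (i == j)%:R.
Proof.
rewrite lfunE /basis_vec (tnth_nth 0); apply: etrans (coord_free _ _ _) _.
  exact: basis_free (vbasisP _).
by rewrite eq_sym.
Qed.

Section Module.
Variable W : lmodType R.

(** A predicate on plain functions, so that expressions built from [Gamma x], with values in smooth
    functions or in forms, can be contracted as they stand. *)
Definition linear_map (B : g -> W) := forall (a : R) x y, B (a *: x + y) = a *: B x + B y.

Lemma linear_mapE (B : g -> W) : linear_map B -> forall x, B x = \sum_i c i x *: B (e i).
Proof.
move=> Bl x; have B0 : B 0 = 0.
  by apply: (addIr (B 0)); rewrite -[X in X + _]scale1r -Bl scale1r !add0r.
have BD y z : B (y + z) = B y + B z by rewrite -[y]scale1r Bl !scale1r.
have BZ (a : R) y : B (a *: y) = a *: B y by rewrite -[a *: y]addr0 Bl B0 addr0.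
rewrite {1}(basis_expansion x) (big_morph B BD B0).
by apply: eq_bigr => i _; exact: BZ.
Qed.

Definition bilinear_map (B : g -> g -> W) :=
  (forall y, linear_map (fun x => B x y)) /\ (forall x, linear_map (B x)).

Definition trilinear_map (F : g -> g -> g -> W) :=
  (forall z, bilinear_map (fun x y => F x y z)) /\ (forall x y, linear_map (F x y)).

Lemma bilinear_mapE (B : g -> g -> W) : bilinear_map B ->
  forall x y, B x y = \sum_i \sum_j (c i x * c j y) *: B (e i) (e j).
Proof.
move=> [Bl Br] x y; rewrite (linear_mapE (Bl y) x); apply: eq_bigr => i _.
by rewrite (linear_mapE (Br _) y) scaler_sumr; apply: eq_bigr => j _; rewrite scalerA.
Qed.

Lemma trilinear_mapE (F : g -> g -> g -> W) : trilinear_map F -> forall x y z,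
  F x y z = \sum_l \sum_m \sum_n (c l x * c m y * c n z) *: F (e l) (e m) (e n).
Proof.
move=> [Fb Fl] x y z; rewrite (bilinear_mapE (Fb z)).
apply: eq_bigr => l _; apply: eq_bigr => m _; rewrite (linear_mapE (Fl _ _) z) scaler_sumr.
by apply: eq_bigr => n _; rewrite scalerA.
Qed.

Lemma contraction_coord (B : g -> g -> W) : bilinear_map B ->
  \sum_k B (e k) (v k) = \sum_k \sum_l r (c k) (c l) *: B (e k) (e l).
Proof.
move=> [_ Br]; apply: eq_bigr => k _; rewrite (linear_mapE (Br _)).
by apply: eq_bigr => l _; rewrite bivector_mapE.
Qed.

(** The form in which the skewness of [r] is used: the skewness of the bivector field and of the
    bracket, the torsion identity and one term of the metacurvature come down to it. *)
Lemma contraction_skew (B : g -> g -> W) : bilinear_map B ->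
  \sum_k B (v k) (e k) = - \sum_k B (e k) (v k).
Proof.
move=> Bb; rewrite (contraction_coord Bb) exchange_big -sumrN; apply: eq_bigr => k _.
case: Bb => Bl _; rewrite (linear_mapE (Bl _)) -sumrN; apply: eq_bigr => l _.
by rewrite bivector_mapE bv_skew scaleNr.
Qed.

(** Both sides contract [B] with the tensor [r], expanded once in the given basis and once in
    [vbasis]. Independence of the basis is a consequence, since the right-hand side does not mention
    [u] or [a]. *)
Lemma expansion_contraction n (u : n.-tuple g) (a : 'M[R]_n) (B : g -> g -> W) :
  bivector_expansion r u a -> bilinear_map B ->
  \sum_(i < n) \sum_(j < n | (i < j)%N)
     a i j *: (B (tnth u i) (tnth u j) - B (tnth u j) (tnth u i))
  = \sum_k B (e k) (v k).
Proof.
move=> [_ ra] Bb; rewrite (contraction_coord Bb).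
transitivity (\sum_(i < n) \sum_(j < n | (i < j)%N) \sum_k \sum_l
    (a i j * bivector_wedge (tnth u i) (tnth u j) (c k) (c l)) *: B (e k) (e l)).
  apply: eq_bigr => i _; apply: eq_bigr => j _; rewrite !(bilinear_mapE Bb) -sumrB scaler_sumr.
  apply: eq_bigr => k _; rewrite -sumrB scaler_sumr; apply: eq_bigr => l _.
  by rewrite -scalerBl scalerA.
under eq_bigr do rewrite exchange_big.
rewrite exchange_big; apply: eq_bigr => k _ /=.
under eq_bigr do rewrite exchange_big.
rewrite exchange_big; apply: eq_bigr => l _ /=.
by rewrite ra scaler_suml; apply: eq_bigr => i _; rewrite scaler_suml.
Qed.

End Module.

Lemma bracket_linear (xi : dual g) x : linear_map (W := R^o) (fun y => xi (lie_bracket x y)).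
Proof.
move=> a y z; rewrite lie_skew lie_linear opprD -scalerN -!(lie_skew x).
by rewrite linearP.
Qed.

(** By skewness [c n (v j) = - c j (v n)], and the numbers [c j (v n)] are the coordinates of [v n],
    so the sum reassembles the second argument of the bracket. *)
Lemma bracket_contraction (xi : dual g) x n :
  \sum_j c n (v j) * xi (lie_bracket x (e j)) = - xi (lie_bracket x (v n)).
Proof.
rewrite (linear_mapE (bracket_linear xi x)) -sumrN; apply: eq_bigr => j _.
by rewrite !bivector_mapE bv_skew mulNr.
Qed.

Lemma sum_dual_basis l (G : _ -> R) : \sum_i c l (e i) * G i = G l.
Proof.
rewrite (bigD1 l) //= dual_basis eqxx mul1r big1 ?addr0 // => i il.
by rewrite dual_basis eq_sym (negbTE il) mul0r.
Qed.

(* The left-hand side contracts [F] with [r13, r23] + [r12, r23] + [r12, r13]. *)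
Lemma yang_baxter_contraction (W : lmodType R) (F : g -> g -> g -> W) :
  yang_baxter r -> trilinear_map F ->
  \sum_i \sum_j (F (e i) (e j) (lie_bracket (v i) (v j))
    + F (e i) (lie_bracket (v i) (e j)) (v j)
    - F (lie_bracket (v i) (e j)) (e i) (v j)) = 0.
Proof.
move=> yb Ft; pose K i j l m n : R :=
  c l (e i) * c m (e j) * c n (lie_bracket (v i) (v j))
  + c l (e i) * c m (lie_bracket (v i) (e j)) * c n (v j)
  - c l (lie_bracket (v i) (e j)) * c m (e i) * c n (v j).
transitivity (\sum_i \sum_j \sum_l \sum_m \sum_n K i j l m n *: F (e l) (e m) (e n)).
  apply: eq_bigr => i _; apply: eq_bigr => j _; rewrite !(trilinear_mapE Ft).
  rewrite -big_split -sumrB; apply: eq_bigr => l _ /=.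
  rewrite -big_split -sumrB; apply: eq_bigr => m _ /=.
  rewrite -big_split -sumrB; apply: eq_bigr => n _ /=.
  by rewrite -scalerDl -scalerBl.
under eq_bigr do rewrite exchange_big.
rewrite exchange_big big1 // => l _.
under eq_bigr do rewrite exchange_big.
rewrite exchange_big big1 // => m _.
under eq_bigr do rewrite exchange_big.
rewrite exchange_big big1 // => n _.
under eq_bigr do rewrite -scaler_suml.
rewrite -scaler_suml [X in X *: _](_ : _ = 0) ?scale0r //.
(* After the sums are exchanged, the coefficient of [F (e l) (e m) (e n)] is the Yang-Baxter
   expression at [c l], [c m], [c n]. *)
rewrite -[RHS](yb (c l) (c m) (c n)) -/(v l) -/(v m) -/(v n).
have -> : \sum_i \sum_j K i j l m n =
   \sum_i c l (e i) * (\sum_j c m (e j) * c n (lie_bracket (v i) (v j)))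
   + \sum_i c l (e i) * (\sum_j c n (v j) * c m (lie_bracket (v i) (e j)))
   - \sum_i c m (e i) * (\sum_j c n (v j) * c l (lie_bracket (v i) (e j))).
  rewrite -big_split -sumrB; apply: eq_bigr => i _ /=; rewrite !mulr_sumr -big_split -sumrB.
  by apply: eq_bigr => j _; rewrite /K /=; ring.
rewrite !sum_dual_basis !bracket_contraction (lie_skew (v n) (v l)) (linearN (c m)); ring.
Qed.

End Contraction.

(** * Values of 1-forms, and constant functions *)

Section OneForms.
Variables (R : realType) (d : nat) (P : manifold R d).
Implicit Types (X Y Z : vfield P) (f : Cinf P) (alpha beta w : pform P).

Lemma form1_linear alpha f X Y : is_form 1 alpha ->
  alpha [:: f *: X + Y] = f * alpha [:: X] + alpha [:: Y].
Proof. by case=> _ al _; exact: (al [::] [::]). Qed.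

Lemma form1_add alpha X Y : is_form 1 alpha ->
  alpha [:: X + Y] = alpha [:: X] + alpha [:: Y].
Proof. by move=> a1; rewrite -[X in LHS]scale1r form1_linear // mul1r. Qed.

Lemma form1_0 alpha : is_form 1 alpha -> alpha [:: 0] = 0.
Proof. by move=> a1; apply: (addIr (alpha [:: 0])); rewrite -form1_add // !add0r. Qed.

Lemma form1_scale alpha f X : is_form 1 alpha -> alpha [:: f *: X] = f * alpha [:: X].
Proof. by move=> a1; rewrite -[f *: X]addr0 form1_linear // form1_0 // addr0. Qed.

Lemma form1_opp alpha X : is_form 1 alpha -> alpha [:: - X] = - alpha [:: X].
Proof. by move=> a1; apply: (addIr (alpha [:: X])); rewrite -form1_add // !addNr form1_0. Qed.

Lemma form1_sum (I : Type) (s : seq I) (Q : pred I) (F : I -> vfield P) alpha :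
  is_form 1 alpha -> alpha [:: \sum_(i <- s | Q i) F i] = \sum_(i <- s | Q i) alpha [:: F i].
Proof.
move=> a1; apply: (big_morph (fun X => alpha [:: X])); last exact: form1_0.
by move=> X Y; exact: form1_add.
Qed.

Lemma form1P alpha beta : is_form 1 alpha -> is_form 1 beta ->
  (forall X, alpha [:: X] = beta [:: X]) -> alpha = beta.
Proof.
move=> [a0 _ _] [b0 _ _] ab; apply: pformP => s.
case: s => [|X [|Y s]]; [by rewrite a0 // b0|exact: ab|by rewrite a0 // b0].
Qed.

Lemma vf_const X (a : R) : X (a *: (1 : Cinf P)) = 0.
Proof.
rewrite vfZ; have -> : X 1 = 0; last by rewrite scaler0.
have := vf_leibniz X 1 1; rewrite !mulr1 mul1r => /eqP.
by rewrite -subr_eq0 opprD addNKr oppr_eq0 => /eqP.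
Qed.

Lemma df_const (a : R) : df (a *: (1 : Cinf P)) = 0 :> pform P.
Proof.
apply: pform_nilP; first exact: df_nil.
move=> X; rewrite interior_df vf_const; apply: pformP => -[|Y s] //.
Qed.

Lemma vf_sum X (I : Type) (s : seq I) (Q : pred I) (F : I -> Cinf P) :
  X (\sum_(i <- s | Q i) F i) = \sum_(i <- s | Q i) X (F i).
Proof. exact: (big_morph X (vfD X) (vf0 X)). Qed.

End OneForms.

(** Replaces a real scalar by a function, so that [ring] can settle identities that mix scaling and
    multiplication. *)
Lemma scale_is_mul (R : realType) (d : nat) (P : manifold R d) (a : R) :
  exists q : Cinf P, forall f, a *: f = q * f.
Proof. by exists (a *: (1 : Cinf P)) => f; exact: Cinf_scale_mul1. Qed.

(** * The connection of a Yang-Baxter solution *)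

Section Geometry.
Variables (R : realType) (d : nat) (P : manifold R d) (g : lie_algebra R).
Variables (Gamma : g -> vfield P) (r : bivector g).
Hypotheses (hGamma : lie_morphism Gamma).
Implicit Types (X Y Z : vfield P) (f h : Cinf P) (alpha beta w sigma rho : pform P).

Let U k := Gamma (basis_vec k).
Let V k := Gamma (r_vec r k).

Definition r_connection alpha w : pform P :=
  \sum_k fscale (alpha [:: Gamma (basis_vec k)]) (lie (Gamma (r_vec r k)) w).

Definition r_bivector alpha beta : Cinf P :=
  \sum_k alpha [:: Gamma (basis_vec k)] * beta [:: Gamma (r_vec r k)].

Definition r_anchor alpha : vfield P :=
  \sum_k alpha [:: Gamma (basis_vec k)] *: Gamma (r_vec r k).

Lemma GammaP (a : R) x y : Gamma (a *: x + y) = (a *: (1 : Cinf P)) *: Gamma x + Gamma y.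
Proof. by case: hGamma => + _; apply. Qed.

Lemma form1_Gamma alpha (a : R) x y : is_form 1 alpha ->
  alpha [:: Gamma (a *: x + y)] = a *: alpha [:: Gamma x] + alpha [:: Gamma y].
Proof. by move=> a1; rewrite GammaP form1_linear // -Cinf_scale_mul1. Qed.

Lemma vf_Gamma (a : R) x y f : Gamma (a *: x + y) f = a *: Gamma x f + Gamma y f.
Proof.
rewrite GammaP; change ((a *: (1 : Cinf P)) * Gamma x f + Gamma y f = a *: Gamma x f + Gamma y f).
by rewrite -Cinf_scale_mul1.
Qed.

(** Over functions [lie] is not linear in the vector field, but the correction carries the
    differential of the coefficient, which vanishes for a constant. *)
Lemma lie_Gamma k (a : R) x y w : is_form k w ->
  lie (Gamma (a *: x + y)) w = a *: lie (Gamma x) w + lie (Gamma y) w.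
Proof.
move=> wk; rewrite GammaP (lie_addl _ _ wk) (lie_scale _ _ wk) df_const wedge0l addr0.
by rewrite -pform_scale_fscale.
Qed.

Lemma r_anchorE alpha f : r_anchor alpha f =
  \sum_k alpha [:: Gamma (basis_vec k)] * Gamma (r_vec r k) f.
Proof. exact: vf_sumE. Qed.

Lemma form_r_anchor alpha beta : is_form 1 beta ->
  beta [:: r_anchor alpha] = r_bivector alpha beta.
Proof.
by move=> b1; rewrite form1_sum //; apply: eq_bigr => k _; rewrite form1_scale.
Qed.

Lemma r_bivectorC alpha beta : is_form 1 alpha -> is_form 1 beta ->
  r_bivector alpha beta = - r_bivector beta alpha.
Proof.
move=> a1 b1; have B : bilinear_map (fun x y => beta [:: Gamma x] * alpha [:: Gamma y]).
  split=> [y|x] a x1 x2; rewrite form1_Gamma //.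
    by rewrite mulrDl -Cinf_scalerAl.
  by rewrite mulrDr -Cinf_scalerAr.
rewrite /r_bivector -(contraction_skew r B).
by apply: eq_bigr => k _; exact: mulrC.
Qed.

Lemma is_form_r_connection k alpha w : is_form k w -> is_form k (r_connection alpha w).
Proof. by move=> wk; apply: is_form_sum => i _; apply: is_form_fscale; exact: is_form_lie. Qed.

Lemma r_connection_form0 alpha f : r_connection alpha (form0 f) = form0 (r_anchor alpha f).
Proof.
apply: pform_nilP => [|X].
  rewrite /r_connection pform_sumE /= r_anchorE; apply: eq_bigr => k _.
  by rewrite fscaleE lie_nil.
rewrite interior_form0E; apply: interior_form0.
by apply: is_form_r_connection; exact: form0_form.
Qed.

Lemma r_connection_addl alpha alpha' w :
  r_connection (alpha + alpha') w = r_connection alpha w + r_connection alpha' w.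
Proof.
rewrite /r_connection -big_split; apply: eq_bigr => k _ /=.
by rewrite -fscaleDl.
Qed.

Lemma r_connection_fscalel f alpha w :
  r_connection (fscale f alpha) w = fscale f (r_connection alpha w).
Proof.
rewrite /r_connection fscale_sum; apply: eq_bigr => k _ /=.
by rewrite fscaleA.
Qed.

Lemma r_connection_addr alpha w w' :
  r_connection alpha (w + w') = r_connection alpha w + r_connection alpha w'.
Proof.
rewrite /r_connection -big_split; apply: eq_bigr => k _ /=.
by rewrite lieD fscaleD.
Qed.

Lemma r_connection_fscaler f alpha w : r_connection alpha (fscale f w) =
  fscale f (r_connection alpha w) + fscale (r_anchor alpha f) w.
Proof.
rewrite /r_connection r_anchorE fscale_sum fscale_suml -big_split; apply: eq_bigr => k _ /=.
by rewrite lie_fscale fscaleD !fscaleA [alpha _ * _]mulrC.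
Qed.

Lemma r_connection_wedge alpha w w' : r_connection alpha (wedge w w') =
  wedge (r_connection alpha w) w' + wedge w (r_connection alpha w').
Proof.
rewrite /r_connection wedge_suml wedge_sumr -big_split; apply: eq_bigr => k _ /=.
by rewrite lie_wedge fscaleD wedge_fscalel wedge_fscaler.
Qed.

(** By the Leibniz rule [lie (r_anchor alpha) beta] exceeds [r_connection alpha beta] by the sum of
    the [beta(V k) d(alpha(U k))]. Exchanging the legs of [r] in the excess with [alpha] and [beta]
    swapped makes the difference of the two the differential of [r_bivector alpha beta]. *)
Lemma r_torsion_free alpha beta : is_form 1 alpha -> is_form 1 beta ->
  r_connection alpha beta - r_connection beta alpha =
  lie (r_anchor alpha) beta - lie (r_anchor beta) alpha - df (r_bivector alpha beta).
Proof.
move=> a1 b1.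
have lie_anchor alpha' beta' Y : is_form 1 beta' -> lie (r_anchor alpha') beta' [:: Y] =
    r_connection alpha' beta' [:: Y] + \sum_k Y (alpha' [:: U k]) * beta' [:: V k].
  move=> b1'; rewrite lie1E liebC form1_opp // opprK.
  rewrite /r_connection pform_sumE -big_split r_anchorE.
  have -> : lieb Y (r_anchor alpha') =
      \sum_k (alpha' [:: U k] *: lieb Y (V k) + Y (alpha' [:: U k]) *: V k).
    rewrite /r_anchor (big_morph (lieb Y) (liebDr Y) (lieb0r Y)).
    by apply: eq_bigr => k _; rewrite lieb_scaler.
  rewrite form1_sum // -big_split; apply: eq_bigr => k _ /=.
  rewrite form1_linear // form1_scale // fscaleE lie1E (liebC Y) form1_opp //; ring.
apply: form1P => [||Y].
- by apply: is_formB; apply: is_form_r_connection.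
- by apply: is_formB; [apply: is_formB; exact: is_form_lie|exact: is_form_df].
rewrite !(pform_addE, pform_oppE) !lie_anchor // dfE.
have -> : \sum_k Y (beta [:: U k]) * alpha [:: V k] = - \sum_k alpha [:: U k] * Y (beta [:: V k]).
  have B : bilinear_map (fun x y => alpha [:: Gamma x] * Y (beta [:: Gamma y])).
    split=> [y|x] a x1 x2; rewrite form1_Gamma // ?vf_linear.
      by rewrite mulrDl -Cinf_scalerAl.
    by rewrite mulrDr -Cinf_scalerAr.
  by rewrite -(contraction_skew r B); apply: eq_bigr => k _; exact: mulrC.
have -> : Y (r_bivector alpha beta) = \sum_k Y (alpha [:: U k]) * beta [:: V k]
    + \sum_k alpha [:: U k] * Y (beta [:: V k]).
  rewrite vf_sum -big_split; apply: eq_bigr => k _ /=.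
  by rewrite vf_leibniz addrC.
ring.
Qed.

Hypothesis hr : yang_baxter r.

(** Stated in all degrees, to cover functions as well as 1-forms, and with the commutator of
    [r_connection] in place of the Koszul bracket. Derivatives of the coefficients cancel against
    those in that commutator, second Lie derivatives combine into Lie derivatives along brackets,
    and the terms left over are those of the Yang-Baxter contraction. *)
Lemma r_flat k alpha beta w : is_form 1 alpha -> is_form 1 beta -> is_form k w ->
  r_connection alpha (r_connection beta w) - r_connection beta (r_connection alpha w)
  = r_connection (r_connection alpha beta - r_connection beta alpha) w.
Proof.
move=> a1 b1 wk; apply: pformP => s.
have lie_con alpha' i : lie (V i) (r_connection alpha' w) s = \sum_j
    (alpha' [:: U j] * lie (V i) (lie (V j) w) s + V i (alpha' [:: U j]) * lie (V j) w s).
  rewrite lie_sum pform_sumE; apply: eq_bigr => j _.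
  by rewrite lie_fscale pform_addE !fscaleE.
have con_con alpha' beta' : r_connection alpha' (r_connection beta' w) s =
    \sum_i \sum_j alpha' [:: U i] * (beta' [:: U j] * lie (V i) (lie (V j) w) s
       + V i (beta' [:: U j]) * lie (V j) w s).
  rewrite /r_connection pform_sumE; apply: eq_bigr => i _.
  by rewrite fscaleE -/(r_connection beta' w) lie_con mulr_sumr.
have con_U alpha' beta' j : r_connection alpha' beta' [:: U j] =
    \sum_i alpha' [:: U i] * (V i (beta' [:: U j]) - beta' [:: lieb (V i) (U j)]).
  by rewrite /r_connection pform_sumE; apply: eq_bigr => i _; rewrite fscaleE lie1E.
apply/eqP; rewrite -subr_eq0; apply/eqP.
pose F x y z := alpha [:: Gamma x] * beta [:: Gamma y] * lie (Gamma z) w s.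
have Ft : trilinear_map F.
  split=> [z|x y]; [split=> [y|x]|] => a x1 x2; rewrite /F.
  - by rewrite form1_Gamma //; have [q qE] := scale_is_mul P a; rewrite !qE; ring.
  - by rewrite form1_Gamma //; have [q qE] := scale_is_mul P a; rewrite !qE; ring.
  - rewrite (lie_Gamma _ _ _ wk) pform_addE pform_scaleE.
    by have [q qE] := scale_is_mul P a; rewrite !qE; ring.
have GL x y : Gamma (lie_bracket x y) = lieb (Gamma x) (Gamma y) by case: hGamma.
have conE alpha' : r_connection alpha' w s = \sum_j alpha' [:: U j] * lie (V j) w s.
  by rewrite /r_connection pform_sumE; apply: eq_bigr => j _; rewrite fscaleE.
(* The indices are exchanged in the second-order part only, to match its coefficients with those of
   the other composition. *)
have S2 : r_connection beta (r_connection alpha w) s = \sum_i \sum_j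
    (alpha [:: U i] * beta [:: U j] * lie (V j) (lie (V i) w) s
     + beta [:: U i] * V i (alpha [:: U j]) * lie (V j) w s).
  rewrite con_con; transitivity (\sum_i \sum_j
      beta [:: U i] * alpha [:: U j] * lie (V i) (lie (V j) w) s
    + \sum_i \sum_j beta [:: U i] * V i (alpha [:: U j]) * lie (V j) w s).
    rewrite -big_split; apply: eq_bigr => i _; rewrite -big_split; apply: eq_bigr => j _ /=.
    ring.
  rewrite exchange_big -big_split; apply: eq_bigr => i _; rewrite -big_split.
  by apply: eq_bigr => j _ /=; rewrite [beta _ * _]mulrC.
have S3 : r_connection (r_connection alpha beta - r_connection beta alpha) w s =
  \sum_i \sum_j (alpha [:: U i] * (V i (beta [:: U j]) - beta [:: lieb (V i) (U j)])
    - beta [:: U i] * (V i (alpha [:: U j]) - alpha [:: lieb (V i) (U j)])) * lie (V j) w s.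
  rewrite conE exchange_big; apply: eq_bigr => j _ /=.
  by rewrite pform_addE pform_oppE !con_U -sumrB mulr_suml.
rewrite -[RHS](yang_baxter_contraction hr Ft) /F.
rewrite pform_addE pform_oppE S2 S3 con_con -!sumrB; apply: eq_bigr => i _.
rewrite -!sumrB; apply: eq_bigr => j _; rewrite !GL (lie_lieb _ _ wk) pform_addE pform_oppE.
rewrite -/(U _) -/(U _) -/(V _) -/(V _); ring.
Qed.

(** As [lie] commutes with [ext_d], the first two terms each contribute
    [df (r_bivector (df f) (df h))], the second after a change of sign by skewness, and the third
    removes one of the two copies. *)
Lemma koszul_exact f h : lie (r_anchor (df f)) (df h) - lie (r_anchor (df h)) (df f)
  - df (r_bivector (df f) (df h)) = df (r_bivector (df f) (df h)) :> pform P.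
Proof.
have E f1 f2 : lie (r_anchor (df f1)) (df f2) = df (r_bivector (df f1) (df f2)).
  rewrite /df (lie_ext_d _ (form0_form f2)); congr ext_d.
  apply: pform_nilP => [|X]; last first.
    by rewrite interior_form0E; apply: interior_form0; apply: is_form_lie; exact: form0_form.
  by rewrite lie_nil /= -[LHS]dfE form_r_anchor //; exact: is_form_df.
rewrite !E (r_bivectorC (is_form_df h) (is_form_df f)).
have dN q : df (- q) = - df q :> pform P.
  apply: form1P => [||X]; [exact: is_form_df|apply: is_formN; exact: is_form_df|].
  by rewrite pform_oppE !dfE vfN.
by rewrite dN opprK addrK.
Qed.

Lemma r_jacobi f1 f2 f3 : let br f h := r_bivector (df f) (df h) in
  br f1 (br f2 f3) + br f2 (br f3 f1) + br f3 (br f1 f2) = 0.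
Proof.
move=> br; have brC f h : br f h = - br h f by apply: r_bivectorC; exact: is_form_df.
have brN f h : br f (- h) = - br f h.
  rewrite /br /r_bivector -sumrN; apply: eq_bigr => k _; by rewrite !dfE vfN mulrN.
have anchor_br f h : r_anchor (df f) h = br f h.
  by rewrite -[LHS]dfE form_r_anchor //; exact: is_form_df.
have := r_flat (is_form_df f1) (is_form_df f2) (form0_form f3).
rewrite r_torsion_free ?koszul_exact; try exact: is_form_df.
move/(congr1 (fun w : pform P => w [::])).
rewrite pform_addE pform_oppE !r_connection_form0 /= !anchor_br => E.
rewrite (brC f3 (br f1 f2)) -[br (br f1 f2) f3]E (brC f3 f1) brN.
ring.
Qed.

End Geometry.

(** * Metacurvature *)

Section Locality.
Variables (R : realType) (d : nat) (P : manifold R d).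

(** The local frame at [p] writes [fscale b alpha], not [alpha] itself, as a combination of
    differentials. As [N] commutes with the factor [b] and [b p = 1], this is enough for the value
    at [p]. *)
Lemma tensor_vanish (N : pform P -> pform P) :
  (forall f alpha alpha', is_form 1 alpha -> is_form 1 alpha' ->
     N (fscale f alpha + alpha') = fscale f (N alpha) + N alpha') ->
  (forall f, N (df f) = 0) -> forall alpha, is_form 1 alpha -> N alpha = 0.
Proof.
move=> Nl Ndf alpha a1; have z1 := is_form_zero P 1.
have N0 : N 0 = 0.
  by apply: (addIr (N 0)); rewrite -{1}[N 0]fscale1 -Nl // fscale1 !add0r.
have ND w w' : is_form 1 w -> is_form 1 w' -> N (w + w') = N w + N w'.
  by move=> w1 w1'; rewrite -[w in LHS]fscale1 Nl // fscale1.
have NZ f w : is_form 1 w -> N (fscale f w) = fscale f (N w).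
  by move=> w1; rewrite -[fscale f w]addr0 Nl // N0 addr0.
apply: pformP => s; apply: CinfP => p.
have [b [x [X [bp _ frame]]]] := local_frame p.
have : fscale b alpha = \sum_i fscale (alpha [:: X i]) (df (x i)).
  apply: form1P => [||Y].
  - exact: is_form_fscale.
  - by apply: is_form_sum => i _; apply: is_form_fscale; exact: is_form_df.
  rewrite fscaleE pform_sumE -form1_scale // frame form1_sum //.
  by apply: eq_bigr => i _; rewrite form1_scale // fscaleE dfE mulrC.
move/(congr1 N); rewrite NZ //.
have -> : N (\sum_i fscale (alpha [:: X i]) (df (x i))) = 0.
  (* Additivity of [N] is available on 1-forms only, so the induction over the sum carries along
     that the partial sums are 1-forms. *)
  have : is_form 1 (\sum_i fscale (alpha [:: X i]) (df (x i))) /\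
      N (\sum_i fscale (alpha [:: X i]) (df (x i))) = 0; last by case.
  elim/big_ind: _ => [//|w w' [w1 Nw] [w1' Nw']|i _].
    by split; [exact: is_formD|rewrite ND // Nw Nw' addr0].
  have dx := is_form_df (x i).
  by split; [exact: is_form_fscale|rewrite NZ // Ndf fscale0].
move/(congr1 (fun w : pform P => w s p)); rewrite fscaleE Cinf_mulE bp mul1r.
by [].
Qed.

Lemma ext_d_df (f : Cinf P) : ext_d (df f) = 0.
Proof.
apply: pform_nilP => [|X]; first exact: ext_d_nil.
rewrite (interior_d _ (is_form_df f)) /df (lie_ext_d _ (form0_form f)).
rewrite -/(df f) interior_df -ext_dN -ext_dD (_ : _ - _ = 0) ?ext_d0 //.
apply: pform_nilP => [|Y]; first by rewrite pform_addE pform_oppE lie_nil subrr.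
by rewrite interiorD interiorN interior_form0E interior_lie !interior_form0E lie0 !subr0.
Qed.

End Locality.

(** * Two generalized Poisson brackets compared on forms built from differentials *)

Section BracketAgreement.
Variables (R : realType) (d : nat) (P : manifold R d).
Variables (pi : pform P -> pform P -> Cinf P) (D : pform P -> pform P -> pform P).
Variables br1 br2 : pform P -> pform P -> pform P.
Hypotheses (H1 : generalized_poisson_bracket pi D br1)
           (H2 : generalized_poisson_bracket pi D br2).
Implicit Types (f q h : Cinf P) (alpha beta w : pform P).

Lemma agree_fun_form f alpha : is_form 1 alpha ->
  br1 (form0 f) alpha = br2 (form0 f) alpha.
Proof.
move=> a1; have d1 := is_form_df f.
have [E1 X1 br1E] := gpb_connection H1; have [E2 X2 br2E] := gpb_connection H2.
by rewrite (br1E _ _ _ a1) (br2E _ _ _ a1) (ext_form1 X1) // (ext_form1 X2).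
Qed.

(** The extensions of [D] that come with the two brackets are compared on sums of products of
    1-forms, where the derivation rule reduces both to [D]. *)
Lemma agree_fun_wedge f (n : nat) (F G : 'I_n -> pform P) :
  (forall i, is_form 1 (F i)) -> (forall i, is_form 1 (G i)) ->
  br1 (form0 f) (\sum_i wedge (F i) (G i)) = br2 (form0 f) (\sum_i wedge (F i) (G i)).
Proof.
move=> F1 G1; have d1 := is_form_df f.
have [E1 X1 br1E] := gpb_connection H1; have [E2 X2 br2E] := gpb_connection H2.
have w2 i : is_form 2 (wedge (F i) (G i)) by exact: (is_form_wedge (F1 i) (G1 i)).
have z2 := is_form_zero P 2.
have S2 : is_form 2 (\sum_i wedge (F i) (G i)) by apply: is_form_sum => i _.
rewrite (br1E _ _ _ S2) (br2E _ _ _ S2).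
have E0 E (X : extension_to_forms pi D E) : E (df f) 0 = 0.
  apply: (addIr (E (df f) 0)).
  by rewrite -{1}[E (df f) 0]scale1r -(ext_linear X _ d1 z2 z2) scale1r !add0r.
have ED E (X : extension_to_forms pi D E) w w' : is_form 2 w -> is_form 2 w' ->
    E (df f) (w + w') = E (df f) w + E (df f) w'.
  by move=> wk wk'; rewrite -[w in LHS]scale1r (ext_linear X _ d1 wk wk') scale1r.
have : is_form 2 (\sum_i wedge (F i) (G i)) /\
    E1 (df f) (\sum_i wedge (F i) (G i)) = E2 (df f) (\sum_i wedge (F i) (G i)); last by case.
elim/big_ind: _ => [|w w' [w1 Nw] [w1' Nw']|i _].
- by split => //; rewrite !E0.
- by split; [exact: is_formD|rewrite !ED // Nw Nw'].
split; first exact: w2.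
rewrite (ext_wedge X1 d1 (F1 i) (G1 i)) (ext_wedge X2 d1 (F1 i) (G1 i)).
by rewrite !(ext_form1 X1) // !(ext_form1 X2).
Qed.

(* [{df, dh} = d{f, dh}] since [ddh = 0]. *)
Lemma bracket_exact br f h : generalized_poisson_bracket pi D br ->
  br (df f) (df h) = ext_d (br (form0 f) (df h)).
Proof.
move=> H; have f0 := form0_form f; have h1 := is_form_df h; have z2 := is_form_zero P 2.
rewrite (gpb_d H f0 h1) ext_d_df expr0 scale1r.
have -> : br (form0 f) 0 = 0; last by rewrite addr0.
apply: (addIr (br (form0 f) 0)).
by rewrite -{1}[br _ 0]scale1r -(gpb_linearr H _ f0 z2 z2) scale1r !add0r.
Qed.

Lemma agree_exact f h : br1 (df f) (df h) = br2 (df f) (df h).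
Proof.
rewrite (bracket_exact _ _ H1) (bracket_exact _ _ H2) agree_fun_form //.
exact: is_form_df.
Qed.

(** The product rule concerns the second argument, so skewness is applied before it and once more
    after it. Between two 1-forms the bracket is symmetric. *)
Lemma bracket_fscale_exact br q f h : generalized_poisson_bracket pi D br ->
  br (fscale q (df f)) (df h) =
    - wedge (br (form0 q) (df h)) (df f) + fscale q (br (df h) (df f)).
Proof.
move=> H; have f1 := is_form_df f; have h1 := is_form_df h; have q0 := form0_form q.
rewrite (gpb_skew H (is_form_fscale q f1) h1) expr1 scaleN1r opprK.
rewrite -wedge_form0 (gpb_wedge H h1 q0 f1) expr0 scale1r wedge_form0.
by rewrite (gpb_skew H h1 q0) expr0 scale1r wedgeNl.
Qed.

(** Made for the iterated brackets in the metacurvature: the bracket of a function with a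
    differential is such a combination of differentials. *)
Lemma agree_sum_exact (n : nat) (q f : 'I_n -> Cinf P) h :
  br1 (\sum_i fscale (q i) (df (f i))) (df h) = br2 (\sum_i fscale (q i) (df (f i))) (df h).
Proof.
have h1 := is_form_df h; have z1 := is_form_zero P 1.
have B0 br (H : generalized_poisson_bracket pi D br) : br 0 (df h) = 0.
  apply: (addIr (br 0 (df h))).
  by rewrite -{1}[br 0 _]scale1r -(gpb_linearl H _ z1 z1 h1) scale1r !add0r.
have BD br (H : generalized_poisson_bracket pi D br) w w' : is_form 1 w -> is_form 1 w' ->
    br (w + w') (df h) = br w (df h) + br w' (df h).
  by move=> w1 w1'; rewrite -[w in LHS]scale1r (gpb_linearl H _ w1 w1' h1) scale1r.
have : is_form 1 (\sum_i fscale (q i) (df (f i))) /\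
    br1 (\sum_i fscale (q i) (df (f i))) (df h) = br2 (\sum_i fscale (q i) (df (f i))) (df h);
  last by case.
elim/big_ind: _ => [|w w' [w1 Nw] [w1' Nw']|i _].
- by split => //; rewrite !B0.
- by split; [exact: is_formD|rewrite !BD // Nw Nw'].
split; first by apply: is_form_fscale; exact: is_form_df.
rewrite (bracket_fscale_exact _ _ _ H1) (bracket_fscale_exact _ _ _ H2) agree_exact.
by rewrite agree_fun_form.
Qed.

End BracketAgreement.

(** * The generalized Poisson bracket of [r] *)

Section GeneralizedBracket.
Variables (R : realType) (d : nat) (P : manifold R d) (g : lie_algebra R).
Variables (Gamma : g -> vfield P) (r : bivector g).
Hypotheses (hGamma : lie_morphism Gamma).
Implicit Types (X Y Z : vfield P) (f h : Cinf P) (alpha beta w sigma rho lambda : pform P).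

Let U k := Gamma (basis_vec k).
Let V k := Gamma (r_vec r k).

Definition r_bracket sigma rho : pform P :=
  \sum_k wedge (lie (Gamma (basis_vec k)) sigma) (lie (Gamma (r_vec r k)) rho).

Lemma is_form_r_bracket k l sigma rho : is_form k sigma -> is_form l rho ->
  is_form (k + l) (r_bracket sigma rho).
Proof.
by move=> sk rl; apply: is_form_sum => i _; apply: is_form_wedge; exact: is_form_lie.
Qed.

Lemma lie_form0 X f : lie X (form0 f) = form0 (X f).
Proof.
apply: pform_nilP => [|Y]; first by rewrite lie_nil.
by rewrite interior_form0E; apply: interior_form0; apply: is_form_lie; exact: form0_form.
Qed.

Lemma r_bracket_fun f sigma : r_bracket (form0 f) sigma = r_connection Gamma r (df f) sigma.
Proof.
by apply: eq_bigr => k _; rewrite lie_form0 wedge_form0 dfE.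
Qed.

Lemma r_bracket_linearl (a : R) sigma sigma' rho :
  r_bracket (a *: sigma + sigma') rho = a *: r_bracket sigma rho + r_bracket sigma' rho.
Proof.
rewrite /r_bracket scaler_sumr -big_split; apply: eq_bigr => k _ /=.
by rewrite (lieD _ (a *: sigma)) lieZ wedgeDl wedgeZl.
Qed.

Lemma r_bracket_linearr (a : R) sigma rho rho' :
  r_bracket sigma (a *: rho + rho') = a *: r_bracket sigma rho + r_bracket sigma rho'.
Proof.
rewrite /r_bracket scaler_sumr -big_split; apply: eq_bigr => k _ /=.
by rewrite (lieD _ (a *: rho)) lieZ wedgeDr wedgeZr.
Qed.

Lemma r_bracket_skew k l sigma rho : is_form k sigma -> is_form l rho ->
  r_bracket sigma rho = - ((-1 : R) ^+ (k * l) *: r_bracket rho sigma).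
Proof.
move=> sk rl.
have B : bilinear_map (fun x y => wedge (lie (Gamma x) rho) (lie (Gamma y) sigma)).
  split=> [y|x] a x1 x2.
    by rewrite (lie_Gamma hGamma _ _ _ rl) wedgeDl wedgeZl.
  by rewrite (lie_Gamma hGamma _ _ _ sk) wedgeDr wedgeZr.
rewrite -scalerN -(contraction_skew r B) scaler_sumr; apply: eq_bigr => i _.
by apply: wedgeC; exact: is_form_lie.
Qed.

Lemma r_bracket_ext_d k l sigma rho : is_form k sigma -> is_form l rho ->
  ext_d (r_bracket sigma rho)
  = r_bracket (ext_d sigma) rho + (-1 : R) ^+ k *: r_bracket sigma (ext_d rho).
Proof.
move=> sk rl; rewrite /r_bracket ext_d_sum scaler_sumr -big_split; apply: eq_bigr => i _ /=.
rewrite (ext_d_wedge (is_form_lie _ sk) (is_form_lie _ rl)).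
by rewrite (twist_form (is_form_lie _ sk)) wedgeZl !(lie_ext_d _ sk) (lie_ext_d _ rl).
Qed.

Lemma r_bracket_wedge k l sigma rho lambda : is_form k sigma -> is_form l rho ->
  r_bracket sigma (wedge rho lambda) = wedge (r_bracket sigma rho) lambda
    + (-1 : R) ^+ (k * l) *: wedge rho (r_bracket sigma lambda).
Proof.
move=> sk rl; rewrite /r_bracket wedge_suml wedge_sumr scaler_sumr -big_split.
apply: eq_bigr => i _ /=; rewrite lie_wedge wedgeDr !wedgeA; congr (_ + _).
by rewrite (wedgeC (is_form_lie _ sk) rl) wedgeZl.
Qed.

Hypothesis hr : yang_baxter r.

(** The three iterated brackets are first brought to a common shape, with [alpha] in the left factor
    and [beta] in the right one. Their second derivatives of [f], of [alpha] and of [beta] then pair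
    off into commutators, one for each of the three terms of the contraction. *)
Lemma r_bracket_metacurvature f alpha beta : is_form 1 alpha -> is_form 1 beta ->
  r_bracket (form0 f) (r_bracket alpha beta) - r_bracket (r_bracket (form0 f) alpha) beta
  - r_bracket (r_bracket (form0 f) beta) alpha = 0.
Proof.
move=> a1 b1; rewrite !r_bracket_fun.
have lie_con X w : lie X (r_connection Gamma r (df f) w) = \sum_i
    (fscale (X (U i f)) (lie (V i) w) + fscale (U i f) (lie X (lie (V i) w))).
  by rewrite lie_sum; apply: eq_bigr => i _; rewrite dfE lie_fscale addrC.
apply: pformP => s; pose W sigma rho : Cinf P := wedge sigma rho s.
have WDl sigma sigma' rho : W (sigma + sigma') rho = W sigma rho + W sigma' rho.
  by rewrite /W wedgeDl.
have WDr sigma rho rho' : W sigma (rho + rho') = W sigma rho + W sigma rho'.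
  by rewrite /W wedgeDr.
have Wfl q sigma rho : W (fscale q sigma) rho = q * W sigma rho.
  by rewrite /W wedge_fscalel.
have Wfr q sigma rho : W sigma (fscale q rho) = q * W sigma rho.
  by rewrite /W wedge_fscaler.
have WZl (a : R) sigma rho : W (a *: sigma) rho = a *: W sigma rho.
  by rewrite /W wedgeZl.
have WZr (a : R) sigma rho : W sigma (a *: rho) = a *: W sigma rho.
  by rewrite /W wedgeZr.
have t1 : r_connection Gamma r (df f) (r_bracket alpha beta) s = \sum_i \sum_k
   U i f * (W (lie (V i) (lie (U k) alpha)) (lie (V k) beta)
     + W (lie (U k) alpha) (lie (V i) (lie (V k) beta))).
  rewrite /r_connection pform_sumE; apply: eq_bigr => i _.
  rewrite fscaleE dfE lie_sum pform_sumE mulr_sumr; apply: eq_bigr => k _.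
  by rewrite lie_wedge.
have t2 : r_bracket (r_connection Gamma r (df f) alpha) beta s = \sum_i \sum_k
   (- (U k (V i f) * W (lie (U i) alpha) (lie (V k) beta))
    + U i f * W (lie (U k) (lie (V i) alpha)) (lie (V k) beta)).
  rewrite /r_bracket pform_sumE exchange_big; apply: eq_bigr => k _ /=.
  rewrite lie_con wedge_suml pform_sumE big_split /= sumrN.
  (* Exchanging the legs of index [i] in the first kind of term leaves [alpha] differentiated along
     [U i] and [f] along [V i], as in the other two expressions. *)
  have B : bilinear_map (fun x y => U k (Gamma x f) * W (lie (Gamma y) alpha) (lie (V k) beta)).
    split=> [y|x] a x1 x2.
      rewrite (vf_Gamma hGamma) vf_linear.
      by have [q qE] := scale_is_mul P a; rewrite !qE; ring.
    rewrite (lie_Gamma hGamma _ _ _ a1) WDl WZl.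
    by have [q qE] := scale_is_mul P a; rewrite !qE; ring.
  rewrite (contraction_skew r B) opprK -big_split; apply: eq_bigr => i _ /=.
  by rewrite -/(W _ _) WDl !Wfl.
have t3 : r_bracket (r_connection Gamma r (df f) beta) alpha s = \sum_i \sum_k
   (V i (U k f) * W (lie (U i) alpha) (lie (V k) beta)
    + U i f * W (lie (U k) alpha) (lie (V k) (lie (V i) beta))).
  have cb1 : is_form 1 (r_connection Gamma r (df f) beta) by exact: is_form_r_connection.
  (* Between two 1-forms the bracket is symmetric, which brings [alpha] back to the left factor. *)
  rewrite (r_bracket_skew cb1 a1) expr1 scaleN1r opprK /r_bracket pform_sumE.
  transitivity (\sum_k \sum_i (V k (U i f) * W (lie (U k) alpha) (lie (V i) beta)
    + U i f * W (lie (U k) alpha) (lie (V k) (lie (V i) beta)))).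
    apply: eq_bigr => k _; rewrite lie_con wedge_sumr pform_sumE; apply: eq_bigr => i _.
    by rewrite -/(W _ _) WDr !Wfr.
  under eq_bigr do rewrite big_split.
  rewrite big_split /= [X in _ + X]exchange_big -big_split; apply: eq_bigr => i _.
  by rewrite -big_split.
have GL x y : Gamma (lie_bracket x y) = lieb (Gamma x) (Gamma y) by case: hGamma.
pose F x y z := Gamma x f * W (lie (Gamma y) alpha) (lie (Gamma z) beta).
have Ft : trilinear_map F.
  split=> [z|x y]; [split=> [y|x]|] => a x1 x2; rewrite /F.
  - rewrite (vf_Gamma hGamma).
    by have [q qE] := scale_is_mul P a; rewrite !qE; ring.
  - rewrite (lie_Gamma hGamma _ _ _ a1) WDl WZl.
    by have [q qE] := scale_is_mul P a; rewrite !qE; ring.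
  - rewrite (lie_Gamma hGamma _ _ _ b1) WDr WZr.
    by have [q qE] := scale_is_mul P a; rewrite !qE; ring.
rewrite !(pform_addE, pform_oppE) t1 t2 t3 -!sumrB.
rewrite -[RHS](yang_baxter_contraction hr Ft) /F; apply: eq_bigr => i _.
rewrite -!sumrB; apply: eq_bigr => k _; rewrite !GL (lie_lieb _ _ a1) (lie_lieb _ _ b1).
have WNl sigma rho : W (- sigma) rho = - W sigma rho by rewrite /W wedgeNl.
have WNr sigma rho : W sigma (- rho) = - W sigma rho by rewrite /W wedgeNr.
rewrite liebE (WDl (lie (V i) _)) (WDr _ (lie (V i) _)) WNl WNr -!/(U _) -!/(V _); ring.
Qed.

End GeneralizedBracket.

(** * From the expansion in a basis to the tensor [r], and the theorem *)

Section Expansion.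
Variables (R : realType) (d : nat) (P : manifold R d) (g : lie_algebra R).
Variables (Gamma : g -> vfield P) (r : bivector g).
Hypotheses (hGamma : lie_morphism Gamma).
Variables (n : nat) (u : n.-tuple g) (a : 'M[R]_n).
Hypothesis ra : bivector_expansion r u a.
Implicit Types (X Y Z : vfield P) (f h : Cinf P) (alpha beta w sigma rho lambda : pform P).

Let pi : pform P -> pform P -> Cinf P := Gamma_bivector Gamma u a.
Let D : pform P -> pform P -> pform P := Gamma_connection Gamma u a.

Lemma Gamma_bivectorE alpha beta : is_form 1 alpha -> is_form 1 beta ->
  pi alpha beta = r_bivector Gamma r alpha beta.
Proof.
move=> a1 b1; have B : bilinear_map (fun x y => alpha [:: Gamma x] * beta [:: Gamma y]).
  split=> [y|x] q x1 x2; rewrite (form1_Gamma hGamma) //.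
    by rewrite mulrDl -Cinf_scalerAl.
  by rewrite mulrDr -Cinf_scalerAr.
rewrite /r_bivector -(expansion_contraction ra B).
apply: eq_bigr => i _; apply: eq_bigr => j _.
by rewrite [alpha [:: Gamma (tnth u j)] * _]mulrC [X in _ - X]mulrC.
Qed.

Lemma Gamma_connectionE k alpha w : is_form 1 alpha -> is_form k w ->
  D alpha w = r_connection Gamma r alpha w.
Proof.
move=> a1 wk; have B : bilinear_map (fun x y => fscale (alpha [:: Gamma x]) (lie (Gamma y) w)).
  split=> [y|x] q x1 x2.
    rewrite (form1_Gamma hGamma) // fscaleDl; congr (_ + _); apply: pformP => s.
    exact: esym (Cinf_scalerAl _ _ _).
  rewrite (lie_Gamma hGamma _ _ _ wk) fscaleD; congr (_ + _); apply: pformP => s.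
  exact: esym (Cinf_scalerAr _ _ _).
by rewrite /r_connection -(expansion_contraction ra B).
Qed.

(** [anchor] picks some vector field with the right pairings; testing them on differentials shows
    that there is only one. *)
Lemma anchorE alpha : is_form 1 alpha -> anchor pi alpha = r_anchor Gamma r alpha.
Proof.
move=> a1; have ex : exists X, forall beta, is_form 1 beta -> beta [:: X] = pi alpha beta.
  by exists (r_anchor Gamma r alpha) => beta b1; rewrite form_r_anchor // Gamma_bivectorE.
have := @xgetPex _ 0 [set X | forall beta, is_form 1 beta -> beta [:: X] = pi alpha beta] ex.
rewrite -/(anchor pi alpha) => E; apply: vfP => f.
have f1 := is_form_df f.
by rewrite -[LHS]dfE -[RHS]dfE E // Gamma_bivectorE // form_r_anchor.
Qed.

Lemma koszulE alpha beta : is_form 1 alpha -> is_form 1 beta -> koszul pi alpha beta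
  = r_connection Gamma r alpha beta - r_connection Gamma r beta alpha.
Proof.
by move=> a1 b1; rewrite /koszul !anchorE // Gamma_bivectorE // r_torsion_free.
Qed.

Lemma Gamma_torsion_free : torsion_free pi D.
Proof.
move=> alpha beta a1 b1.
by rewrite (Gamma_connectionE a1 b1) (Gamma_connectionE b1 a1) koszulE.
Qed.

Lemma Gamma_contravariant : contravariant_connection pi D.
Proof.
split.
- move=> alpha beta a1 b1; rewrite (Gamma_connectionE a1 b1).
  exact: is_form_r_connection.
- move=> q alpha alpha' beta a1 a1' b1.
  rewrite !(@Gamma_connectionE 1) //; last first.
    by apply: is_formD => //; exact: is_formZ.
  by rewrite r_connection_addl !pform_scale_fscale r_connection_fscalel.
- move=> q alpha beta beta' a1 b1 b1'.
  rewrite !(@Gamma_connectionE 1) //; last first.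
    by apply: is_formD => //; exact: is_formZ.
  rewrite r_connection_addr !pform_scale_fscale r_connection_fscaler.
  by rewrite vf_const fscale0l addr0.
- move=> f alpha beta a1 b1.
  by rewrite !(@Gamma_connectionE 1) // ?r_connection_fscalel //; exact: is_form_fscale.
- move=> f alpha beta a1 b1.
  rewrite !(@Gamma_connectionE 1) // ?r_connection_fscaler ?anchorE //.
  exact: is_form_fscale.
Qed.

Lemma extension_r_connection : extension_to_forms pi D (r_connection Gamma r).
Proof.
split.
- by move=> k alpha w a1 wk; exact: is_form_r_connection.
- move=> k q alpha w w' a1 wk wk'.
  rewrite r_connection_addr !pform_scale_fscale r_connection_fscaler.
  by rewrite vf_const fscale0l addr0.
- by move=> alpha f a1; rewrite r_connection_form0 anchorE.
- by move=> alpha beta a1 b1; rewrite (Gamma_connectionE a1 b1).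
- by move=> k l alpha w w' a1 wk wl; exact: r_connection_wedge.
Qed.

Lemma r_bracket_generalized : generalized_poisson_bracket pi D (r_bracket Gamma r).
Proof.
split.
- by move=> k l sigma rho sk rl; exact: is_form_r_bracket.
- by move=> *; exact: r_bracket_linearl.
- by move=> *; exact: r_bracket_linearr.
- by move=> k l sigma rho sk rl; exact: (r_bracket_skew r hGamma sk rl).
- by move=> k l sigma rho sk rl; by apply: r_bracket_ext_d sk rl.
- by move=> k l m sigma rho lambda sk rl lm; by apply: r_bracket_wedge sk rl.
- move=> f h; rewrite r_bracket_fun r_connection_form0; congr form0.
  have f1 := is_form_df f; have h1 := is_form_df h.
  by rewrite /poisson_bracket Gamma_bivectorE // -[LHS]dfE form_r_anchor.
- exists (r_connection Gamma r); first exact: extension_r_connection.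
  by move=> k f sigma sk; exact: r_bracket_fun.
Qed.

Lemma metric_compatible (m : riemannian_metric P) :
  (forall v, im_bivector r v -> killing m (Gamma v)) ->
  forall alpha beta gamma, is_form 1 alpha -> is_form 1 beta -> is_form 1 gamma ->
    anchor pi alpha (cometric m beta gamma)
    = cometric m (D alpha beta) gamma + cometric m beta (D alpha gamma).
Proof.
move=> kill alpha beta gamma a1 b1 c1.
have kV k : killing m (Gamma (r_vec r k)) by apply: kill; exists (dual_vec k).
(* By the Killing equation, lowering the bracket of [Gamma (r_vec r k)] with [sharp m beta'] gives
   the Lie derivative of [beta']. *)
have sharpD beta' : is_form 1 beta' -> sharp m (D alpha beta') =
    \sum_k alpha [:: Gamma (basis_vec k)] *: lieb (Gamma (r_vec r k)) (sharp m beta').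
  move=> b1'; rewrite (Gamma_connectionE a1 b1').
  apply: sharp_unique => [|Y]; first exact: is_form_r_connection.
  rewrite metric_suml /r_connection pform_sumE; apply: eq_bigr => k _.
  rewrite metricZl fscaleE lie1E -!(sharpE m b1'); congr (_ * _).
  have /eqP := kV k (sharp m beta') Y.
  by rewrite subr_eq0 subr_eq addrC -subr_eq => /eqP <-.
rewrite anchorE // r_anchorE /cometric !sharpD // metric_suml metric_sumr -big_split.
apply: eq_bigr => k _ /=; rewrite metricZl metricZr -mulrDr; congr (_ * _).
have /eqP := kV k (sharp m beta) (sharp m gamma).
by rewrite subr_eq0 subr_eq addrC => /eqP.
Qed.

Hypothesis hr : yang_baxter r.

Lemma Gamma_poisson : is_poisson pi.
Proof.
split; first split.
- move=> f alpha alpha' beta a1 a1' b1.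
  rewrite !Gamma_bivectorE //; last by exact: is_form_fscaleD.
  rewrite /r_bivector mulr_sumr -big_split; apply: eq_bigr => k _ /=.
  by rewrite pform_addE fscaleE mulrDl mulrA.
- by move=> alpha beta a1 b1; rewrite !Gamma_bivectorE // r_bivectorC.
move=> f1 f2 f3 br; rewrite /br /poisson_bracket.
have d1 f := is_form_df f.
by rewrite !Gamma_bivectorE // r_jacobi.
Qed.

Lemma Gamma_flat : flat_connection pi D.
Proof.
move=> alpha beta gamma a1 b1 c1.
have con1 w w' : is_form 1 w' -> is_form 1 (r_connection Gamma r w w').
  exact: is_form_r_connection.
rewrite koszulE // (Gamma_connectionE b1 c1) (Gamma_connectionE a1 c1).
rewrite (Gamma_connectionE a1 (con1 _ _ c1)) (Gamma_connectionE b1 (con1 _ _ c1)).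
rewrite (@Gamma_connectionE 1) //; last by apply: is_formB; exact: con1.
by rewrite (r_flat hGamma hr a1 b1 c1) subrr.
Qed.

(** For existence, the bracket of [r] goes with the zero tensor, whose value on exact arguments is
    [r_bracket_metacurvature]. For an arbitrary [br], tensoriality in the three slots reduces the
    claim to differentials, and there every bracket in the defining formula is one on which [br] and
    [r_bracket] agree. *)
Lemma Gamma_metacurvature : metacurvature_vanishes pi D.
Proof.
split.
  exists (r_bracket Gamma r), (fun _ _ _ => 0); split.
    exact: r_bracket_generalized.
  split=> [*|*|*|*|f alpha beta a1 b1]; rewrite ?fscale0 ?addr0 //.
    exact: is_form_zero.
  by rewrite r_bracket_metacurvature.
move=> br M Hbr HM; have H0 := r_bracket_generalized.
have exact0 f1 f2 f3 : M (df f1) (df f2) (df f3) = 0.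
  have d1 f := is_form_df f; have L1 x f : is_form 1 (lie x (df f)) by exact: is_form_lie.
  rewrite (mc_exact HM) // -[RHS](r_bracket_metacurvature hGamma hr f1 (d1 f2) (d1 f3)).
  rewrite (agree_exact Hbr H0) (agree_fun_form Hbr H0 f1 (d1 f2)).
  rewrite (agree_fun_form Hbr H0 f1 (d1 f3)).
  (* Puts the inner brackets in the form required by [agree_sum_exact]; that of two differentials is
     already a sum of wedge products, as [agree_fun_wedge] requires. *)
  have conE f h : r_bracket Gamma r (form0 f) (df h) =
      \sum_k fscale (Gamma (basis_vec k) f) (df (Gamma (r_vec r k) h)).
    rewrite r_bracket_fun; apply: eq_bigr => k _; rewrite dfE; congr fscale.
    by rewrite {1}/df (lie_ext_d _ (form0_form h)) lie_form0.
  rewrite !conE !(agree_sum_exact Hbr H0); congr (_ - _ - _).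
  by apply: (agree_fun_wedge Hbr H0).
move=> alpha beta gamma a1 b1 c1; have d1 f := is_form_df f.
apply: (@tensor_vanish _ _ _ (fun w => M w beta gamma)) => // [f w w' w1 w1'|f1].
  exact: (mc_linear1 HM).
apply: (@tensor_vanish _ _ _ (fun w => M (df f1) w gamma)) => // [f w w' w1 w1'|f2].
  exact: (mc_linear2 HM).
apply: (@tensor_vanish _ _ _ (fun w => M (df f1) (df f2) w)) => // f w w' w1 w1'.
exact: (mc_linear3 HM).
Qed.

End Expansion.

Theorem theorem1p2 (R : realType) (d : nat) (P : manifold R d)
    (g : lie_algebra R) (Gamma : g -> vfield P) (r : bivector g)
    (hGamma : lie_morphism Gamma) (hr : yang_baxter r) :
  (forall (n : nat) (u : n.-tuple g) (a : 'M[R]_n),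
     bivector_expansion r u a ->
     let pi := Gamma_bivector Gamma u a in
     let D := Gamma_connection Gamma u a in
     [/\ [/\ is_poisson pi, contravariant_connection pi D,
             torsion_free pi D & flat_connection pi D],
         forall m : riemannian_metric P,
           (forall v, im_bivector r v -> killing m (Gamma v)) ->
           metric_contravariant_connection m pi D
       & locally_free_on Gamma (im_bivector r) ->
         metacurvature_vanishes pi D]) /\
  (forall (n n' : nat) (u : n.-tuple g) (a : 'M[R]_n)
          (u' : n'.-tuple g) (a' : 'M[R]_n'),
     bivector_expansion r u a -> bivector_expansion r u' a' ->
     forall alpha beta : pform P, is_form 1 alpha -> is_form 1 beta ->
       Gamma_bivector Gamma u a alpha beta
       = Gamma_bivector Gamma u' a' alpha beta /\
       Gamma_connection Gamma u a alpha beta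
       = Gamma_connection Gamma u' a' alpha beta).
Proof.
split=> [n u a ra pi D|n n' u a u' a' ra ra' alpha beta a1 b1].
  split; [split| |].
  - exact (Gamma_poisson hGamma ra hr).
  - exact (Gamma_contravariant hGamma ra).
  - exact (Gamma_torsion_free hGamma ra).
  - exact (Gamma_flat hGamma ra hr).
  - move=> m kill; split.
    + exact (Gamma_contravariant hGamma ra).
    + exact (Gamma_torsion_free hGamma ra).
    + exact (metric_compatible hGamma ra kill).
  - by move=> _; exact (Gamma_metacurvature hGamma ra hr).
split; first by rewrite (Gamma_bivectorE hGamma ra) // (Gamma_bivectorE hGamma ra').
by rewrite (Gamma_connectionE hGamma ra a1 b1) (Gamma_connectionE hGamma ra' a1 b1).
Qed.
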